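(* Let $\kappa$ be a consistent (positive definite) kernel on $\mathbf X$, $g:\mathbf X\to(0,\infty)$ continuous, $a=(a_i)_{i\in I}$ with all $a_i>0$, and $\mathcal A=(A_i)_{i\in I}$ an $(m,p)$-condenser with $0<\mathrm{cap}\,\mathcal A<\infty$, where $\mathrm{cap}\,\mathcal A:=\mathrm{cap}\,(\mathcal A,a,g)$. Assume that either $I^-=\varnothing$, or both $\inf_{x\in A}g(x)>0$ and $\sup_{x\in A^+,\,y\in A^-}\kappa(x,y)<\infty$. Assume $\mu\in\mathcal E(\overline{\mathcal A})$ has the properties $$\|\mu\|^2=\mathrm{cap}\,(\mathcal A,a,g),\qquad \alpha_ia_i\kappa(x,\mu)\geqslant\frac{\alpha_i\kappa(\mu^i,\mu)}{\mathrm{cap}\,\mathcal A}\,g(x)\ \text{ n.e. in }A_i,\ i\in I.$$ Then $\mu$ is equivalent in $\mathcal E(\overline{\mathcal A})$ to every $\gamma_{\mathcal A}\in\mathcal D(\mathcal A,a,g)$, and for all $i\in I$, $$C_i(\mathcal A,a,g)=\frac{\alpha_i\kappa(\mu^i,\mu)}{\mathrm{cap}\,\mathcal A}=''\!\inf_{x\in A_i}\!''\,\frac{\alpha_ia_i\kappa(x,\mu)}{g(x)},$$ where $\mathcal D(\mathcal A,a,g)$ is the set of interior capacitary distributions and $C_i(\mathcal A,a,g)$ are the interior capacitary constants associated with $\mathcal A$.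
   Context: $\mathbf X$ is a locally compact Hausdorff space; $\mathfrak M$ is the space of all real-valued (signed) Radon measures on $\mathbf X$ with the vague topology (pointwise convergence on continuous real functions with compact support). A kernel is a lower semicontinuous $\kappa:\mathbf X\times\mathbf X\to(-\infty,\infty]$, assumed $\geqslant0$ unless $\mathbf X$ is compact. Write $\kappa(\nu,\nu_1)=\int\kappa\,d(\nu\otimes\nu_1)$ (mutual energy; energy if $\nu_1=\nu$) and $\kappa(x,\nu)=\int\kappa(x,y)\,d\nu(y)$ (potential) whenever well defined. $\mathcal E$ is the set of $\nu\in\mathfrak M$ with finite energy. $\kappa$ is positive definite: symmetric with $\kappa(\nu,\nu)\geqslant0$ whenever defined; then $\mathcal E$ is a pre-Hilbert space with scalar product $\kappa(\nu,\nu_1)$ and seminorm $\|\nu\|=\kappa(\nu,\nu)^{1/2}$, defining the strong topology. A nonnegative measure is concentrated on $E\subset\mathbf X$ if $\mathbf X\setminus E$ is locally negligible for it; $\mathfrak M^+(E)$ is the set of such measures, $\mathcal E^+(E)=\mathfrak M^+(E)\cap\mathcal E$, $\mathcal E^+=\mathcal E^+(\mathbf X)$. $\kappa$ is consistent if every strong Cauchy net in $\mathcal E^+$ converges strongly to each of its vague cluster points. Interior capacity of a set: $C(E)=1/\inf\{\|\nu\|^2:\nu\in\mathcal E^+(E),\ \nu(\mathbf X)=1\}$. A relation holds n.e. (nearly everywhere) in $E$ if the set of $x\in E$ where it fails has interior capacity zero; for $\nu\in\mathcal E$ the potential $\kappa(\cdot,\nu)$ is defined and finite n.e. in $\mathbf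 X$. If $C(E)>0$, $''\!\inf_{x\in E}\!''f(x):=\sup\{q:f(x)\geqslant q\text{ n.e. in }E\}$. Conventions: $\inf\varnothing=+\infty$, $1/0=+\infty$, $1/(+\infty)=0$. Fix integers $m\geqslant1$, $p\geqslant0$; $I=\{1,\dots,m+p\}$, $I^+=\{1,\dots,m\}$, $I^-=I\setminus I^+$; $\alpha_i=+1$ for $i\in I^+$, $\alpha_i=-1$ for $i\in I^-$. An $(m,p)$-condenser is an ordered collection $\mathcal A=(A_i)_{i\in I}$ of nonempty subsets of $\mathbf X$ with $\overline{A_i}\cap\overline{A_j}=\varnothing$ for all $i\in I^+$, $j\in I^-$; it is compact if all $A_i$ are; $\overline{\mathcal A}=(\overline{A_i})_{i\in I}$ is again a condenser; $\mathcal A'\prec\mathcal A$ means $A_i'\subset A_i$ for all $i$. $A=\bigcup_{i\in I}A_i$, $A^+=\bigcup_{i\in I^+}A_i$, $A^-=\bigcup_{i\in I^-}A_i$. $\mathfrak M(\mathcal A)$ is the set of formal combinations $\mu=\sum_{i\in I}\alpha_i\mu^i$ with $\mu^i\in\mathfrak M^+(A_i)$, identified with tuples $(\mu^i)_{i\in I}$; $R\mu\in\mathfrak M$ is the signed measure $\sum_i\alpha_i\mu^i$; potentials and (mutual) energies of $\mu$ are those of $R\mu$, e.g. $\kappa(x,\mu)=\kappa(x,R\mu)$, $\kappa(\mu^i,\mu)=\kappa(\mu^i,R\mu)$. $\mathcal E(\mathcal A)$ is the set of $\mu\in\mathfrak M(\mathcal A)$ with finite energy $\|\mu\|^2:=\kappa(\mu,\mu)$,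 a semimetric space with semimetric $\|\mu_1-\mu_2\|:=\|R\mu_1-R\mu_2\|$ (its topology is called strong); $\mu_1,\mu_2$ are equivalent in $\mathcal E(\mathcal A)$ if $\|\mu_1-\mu_2\|=0$. $\mathcal A$-vague convergence in $\mathfrak M(\overline{\mathcal A})$ is vague convergence of each $i$-coordinate. $\mathcal E(\mathcal A,a,g)=\{\mu\in\mathcal E(\mathcal A):\int g\,d\mu^i=a_i\ \forall i\}$. For a set $\mathcal H$ in $\mathcal E$ or $\mathcal E(\mathcal A)$, $\|\mathcal H\|^2:=\inf_{\nu\in\mathcal H}\|\nu\|^2$. $\mathrm{cap}\,(\mathcal A,a,g):=1/\|\mathcal E(\mathcal A,a,g)\|^2$. For a number $c>0$, $ac=(a_ic)_{i\in I}$. $\mathcal S(\mathcal A,a,g)$ is the set of all $\lambda\in\mathcal E(\mathcal A,a,g)$ with $\|\lambda\|^2=\|\mathcal E(\mathcal A,a,g)\|^2$. $\hat\Gamma(\mathcal A,a,g)$ is the class of all $\nu\in\mathcal E$ for which there exist real $c_i(\nu)$, $i\in I$, with (1) $\alpha_ia_i\kappa(x,\nu)\geqslant c_i(\nu)g(x)$ n.e. in $A_i$ for all $i\in I$ and (2) $\sum_{i\in I}c_i(\nu)\geqslant1$. Under the stated assumptions there is $\hat\omega\in\hat\Gamma(\mathcal A,a,g)$ with $\|\hat\omega\|^2=\|\hat\Gamma(\mathcal A,a,g)\|^2$, and the numbers $c_i(\hat\omega)$ satisfying (1) and (2) for $\nu=\hat\omega$ are unique and independent of the choice of such $\hat\omega$;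 they are the interior capacitary constants $C_i(\mathcal A,a,g):=c_i(\hat\omega)$. $\{\mathcal K\}_{\mathcal A}$ is the family, directed upward by $\prec$, of all compact condensers $\mathcal K\prec\mathcal A$ (only those with $\mathrm{cap}\,\mathcal K:=\mathrm{cap}\,(\mathcal K,a,g)>0$ are considered). $\gamma\in\mathcal E(\overline{\mathcal A})$ is an interior capacitary distribution associated with $\mathcal A$ if there exist a subnet $(\mathcal K_s)_{s\in S}$ of $(\mathcal K)_{\mathcal K\in\{\mathcal K\}_{\mathcal A}}$ and $\lambda_{\mathcal K_s}\in\mathcal S(\mathcal K_s,a\,\mathrm{cap}\,\mathcal K_s,g)$ such that $(\lambda_{\mathcal K_s})_{s\in S}$ converges to $\gamma$ both $\mathcal A$-vaguely and strongly; $\mathcal D(\mathcal A,a,g)$ is the collection of all such $\gamma$. *)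

(* Defs.v *)
From HB Require Import structures.
From mathcomp Require Import all_boot all_order all_algebra.
From mathcomp Require Import all_classical all_reals all_analysis.

Set Implicit Arguments.
Unset Strict Implicit.
Unset Printing Implicit Defensive.

Import Order.TTheory GRing.Theory Num.Theory.
Import numFieldNormedType.Exports.

Local Open Scope classical_set_scope.
Local Open Scope ring_scope.
Local Open Scope ereal_scope.

Definition borel (X : ptopologicalType) := g_sigma_algebraType (@open X).

Definition test_fun (R : realType) (X : topologicalType) (f : X -> R) : Prop :=
  continuous f /\ compact (closure [set x | f x != 0%R]).

Section RadonMeasures.
Context {R : realType} {X : ptopologicalType}.
Implicit Types (mu : {measure set (borel X) -> \bar R}) (nu : set X -> R).

(* Positive Radon measures, with the convention that every Borel set is inner
   regular with respect to the compact sets. *)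
Definition radon mu : Prop :=
  (forall K, compact K -> mu K < +oo) /\
  (forall B, measurable B ->
     mu B = ereal_sup [set mu K | K in [set K | compact K /\ K `<=` B]]).

Definition bounded_borel (B : set X) : Prop :=
  measurable (B : set (borel X)) /\ precompact B.

(* A real-valued signed Radon measure may have infinite positive and negative
   total mass: it is a set function whose values matter only on the relatively
   compact Borel sets, where it is a difference of two positive Radon
   measures. *)
Definition signed_radon nu : Prop :=
  exists mu1 mu2, [/\ radon mu1, radon mu2 &
    forall B, bounded_borel B -> nu B = (fine (mu1 B) - fine (mu2 B))%R].

Definition signed_of mu : set X -> R := fun B => fine (mu B).

(* The Jordan decomposition nu = nu^+ - nu^-: the positive and negative
   variations, extended to all Borel sets by inner regularity. *)
Definition pos_part nu : set (borel X) -> \bar R := fun B =>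
  ereal_sup [set (nu C)%:E | C in [set C | bounded_borel C /\ C `<=` B]].

Definition neg_part nu : set (borel X) -> \bar R := pos_part (\- nu)%R.

Definition test_integral nu (f : X -> R) : R :=
  (fine (\int[pos_part nu]_x (f x)%:E)
   - fine (\int[neg_part nu]_x (f x)%:E))%R.

(* The vague topology is the one induced through this map by pointwise
   convergence of functionals. *)
Definition vague nu : {ptws {f : X -> R | test_fun f} -> R} :=
  fun f => test_integral nu (sval f).

Definition concentrated mu (E : set X) : Prop :=
  forall K, compact K -> mu.-negligible (K `\` E).

Definition pos_radon_on (E : set X) : set {measure set (borel X) -> \bar R} :=
  [set mu | radon mu /\ concentrated mu E].

End RadonMeasures.

Section Nets.
Variables (S : Type) (le : S -> S -> Prop).

Definition directed : Prop :=
  [/\ inhabited S, (forall s, le s s),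
      (forall s t u, le s t -> le t u -> le s u) &
      (forall s t, exists u, le s u /\ le t u)].

Definition tails : set_system S := filter_from setT (fun s => [set t | le s t]).

End Nets.

Section Energy.
Context {R : realType} {X : ptopologicalType} (kappa : X -> X -> \bar R).
Implicit Types (mu : {measure set (borel X) -> \bar R}) (nu : set X -> R).

Definition lsc_kernel : Prop :=
  [/\ lower_semicontinuous (fun z : X * X => kappa z.1 z.2),
      (forall x y, kappa x y != -oo) &
      compact [set: X] \/ (forall x y, 0 <= kappa x y)].

(* The integral of kappa with respect to the Radon measure mu1 (x) mu2 on X * X,
   for positive Radon mu1, mu2. The Borel sigma-algebra of X * X may be larger
   than the product sigma-algebra, so the product measure is taken as a
   functional on compactly supported continuous functions (where it is the
   iterated integral), and the integral of the lower semicontinuous kappa is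
   the supremum over such minorants. *)
Definition prod_integral (mu1 mu2 : set (borel X) -> \bar R) : \bar R :=
  ereal_sup [set \int[mu1]_x \int[mu2]_y (f (x, y))%:E |
             f in [set f : X * X -> R | test_fun f /\
                     forall x y, (f (x, y))%:E <= kappa x y]].

Definition energy_pos nu nu1 : \bar R :=
  prod_integral (pos_part nu) (pos_part nu1)
  + prod_integral (neg_part nu) (neg_part nu1).

Definition energy_neg nu nu1 : \bar R :=
  prod_integral (pos_part nu) (neg_part nu1)
  + prod_integral (neg_part nu) (pos_part nu1).

Definition energy_defined nu nu1 : Prop :=
  energy_pos nu nu1 < +oo \/ energy_neg nu nu1 < +oo.

Definition mutual_energy nu nu1 : \bar R :=
  energy_pos nu nu1 - energy_neg nu nu1.

Definition energy nu : \bar R := mutual_energy nu nu.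

Definition potential_defined (x : X) nu : Prop :=
  \int[pos_part nu]_y kappa x y < +oo \/ \int[neg_part nu]_y kappa x y < +oo.

Definition potential (x : X) nu : \bar R :=
  \int[pos_part nu]_y kappa x y - \int[neg_part nu]_y kappa x y.

Definition finite_energy : set (set X -> R) :=
  [set nu | [/\ signed_radon nu, energy_defined nu nu & energy nu \is a fin_num]].

Definition positive_definite : Prop :=
  (forall x y, kappa x y = kappa y x) /\
  (forall nu, signed_radon nu -> energy_defined nu nu -> 0 <= energy nu).

Definition pos_finite_energy_on (E : set X) :
    set {measure set (borel X) -> \bar R} :=
  [set mu | pos_radon_on E mu /\ finite_energy (signed_of mu)].

(* [energy] is the square of the seminorm defining the strong topology. *)
Definition strong_cvg (S : Type) (le : S -> S -> Prop) (nu_ : S -> set X -> R)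
    nu : Prop :=
  energy (nu_ s \- nu)%R @[s --> tails le] --> 0.

Definition strong_cauchy (S : Type) (le : S -> S -> Prop)
    (nu_ : S -> set X -> R) : Prop :=
  forall e : R, (0 < e)%R -> exists s0, forall s t, le s0 s -> le s0 t ->
    energy (nu_ s \- nu_ t)%R < e%:E.

Definition consistent : Prop :=
  positive_definite /\
  forall (S : Type) (le : S -> S -> Prop)
         (mu_ : S -> {measure set (borel X) -> \bar R}),
    directed le -> (forall s, pos_finite_energy_on setT (mu_ s)) ->
    strong_cauchy le (fun s => signed_of (mu_ s)) ->
    forall nu, signed_radon nu ->
      cluster (vague (signed_of (mu_ s)) @[s --> tails le]) (vague nu) ->
      finite_energy nu /\ strong_cvg le (fun s => signed_of (mu_ s)) nu.

Definition interior_capacity (E : set X) : \bar R :=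
  (ereal_inf [set energy (signed_of mu) |
     mu in [set mu | pos_finite_energy_on E mu /\ mu setT = 1]])^-1.

Definition nearly_everywhere (E : set X) (P : X -> Prop) : Prop :=
  interior_capacity [set x | E x /\ ~ P x] = 0.

(* The n.e.-essential infimum over [E] of a partial function [f] with domain of
   definition [D]: points outside [D] count as failures. *)
Definition ne_inf (E : set X) (D : X -> Prop) (f : X -> \bar R) : \bar R :=
  ereal_sup [set q%:E |
    q in [set q : R | nearly_everywhere E (fun x => D x /\ q%:E <= f x)]].

End Energy.

(* Of an (m, p)-condenser [A : 'I_(m + p) -> set X], the plates of index
   [i < m] are positive. *)
Definition alpha {R : realType} {m p : nat} (i : 'I_(m + p)) : R :=
  (if (i < m)%N then 1 else -1)%R.

Section Condensers.
Context {R : realType} {X : ptopologicalType} {m p : nat}.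
Implicit Types A K : 'I_(m + p) -> set X.

Definition condenser A : Prop :=
  (forall i, A i !=set0) /\
  (forall i j : 'I_(m + p), (i < m)%N -> (m <= j)%N ->
     closure (A i) `&` closure (A j) = set0).

Definition compact_condenser A : Prop := condenser A /\ forall i, compact (A i).

Definition sub_condenser K A : Prop := forall i, K i `<=` A i.

Definition closure_condenser A : 'I_(m + p) -> set X := fun i => closure (A i).

Definition plates A : set X := \bigcup_i A i.
Definition pos_plates A : set X :=
  \bigcup_(i in [set i : 'I_(m + p) | (i < m)%N]) A i.
Definition neg_plates A : set X :=
  \bigcup_(i in [set i : 'I_(m + p) | (m <= i)%N]) A i.

Definition vmeasure := 'I_(m + p) -> {measure set (borel X) -> \bar R}.

Definition vmeasure_on A : set vmeasure :=
  [set mu | forall i, pos_radon_on (A i) (mu i)].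

Definition signed_sum (mu : vmeasure) : set X -> R :=
  fun B => (\sum_i alpha i * signed_of (mu i) B)%R.

Variables (kappa : X -> X -> \bar R) (A : 'I_(m + p) -> set X)
  (a : 'I_(m + p) -> R) (g : X -> R).

Definition vfinite_energy : set vmeasure :=
  [set mu | vmeasure_on A mu /\ finite_energy kappa (signed_sum mu)].

Definition admissible : set vmeasure :=
  [set mu | vfinite_energy mu /\ forall i, \int[mu i]_x (g x)%:E = (a i)%:E].

Definition min_energy : \bar R :=
  ereal_inf [set energy kappa (signed_sum mu) | mu in admissible].

Definition cap : \bar R := min_energy^-1.

Definition minimizers : set vmeasure :=
  [set lambda | admissible lambda /\
                energy kappa (signed_sum lambda) = min_energy].

Definition dual_constraints (nu : set X -> R) (c : 'I_(m + p) -> R) : Prop :=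
  (forall i, nearly_everywhere kappa (A i) (fun x =>
     potential_defined kappa x nu /\
     (c i * g x)%:E <= (alpha i * a i)%:E * potential kappa x nu)) /\
  (1 <= \sum_i c i)%R.

Definition dual_class : set (set X -> R) :=
  [set nu | finite_energy kappa nu /\ exists c, dual_constraints nu c].

Definition capacitary_constants (c : 'I_(m + p) -> R) : Prop :=
  exists omega, [/\ dual_class omega,
    energy kappa omega = ereal_inf [set energy kappa nu | nu in dual_class] &
    dual_constraints omega c].

End Condensers.

Arguments vmeasure R X m p : clear implicits.

Section CapacitaryDistributions.
Context {R : realType} {X : ptopologicalType} {m p : nat}.
Variables (kappa : X -> X -> \bar R) (A : 'I_(m + p) -> set X)
  (a : 'I_(m + p) -> R) (g : X -> R).

Definition compact_subcondenser (K : 'I_(m + p) -> set X) : Prop :=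
  [/\ compact_condenser K, sub_condenser K A & 0 < cap kappa K a g].

Definition vvague_cvg (S : Type) (le : S -> S -> Prop)
    (mu_ : S -> vmeasure R X m p) (mu : vmeasure R X m p) : Prop :=
  forall i, vague (signed_of (mu_ s i)) @[s --> tails le]
            --> vague (signed_of (mu i)).

Definition vstrong_cvg (S : Type) (le : S -> S -> Prop)
    (mu_ : S -> vmeasure R X m p) (mu : vmeasure R X m p) : Prop :=
  strong_cvg kappa le (fun s => signed_sum (mu_ s)) (signed_sum mu).

Definition equivalent (mu1 mu2 : vmeasure R X m p) : Prop :=
  energy kappa (signed_sum mu1 \- signed_sum mu2)%R = 0.

(* [K_] is a subnet, in the sense of Kelley, of the family of the compact
   subcondensers of [A] with positive capacity, directed upward by inclusion. *)
Definition capacitary_distributions : set (vmeasure R X m p) :=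
  [set gamma | vfinite_energy kappa (closure_condenser A) gamma /\
    exists (S : Type) (le : S -> S -> Prop) (K_ : S -> 'I_(m + p) -> set X)
           (lambda_ : S -> vmeasure R X m p),
    [/\ directed le,
        (forall s, compact_subcondenser (K_ s)),
        (forall K, compact_subcondenser K ->
           exists s0, forall s, le s0 s -> sub_condenser K (K_ s)),
        (forall s, minimizers kappa (K_ s)
           (fun i => (a i * fine (cap kappa (K_ s) a g))%R) g (lambda_ s)) &
        vvague_cvg le lambda_ gamma /\ vstrong_cvg le lambda_ gamma]].

End CapacitaryDistributions.

(* Main.v *)
(* Every nu in the dual class satisfies kappa(lambda, nu) >= 1 for every lambda
   admissible in the primal problem: integrate the inequalities defining the
   class against the components of lambda, which do not charge sets of
   interior capacity zero. If moreover ||nu||^2 = cap A =: C and (lambda_n) is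
   a minimizing sequence for the primal problem, then
     ||C lambda_n - nu||^2 <= C^2 ||lambda_n||^2 - 2 C + C -> 0,
   so all such nu are equivalent, and mu is one of them because the numbers
   c_i = alpha_i kappa(mu^i, mu) / C add up to 1. The same computation with the
   minimizers over compact subcondensers K bounds their squared distance to mu
   by cap A - cap K, which tends to 0 by inner regularity; this identifies the
   capacitary distributions. Finally, a constant q that is admissible for the
   i-th inequality of some nu equivalent to mu satisfies q <= c_i, because
   kappa(lambda_n, mu) -> 1 while the other components contribute at least
   1 - c_i; hence the c_i are the capacitary constants and the essential
   infima. *)

From HB Require Import structures.
Require Import Defs.
From mathcomp Require Import all_boot all_order all_algebra finmap.
From mathcomp Require Import all_classical all_reals all_analysis.
From mathcomp Require Import measurable_realfun ring lra.
Import Order.TTheory GRing.Theory Num.Theory.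
Import numFieldNormedType.Exports.
Local Open Scope classical_set_scope.
Local Open Scope ring_scope.
Local Open Scope ereal_scope.
Set Implicit Arguments.
Unset Strict Implicit.
Unset Printing Implicit Defensive.

(** * Radon measures *)

(** The overview computes with the energy as with a positive semidefinite bilinear form, and most of
    the proof earns that right. Energies are defined through the Jordan parts of a set function and
    through suprema over continuous minorants, and the measures need not be sigma-finite. Three
    facts bridge the gap. Tau-smoothness turns such a supremum into an iterated integral. Positive
    definiteness keeps the mutual energy of two positive measures of finite energy finite, so any
    decomposition into such measures may replace the Jordan one. Separation of plates of opposite
    sign puts each component below a Jordan part of the signed sum, so every component has finite
    energy. A kernel with negative values, possible only on a compact space, is first raised by a
    constant [c] to a nonnegative one; the contribution of [c] is finite and is subtracted again. *)

Section Topology.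
Context {R : realType} {X : ptopologicalType}.

Lemma open_borel (U : set X) : open U -> measurable (U : set (borel X)).
Proof. by move=> oU; exact: (@sub_sigma_algebra _ setT (@open X) U). Qed.

Lemma compact_borel (K : set X) :
  hausdorff_space X -> compact K -> measurable (K : set (borel X)).
Proof.
move=> hX cK; rewrite -[K]setCK; apply: (@measurableC _ (borel X)).
by apply: open_borel; apply: closed_openC; apply: compact_closed.
Qed.

Lemma lsc_borel (h : X -> \bar R) : lower_semicontinuous h ->
  measurable_fun setT (h : borel X -> \bar R).
Proof.
move=> scif; apply: (measurability _ (ErealGenOInfty.measurableE R)).
move=> /= _ [_ [a ->]] <-; apply: measurableI => //; apply: open_borel.
by rewrite preimage_itvoy; move/lower_semicontinuousP : scif; exact.
Qed.

Lemma continuous_lsc (T : topologicalType) (f : T -> R) : continuous f ->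
  lower_semicontinuous (fun x => (f x)%:E).
Proof.
move=> cf; apply/lower_semicontinuousP => a.
rewrite (_ : [set x | _] = f @^-1` [set y | (a < y)%R]); last first.
  by apply/seteqP; split => x /=; rewrite lte_fin.
by apply: open_comp => //; exact: open_gt.
Qed.

Lemma continuous_borel (f : X -> R) : continuous f ->
  measurable_fun setT (f : borel X -> R).
Proof. by move=> /continuous_lsc/lsc_borel/measurable_EFinP. Qed.

(** The bump is [1 - f], where [f] separates [x] from the complement of the interior of the
    intersection of [V] and [W]. Intersecting with the compact closed neighbourhood [W] is what
    makes the support compact. *)
Lemma test_fun_nbhs (x : X) (V : set X) :
  hausdorff_space X -> locally_compact [set: X] -> nbhs x V ->
  exists f : X -> R, [/\ test_fun f, (forall y, (0 <= f y <= 1)%R),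
    f x = 1%R & forall y, f y != 0%R -> V y].
Proof.
move=> hX lcX xV.
have [W xW [cW clW]] : exists2 W, nbhs x W & compact W /\ closed W.
  have [W xW [cpt cl]] := lcX x Logic.I.
  by exists W => //; rewrite withinET in xW.
have oVW : open (V `&` W)° by exact: open_interior.
have xVW : (V `&` W)° x by rewrite /interior; exact: filterI.
have := @locally_compact_completely_regular X R lcX hX x (~` (V `&` W)°)
  (open_closedC oVW) (fun h => h xVW).
move=> /(@uniform_separatorP _ R)[f [cf f01 fx fV]].
have fx0 : f x = 0%R by apply: fx; exists x.
exists (fun y => 1 - f y)%R; split.
- split.
    move=> y; apply: (@cvgB _ R^o); first exact: cvg_cst.
    exact: cf.
  apply: (subclosed_compact _ cW); first exact: closed_closure.
  rewrite (closure_id W).1//; apply: closureS => y /=.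
  apply: contraPP => nWy; apply/negP; rewrite negbK subr_eq0 eq_sym.
  apply/eqP; apply: fV; exists y => // /interior_subset[].
  by [].
- move=> y; have /f01/= : range f (f y) by exists y.
  by rewrite in_itv/= => /andP[? ?]; apply/andP; split; lra.
- by rewrite fx0 subr0.
- move=> y; apply: contra_neqP => nVy; apply/eqP; rewrite subr_eq0 eq_sym.
  by apply/eqP; apply: fV; exists y => // /interior_subset[].
Qed.

End Topology.

(** * Inner regularity of measures and integrals *)

Section InnerRegularity.
Context {R : realType} {X : ptopologicalType}.
Hypothesis hX : hausdorff_space X.
Implicit Types (mu : {measure set (borel X) -> \bar R}) (E : set X).

(** [E] need not be Borel and concentration is only tested on compact sets. Inside a compact [K] one
    removes a Borel null set [N] that covers the part of [K] outside [E], and applies inner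
    regularity to what is left. *)
Lemma radon_on_sup mu E (B : set (borel X)) : pos_radon_on E mu ->
  measurable B ->
  mu B = ereal_sup [set mu K | K in [set K | compact K /\ K `<=` B `&` E]].
Proof.
move=> [[_ muR] muE] mB; apply/eqP; rewrite eq_le; apply/andP; split.
  rewrite (muR _ mB); apply/ereal_supP => _ [K [cK KB] <-].
  have mK : measurable (K : set (borel X)) by exact: compact_borel.
  have [N [mN muN KEN]] := muE K cK.
  have mKN : measurable (K `\` N : set (borel X)) by exact: measurableD.
  have -> : mu K = mu (K `\` N).
    rewrite (measureDI mu mK mN) [X in _ + X](_ : _ = 0) ?adde0//.
    by apply/eqP; rewrite eq_le measure_ge0 andbT -muN le_measure// inE//;
      exact: measurableI.
  rewrite (muR _ mKN); apply: ereal_sup_le => _ [L [cL LKN] <-]; exists L => //.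
  split => // x /LKN[Kx nNx]; split; first exact: KB.
  by apply: contrapT => nEx; apply: nNx; apply: KEN.
apply/ereal_supP => _ [K [cK KB] <-].
rewrite le_measure ?inE//; first exact: compact_borel.
by move=> x /KB[].
Qed.

Import HBNNSimple.

(** Each fibre of the simple function is approximated in measure by a sequence of compact subsets
    lying in [E]. The sum over the finitely many values converges, so a single index serves them
    all. *)
Lemma sintegral_compact mu E (s : {nnsfun borel X >-> R}) (t : \bar R) :
  pos_radon_on E mu -> t < sintegral mu s ->
  exists (l : seq R) (K : R -> set X), [/\ uniq l, forall v, v \in l -> (0 <= v)%R,
    (forall v, compact (K v)), (forall v, K v `<=` s @^-1` [set v] `&` E) &
    t < \sum_(v <- l) v%:E * mu (K v)].
Proof.
move=> muE; rewrite sintegralE fsbig_finite//= => tlt.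
have mB v : measurable (s @^-1` [set v] : set (borel X)) by [].
have /choice[K_ K_P] : forall v, exists u : nat -> set X,
    (forall n, compact (u n) /\ u n `<=` s @^-1` [set v] `&` E) /\
    mu (u n) @[n --> \oo] --> mu (s @^-1` [set v]).
  move=> v; rewrite (radon_on_sup muE (mB v)).
  set S := [set mu K | K in _].
  have [|u Su cu] := @ereal_sup_seq _ S.
    by apply/set0P; exists (mu set0), set0 => //; split; [exact: compact0|].
  have /choice[w w_P] : forall n, exists K, [set K | compact K /\
      K `<=` s @^-1` [set v] `&` E] K /\ mu K = u n.
    by move=> n; have [K KP <-] := Su n; exists K.
  exists w; split=> [n|]; first exact: (w_P n).1.
  by rewrite (_ : (fun n => mu (w n)) = u)//; apply/funext => n; exact: (w_P n).2.
have v_ge0 v : v \in fset_set (range s) -> (0 <= v)%R.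
  by rewrite in_fset_set// inE => -[x _ <-].
have cvgS : \sum_(v <- fset_set (range s) | v \in fset_set (range s))
      v%:E * mu (K_ v n) @[n --> \oo] -->
    \sum_(v <- fset_set (range s) | v \in fset_set (range s))
      v%:E * mu (s @^-1` [set v]).
  apply: cvg_nnesum => v vs.
    by apply: nearW => n; rewrite mule_ge0// lee_fin v_ge0.
  by apply: cvgeZl => //; exact: (K_P v).2.
rewrite -!big_seq in cvgS.
have [n tn] : exists n, t < \sum_(v <- fset_set (range s)) v%:E * mu (K_ v n).
  apply: contrapT => /forallNP nlt; move: tlt; apply/negP; rewrite -leNgt.
  apply: (cvge_to_le cvgS); apply: nearW => n.
  by rewrite -big_seq leNgt; apply/negP; exact: nlt.
exists (fset_set (range s)), (fun v => K_ v n).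
by split => // [|v|v]; [exact: fset_uniq | |]; have [/(_ n)[]] := K_P v.
Qed.

(** The weight [w v] is kept apart from the index [v] because [integral_compact] takes [w = id],
    whereas [tau_smooth] lowers the weight to [th * v]. *)
Lemma sum_compact_le mu (l : seq R) (w : R -> R) (K : R -> set X)
    (h : borel X -> \bar R) (D : set (borel X)) :
  measurable D -> uniq l -> (forall v, compact (K v)) -> trivIset setT K ->
  (forall v, v \in l -> K v `<=` D) ->
  measurable_fun setT h -> (forall x, 0 <= h x) ->
  (forall v, v \in l -> (0 <= w v)%R) ->
  (forall v, v \in l -> forall x, K v x -> (w v)%:E <= h x) ->
  \sum_(v <- l) (w v)%:E * mu (K v) <= \int[mu]_(x in D) h x.
Proof.
move=> mD ul cK tK KD mh h0 w0 wh.
have mK v : measurable (K v : set (borel X)) by exact: compact_borel.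
have mU : measurable (\big[setU/set0]_(v <- l) K v : set (borel X)).
  by apply: bigsetU_measurable => v _.
apply: (@le_trans _ _ (\int[mu]_(x in \big[setU/set0]_(v <- l) K v) h x)).
  rewrite ge0_integral_bigsetU//; last 2 first.
  - by apply: sub_trivIset tK.
  - exact: measurable_funTS.
  rewrite big_seq [leRHS]big_seq; apply: lee_sum => v vl.
  rewrite -integral_cst//; apply: ge0_le_integral => //.
  - by move=> x _; rewrite lee_fin w0.
  - exact: measurable_funTS.
  - by move=> x Kx; exact: wh.
apply: ge0_subset_integral => //; first exact: measurable_funTS.
move=> x; rewrite -bigcup_seq => -[v /= vl Kx]; exact: KD Kx.
Qed.

Lemma fibers_trivIset (K : R -> set X) E (s : X -> R) :
  (forall v, K v `<=` s @^-1` [set v] `&` E) -> trivIset setT K.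
Proof.
by move=> Ks; apply/trivIsetP => i j _ _; apply: contra_neqP => /eqP/set0P[x [/Ks[<- _] /Ks[<- _]]].
Qed.

Lemma integral_gt_nnsfun mu (h : borel X -> \bar R) (t : \bar R) :
  (forall x, 0 <= h x) -> t < \int[mu]_x h x ->
  exists2 s : {nnsfun borel X >-> R}, (forall x, (s x)%:E <= h x) &
    t < sintegral mu s.
Proof.
move=> h0; rewrite ge0_integralTE// => /ereal_sup_gt[_ [s sh <-] ts].
by exists s.
Qed.

Lemma integral_compact mu E (h : borel X -> \bar R) (t : \bar R) :
  pos_radon_on E mu -> measurable_fun setT h -> (forall x, 0 <= h x) ->
  t < \int[mu]_x h x ->
  exists K, [/\ compact K, K `<=` E & t < \int[mu]_(x in K) h x].
Proof.
move=> muE mh h0 /(integral_gt_nnsfun h0)[s sh] /(sintegral_compact muE).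
move=> [l [K [ul l0 cK KE tlt]]].
exists (\big[setU/set0]_(v <- l) K v); split.
- exact: bigsetU_compact.
- by move=> x; rewrite -bigcup_seq => -[v _ /KE[]].
apply: (lt_le_trans tlt); apply: (@sum_compact_le _ _ id) => //.
- by apply: bigsetU_measurable => v _; exact: compact_borel.
- exact: fibers_trivIset KE.
- by move=> v vl x Kx; rewrite -bigcup_seq; exists v.
- by move=> v vl x /KE[<- _].
Qed.

End InnerRegularity.

(** * Tau-smoothness of Radon integrals *)

Section TauSmooth.
Context {R : realType} {X : ptopologicalType}.
Hypothesis hX : hausdorff_space X.

(* Inner regularity replaces a simple function below [h] by finitely many
   disjoint compact sets; on each of them compactness and directedness select
   one member of [F] that is almost as large. *)
Lemma tau_smooth (mu : {measure set (borel X) -> \bar R}) (F : set (X -> R))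
    (h : X -> \bar R) :
  radon mu -> F !=set0 ->
  (forall f g, F f -> F g -> exists2 k, F k & forall x, (Num.max (f x) (g x) <= k x)%R) ->
  (forall f, F f -> continuous f /\ forall x, (0 <= f x)%R) ->
  (forall x, h x = ereal_sup [set (f x)%:E | f in F]) ->
  \int[mu]_x h x = ereal_sup [set \int[mu]_x (f x)%:E | f in F].
Proof.
move=> mur [f0 Ff0] dirF cF hF.
have mF f : F f -> measurable_fun setT (fun x : borel X => (f x)%:E).
  by move=> /cF[cf _]; apply/measurable_EFinP; exact: continuous_borel.
have fh f x : F f -> (f x)%:E <= h x.
  by move=> Ff; rewrite hF; apply: ereal_sup_ubound; exists f.
have h0 x : 0 <= h x.
  by apply: le_trans (fh _ x Ff0); rewrite lee_fin; have [] := cF _ Ff0.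
have mh : measurable_fun setT (h : borel X -> \bar R).
  apply: lsc_borel => x a; rewrite hF => /ereal_sup_gt[_ [f Ff <-] af].
  have [V xV Vf] := continuous_lsc (cF f Ff).1 af.
  by exists V => // y /Vf/lt_le_trans; apply; exact: fh.
apply/eqP; rewrite eq_le; apply/andP; split; last first.
  apply/ereal_supP => _ [f Ff <-]; apply: ge0_le_integral => //.
  - by move=> x _; rewrite lee_fin; have [] := cF _ Ff.
  - exact: mF.
  - by move=> x _; exact: fh.
rewrite leNgt; apply/negP; set S := ereal_sup _ => SI.
have muT : pos_radon_on setT mu.
  by split=> // K _; rewrite setDT; exact: negligible_set0.
have [s sh] := integral_gt_nnsfun h0 SI.
move=> /(sintegral_compact hX muT)[l [K [ul l0 cK KE]]]; apply/negP.
(* It suffices to reach every fraction [th < 1] of the sum. For [v > 0] the strict gap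
   [th * v < v <= h x] lets some member of [F] exceed [th * v] near [x]. *)
rewrite -leNgt; apply/lee_mul01Pr => [|th /andP[th0 th1]].
  by rewrite big_seq sume_ge0// => v vl; rewrite mule_ge0// lee_fin l0.
(* The directed family [F] is turned into a filter, so that compactness can be used as a
   near-covering property: a pointwise choice of members of [F] becomes one choice valid on all of
   [K v]. *)
pose FF := filter_from F (fun f => [set g | F g /\ forall x, (f x <= g x)%R]).
have FF_filter : ProperFilter FF.
  apply: filter_from_proper => [|f Ff]; last by exists f.
  apply: filter_from_filter; first by exists f0.
  move=> f g Ff Fg; have [k Fk fgk] := dirF f g Ff Fg; exists k => //.
  move=> u [Fu ku]; split; split => // x; apply: le_trans (ku x);
    by apply: le_trans (fgk x); rewrite le_max lexx ?orbT.
have nearK v : v \in l -> \forall f \near FF, K v `<=` [set x | (th * v <= f x)%R].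
  move=> vl; have := l0 v vl; rewrite le_eqVlt => /predU1P[v0|v0].
    by exists f0 => // f [Ff _] x _ /=; rewrite -v0 mulr0; have [] := cF _ Ff.
  have := cK v; move=> /compact_near_coveringP; apply => x Kx.
  have : (th * v)%:E < h x.
    apply: lt_le_trans (sh x); have [-> _] := KE v x Kx.
    by rewrite lte_fin gtr_pMl.
  rewrite hF => /ereal_sup_gt[_ [f Ff <-] thf].
  have [V xV Vf] := continuous_lsc (cF f Ff).1 thf.
  exists (V, [set g | F g /\ forall x, (f x <= g x)%R]).
    by split => //; exists f.
  move=> [y g] [/= /Vf + [_ fg]]; rewrite lte_fin => /ltW/le_trans; apply.
  exact: fg.
have : \forall f \near FF, forall v, v \in l -> K v `<=` [set x | (th * v <= f x)%R].
  elim: (l) nearK => [_|v l' IH nK]; first exact: nearW.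
  have nv := nK v (mem_head _ _).
  have {}IH := IH (fun u ul' => nK u (@mem_behead _ (v :: l') u ul')).
  near=> f => u; rewrite inE => /predU1P[->|ul'].
    by near: f.
  by move: u ul'; near: f.
move=> nl; have [f [fl [Ff _]]] : exists f, (forall v, v \in l -> K v `<=` [set x | (th * v <= f x)%R]) /\ (F f /\ forall x, (f0 x <= f x)%R).
  apply: (@filter_ex _ FF); apply: filterI nl _.
  by exists f0.
apply: (@le_trans _ _ (\int[mu]_x (f x)%:E)); last first.
  by apply: ereal_sup_ubound; exists f.
rewrite big_seq ge0_sume_distrr => [|v vl]; last by rewrite mule_ge0// lee_fin l0.
under eq_bigr do rewrite muleA -EFinM.
rewrite -big_seq.
apply: sum_compact_le => //.
- exact: fibers_trivIset KE.
- exact: mF.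
- by move=> x; rewrite lee_fin; have [] := cF _ Ff.
- by move=> v vl; apply: mulr_ge0; [exact: ltW | exact: l0].
Unshelve. all: by end_near. Qed.

End TauSmooth.

(** * Compactly supported continuous functions on the product *)

Section CompactlySupported.
Context {R : realType} {X : ptopologicalType}.
Hypothesis hX : hausdorff_space X.

(** The support is enclosed in a compact rectangle, so that all slices in the second variable vanish
    off the same [K2]. *)
Definition supported (f : X * X -> R) (K1 K2 : set X) :=
  [/\ continuous f, compact K1, compact K2,
      (forall z, (0 <= f z)%R) &
      forall x y, f (x, y) != 0%R -> K1 x /\ K2 y].

Lemma test_fun_supported (f : X * X -> R) :
  test_fun f -> (forall z, (0 <= f z)%R) ->
  exists K1 K2, supported f K1 K2.
Proof.
move=> [cf cpt] f0.
exists (fst @` closure [set x | f x != 0%R]), (snd @` closure [set x | f x != 0%R]).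
split => //.
- apply: continuous_compact cpt; apply: continuous_subspaceT.
  by move=> z; exact: cvg_fst.
- apply: continuous_compact cpt; apply: continuous_subspaceT.
  by move=> z; exact: cvg_snd.
- by move=> x y fxy; split; exists (x, y) => //; exact: subset_closure.
Qed.

Lemma hausdorff_prod : hausdorff_space (X * X)%type.
Proof.
move=> [x1 y1] [x2 y2] cl; congr (_, _); apply: hX => A B nA nB.
  have AT : nbhs (x1, y1) (A `*` setT) by exists (A, setT) => //=; split => //; exact: filterT.
  have BT : nbhs (x2, y2) (B `*` setT) by exists (B, setT) => //=; split => //; exact: filterT.
  by have [z [[Az _] [Bz _]]] := cl _ _ AT BT; exists z.1.
have TA : nbhs (x1, y1) (setT `*` A) by exists (setT, A) => //=; split => //; exact: filterT.
have TB : nbhs (x2, y2) (setT `*` B) by exists (setT, B) => //=; split => //; exact: filterT.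
by have [z [[_ Az] [_ Bz]]] := cl _ _ TA TB; exists z.2.
Qed.

Lemma supported_test (f : X * X -> R) K1 K2 : supported f K1 K2 -> test_fun f.
Proof.
move=> [cf c1 c2 _ fK]; split => //.
apply: (@subclosed_compact _ _ (K1 `*` K2)).
- exact: closed_closure.
- exact: compact_setX.
rewrite (closure_id (K1 `*` K2)).1; last first.
  by apply: compact_closed; [exact: hausdorff_prod | exact: compact_setX].
by apply: closureS => -[x y] /=; exact: fK.
Qed.

Lemma supported_swap (f : X * X -> R) K1 K2 : supported f K1 K2 ->
  supported (fun z => f (z.2, z.1)) K2 K1.
Proof.
move=> [cf c1 c2 f0 fK]; split => //; last by move=> x y /fK[].
move=> z; apply: (@continuous_comp _ _ _ (fun z : X * X => (z.2, z.1)) f).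
  by apply: cvg_pair => /=; [exact: cvg_snd | exact: cvg_fst].
exact: cf.
Qed.

Lemma supported_max (f g : X * X -> R) K1 K2 L1 L2 :
  supported f K1 K2 -> supported g L1 L2 ->
  supported (f \max g)%R (K1 `|` L1) (K2 `|` L2).
Proof.
move=> [cf c1 c2 f0 fK] [cg d1 d2 g0 gL]; split.
- by move=> z; apply: continuous_max; [exact: cf | exact: cg].
- exact: compactU.
- exact: compactU.
- by move=> z /=; rewrite le_max f0.
- move=> x y /=; have [f00|/fK[]] := eqVneq (f (x, y)) 0%R; last by split; left.
  have [g00|/gL[]] := eqVneq (g (x, y)) 0%R; last by split; right.
  by rewrite f00 g00 maxxx eqxx.
Qed.

Section OneFunction.
Variables (f : X * X -> R) (K1 K2 : set X).
Hypothesis fK : supported f K1 K2.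

Lemma slice_continuous (x : X) : continuous (fun y => f (x, y)).
Proof.
have [cf _ _ _ _] := fK.
move=> y; apply: (@continuous_comp _ _ _ (fun y : X => (x, y)) f); last exact: cf.
by apply: cvg_pair => /=; [exact: cvg_cst | exact: cvg_id].
Qed.

Lemma slice_borel (x : X) (D : set (borel X)) :
  measurable_fun D (fun y : borel X => (f (x, y))%:E).
Proof.
apply: measurable_funTS; apply/measurable_EFinP; apply: continuous_borel.
exact: slice_continuous.
Qed.

(** Compactness of [K2] makes continuity in the first variable uniform in [y] over [K2]; off [K2]
    both values are zero. *)
Lemma tube (x0 : X) (e : R) : (0 < e)%R ->
  \forall x \near x0, forall y, (`|f (x, y) - f (x0, y)| <= e)%R.
Proof.
move=> e0; have [cf _ /compact_near_coveringP c2 _ fs] := fK.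
have : \forall x \near x0, K2 `<=` [set y | (`|f (x, y) - f (x0, y)| < e)%R].
  apply: c2 => y _.
  have h1 : \forall z \near (x0, y), (`|f (x0, y) - f z| < e / 2)%R.
    by move/cvgrPdist_lt : (cf (x0, y)); apply; exact: divr_gt0.
  have h2 : \forall y' \near y, (`|f (x0, y) - f (x0, y')| < e / 2)%R.
    by move/cvgrPdist_lt : (@slice_continuous x0 y); apply; exact: divr_gt0.
  have [[/= U V] [xU yV] UV] := h1.
  exists (V `&` [set y' | (`|f (x0, y) - f (x0, y')| < e / 2)%R], U) => /=.
    by split => //; exact: filterI.
  move=> [y' x'] /= [[Vy' y'h] Ux'].
  have := UV (x', y') (conj Ux' Vy') => /= h.
  rewrite (_ : _ - _ = (f (x0, y) - f (x0, y')) - (f (x0, y) - f (x', y')))%R; last by ring.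
  by apply: le_lt_trans (ler_normB _ _) _; rewrite [ltRHS](splitr e) ltrD.
apply: filterS => x Kx y.
have [fxy|/fs[_ /Kx/ltW//]] := eqVneq (f (x, y)) 0%R.
have [fxy0|/fs[_ /Kx/ltW//]] := eqVneq (f (x0, y)) 0%R.
by rewrite fxy fxy0 subrr normr0 ltW.
Qed.

Section Slices.
Variable w : {measure set (borel X) -> \bar R}.

Lemma slice_integral_close (B : set (borel X)) (x x0 : X) (e : R) :
  measurable B -> (forall y, (`|f (x, y) - f (x0, y)| <= e)%R) ->
  \int[w]_(y in B) (f (x, y))%:E
    <= \int[w]_(y in B) (f (x0, y))%:E + e%:E * w K2.
Proof.
have [cf c1 c2 f0 fs] := fK => mB fe.
have e0 : (0 <= e)%R by apply: le_trans (fe point).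
have mK2 : measurable (K2 : set (borel X)) by exact: compact_borel.
have mind : measurable_fun setT (fun y : borel X => (e * \1_K2 y)%:E).
  apply/measurable_EFinP; apply: measurable_funM => //.
apply: (@le_trans _ _ (\int[w]_(y in B) ((f (x0, y))%:E + (e * \1_K2 y)%:E))).
  apply: ge0_le_integral => //.
  - by move=> y _; rewrite lee_fin.
  - exact: slice_borel.
  - by apply: emeasurable_funD; [exact: slice_borel | exact: measurable_funTS].
  - move=> y _; rewrite -EFinD lee_fin.
    have := fe y; rewrite ler_norml => /andP[_].
    have [-> _|/fs[_ K2y]] := eqVneq (f (x, y)) 0%R; first by rewrite addr_ge0// mulr_ge0.
    by rewrite indicE mem_set//= mulr1; lra.
rewrite ge0_integralD//; last 4 first.
- by move=> y _; rewrite lee_fin.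
- exact: slice_borel.
- by move=> y _; rewrite lee_fin mulr_ge0.
- exact: measurable_funTS.
rewrite leeD2l//.
under eq_integral do rewrite EFinM.
rewrite ge0_integralZl//; last by apply/measurable_EFinP; exact: measurable_indic.
by rewrite integral_indic// lee_wpmul2l ?lee_fin// le_measure ?inE//; exact: measurableI.
Qed.

Lemma slice_integral_ge0 (B : set (borel X)) (x : X) :
  0 <= \int[w]_(y in B) (f (x, y))%:E.
Proof. by have [_ _ _ f0 _] := fK; apply: integral_ge0 => y _; rewrite lee_fin. Qed.

End Slices.

End OneFunction.
End CompactlySupported.

(** * Slice integrals and exchange of the order of integration *)

Section SliceIntegrals.
Context {R : realType} {X : ptopologicalType}.
Hypothesis hX : hausdorff_space X.
Implicit Types (u v w : {measure set (borel X) -> \bar R}) (f : X * X -> R).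

Definition finite_on_compacts w := forall K, compact K -> w K < +oo.

Lemma slice_integral_fin w f K1 K2 (B : set (borel X)) x :
  finite_on_compacts w -> supported f K1 K2 -> measurable B ->
  \int[w]_(y in B) (f (x, y))%:E \is a fin_num.
Proof.
move=> wK fK mB; have [cf c1 c2 f0 fs] := fK.
have [M [_ fM]] : bounded_set ((fun y => f (x, y) : R^o) @` K2).
  apply: compact_bounded; apply: continuous_compact c2.
  by apply: continuous_subspaceT; apply: slice_continuous fK _.
have {}fM y : (f (x, y) <= (`|M| + 1) * \1_K2 y)%R.
  have [-> |/fs[_ K2y]] := eqVneq (f (x, y)) 0%R; first by rewrite mulr_ge0// addr_ge0.
  rewrite indicE mem_set//= mulr1.
  have := fM (`|M| + 1)%R; rewrite (le_lt_trans (ler_norm M))// ?ltrDl// => /(_ isT (f (x, y))).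
  by move=> /(_ (ex_intro2 _ _ y K2y erefl)); apply: le_trans; exact: ler_norm.
have mK2 : measurable (K2 : set (borel X)) by exact: compact_borel.
have mind : measurable_fun setT (fun y : borel X => ((`|M| + 1) * \1_K2 y)%:E).
  by apply/measurable_EFinP; apply: measurable_funM.
rewrite ge0_fin_numE; last by apply: integral_ge0 => y _; rewrite lee_fin.
apply: (@le_lt_trans _ _ (\int[w]_(y in B) ((`|M| + 1) * \1_K2 y)%:E)).
  apply: ge0_le_integral => //.
  - by move=> y _; rewrite lee_fin.
  - exact: slice_borel fK _ _.
  - exact: measurable_funTS.
  - by move=> y _; rewrite lee_fin.
under eq_integral do rewrite EFinM.
rewrite ge0_integralZl//; last by apply/measurable_EFinP.
rewrite integral_indic// lte_mul_pinfty ?lee_fin ?addr_ge0//.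
apply: le_lt_trans (wK K2 c2).
by rewrite le_measure ?inE//; exact: measurableI.
Qed.

Lemma slice_integral_continuous w f K1 K2 (B : set (borel X)) :
  finite_on_compacts w -> supported f K1 K2 -> measurable B ->
  continuous (fun x => fine (\int[w]_(y in B) (f (x, y))%:E)).
Proof.
move=> wK fK mB x; apply/cvgrPdist_le => e e0.
have [cf c1 c2 f0 fs] := fK.
have wK2 : w K2 \is a fin_num by rewrite ge0_fin_numE// wK.
(* The [+ 1] keeps the denominator positive when [w K2] vanishes. *)
pose d := (e / (fine (w K2) + 1))%R.
have D0 : (0 < fine (w K2) + 1)%R by rewrite ltr_wpDl// fine_ge0.
have d0 : (0 < d)%R by rewrite divr_gt0.
have dw : (d * fine (w K2) <= e)%R.
  rewrite /d mulrAC ler_pdivrMr// ler_pM2l// lerDl; exact: ler01.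
have := tube fK x d0; apply: filterS => x' dx.
have fin z := slice_integral_fin z wK fK mB.
have h1 := slice_integral_close hX fK w mB dx.
have h2 : \int[w]_(y in B) (f (x, y))%:E
    <= \int[w]_(y in B) (f (x', y))%:E + d%:E * w K2.
  by apply: (slice_integral_close hX fK w mB) => y; rewrite distrC.
rewrite -(fineK (fin x)) -(fineK (fin x')) -(fineK wK2) -EFinM -EFinD lee_fin in h1.
rewrite -(fineK (fin x)) -(fineK (fin x')) -(fineK wK2) -EFinM -EFinD lee_fin in h2.
by rewrite ler_norml; apply/andP; split; lra.
Qed.

Lemma slice_integral_borel w f K1 K2 (B D : set (borel X)) :
  finite_on_compacts w -> supported f K1 K2 -> measurable B ->
  measurable_fun D (fun x : borel X => \int[w]_(y in B) (f (x, y))%:E).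
Proof.
move=> wK fK mB; apply: measurable_funTS.
rewrite (_ : (fun _ => _) = (fun x : borel X => (fine (\int[w]_(y in B) (f (x, y))%:E))%:E)).
  apply/measurable_EFinP; apply: continuous_borel.
  exact: slice_integral_continuous fK mB.
by apply/funext => x; rewrite fineK//; exact: slice_integral_fin fK mB.
Qed.

(* Tonelli's theorem is not available, since the Radon measures [u] and [v] need
   not be sigma-finite and [f] is only known to be continuous: the set [K1] is
   cut instead into finitely many Borel pieces on which [f] oscillates by at
   most [e] in its first variable. *)
Lemma fubini_small u v f K1 K2 (B : set (borel X)) x0 (e : R) :
  finite_on_compacts u -> finite_on_compacts v -> supported f K1 K2 ->
  measurable B -> B `<=` K1 -> (0 < e)%R ->
  (forall x, B x -> forall y, (`|f (x, y) - f (x0, y)| <= e)%R) ->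
  \int[u]_(x in B) \int[v]_y (f (x, y))%:E
    <= \int[v]_y \int[u]_(x in B) (f (x, y))%:E + (2 * e)%:E * (v K2 * u B).
Proof.
move=> uK vK fK mB BK1 e0 fe; have [cf c1 c2 f0 fs] := fK.
have mK2 : measurable (K2 : set (borel X)) by exact: compact_borel.
have uB : u B \is a fin_num.
  rewrite ge0_fin_numE//; apply: le_lt_trans (uK K1 c1).
  by rewrite le_measure ?inE//; exact: compact_borel.
have vK2 : v K2 \is a fin_num by rewrite ge0_fin_numE// vK.
have I0 := slice_integral_fin x0 vK fK (@measurableT _ (borel X)).
have fKs := supported_swap fK.
set I := (X in X \is a fin_num) in I0.
have I_ge0 : 0 <= I by apply: integral_ge0 => y _; rewrite lee_fin.
have J_ge0 y : 0 <= \int[u]_(x in B) (f (x, y))%:E.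
  by apply: integral_ge0 => x _; rewrite lee_fin.
have mJ : measurable_fun setT (fun y : borel X => \int[u]_(x in B) (f (x, y))%:E).
  exact: slice_integral_borel fKs mB.
(* Both iterated integrals are compared with the one obtained by freezing the first variable at
   [x0]. Each comparison costs at most [e * v K2 * u B], whence the factor [2 * e]. *)
have step1 : \int[u]_(x in B) \int[v]_y (f (x, y))%:E <= (I + e%:E * v K2) * u B.
  rewrite -integral_cst//; apply: ge0_le_integral => //.
  - by move=> x _; apply: integral_ge0 => y _; rewrite lee_fin.
  - exact: slice_integral_borel fK _.
  - by move=> x Bx; apply: (slice_integral_close hX fK) => //; exact: fe.
have mind : measurable_fun setT (fun y : borel X => (e * fine (u B) * \1_K2 y)%:E).
  by apply/measurable_EFinP; apply: measurable_funM.
have ind0 y : 0 <= (e * fine (u B) * \1_K2 y)%:E.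
  by rewrite lee_fin !mulr_ge0// ?fine_ge0// ltW.
have step2 : I * u B <= \int[v]_y (\int[u]_(x in B) (f (x, y))%:E) + e%:E * (v K2 * u B).
  apply: (@le_trans _ _ (\int[v]_y (\int[u]_(x in B) (f (x, y))%:E + (e * fine (u B) * \1_K2 y)%:E))).
    rewrite muleC -ge0_integralZl//; last 2 first.
    - exact: slice_borel fK _ _.
    - by move=> y _; rewrite lee_fin.
    apply: ge0_le_integral => //.
    - by move=> y _; rewrite mule_ge0// lee_fin.
    - by apply: measurable_funeM; exact: slice_borel fK _ _.
    - exact: emeasurable_funD.
    move=> y _; rewrite muleC -integral_cst//.
    rewrite (_ : (e * fine (u B) * \1_K2 y)%:E = \int[u]_(x in B) (e * \1_K2 y)%:E); last first.
      by rewrite integral_cst// mulrAC EFinM fineK.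
    rewrite -ge0_integralD//; last 3 first.
    - by move=> x _; rewrite lee_fin.
    - exact: slice_borel fKs _ _.
    - by move=> x _; rewrite lee_fin mulr_ge0// ltW.
    apply: ge0_le_integral => //.
    - by move=> x _; rewrite lee_fin.
    - by apply: emeasurable_funD => //; exact: slice_borel fKs _ _.
    - move=> x Bx; rewrite -EFinD lee_fin; have := fe x Bx y; rewrite ler_norml => /andP[+ _].
      have [-> _|/fs[_ K2y]] := eqVneq (f (x0, y)) 0%R.
        by rewrite addr_ge0// mulr_ge0// ltW.
      by rewrite indicE mem_set//= mulr1; lra.
  rewrite ge0_integralD// leeD2l//.
  under eq_integral do rewrite EFinM.
  rewrite ge0_integralZl//; last 2 first.
  - by apply/measurable_EFinP.
  - by rewrite lee_fin mulr_ge0// ?fine_ge0// ltW.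
  by rewrite integral_indic// setIT EFinM fineK// -muleA (muleC (u B)).
apply: (le_trans step1); rewrite ge0_muleDl//; last by rewrite mule_ge0// lee_fin ltW.
have -> : (2 * e)%:E * (v K2 * u B) = e%:E * (v K2 * u B) + e%:E * (v K2 * u B).
  by rewrite -(fineK vK2) -(fineK uB) -!EFinM -EFinD; congr EFin; ring.
by rewrite addeA -[e%:E * v K2 * u B]muleA leeD2r.
Qed.

(** One inequality is enough: the reverse one is the same statement for the swapped function, and
    [kernel_integral_sym] uses it in this way. *)
Lemma fubini_le u v f K1 K2 :
  finite_on_compacts u -> finite_on_compacts v -> supported f K1 K2 ->
  \int[u]_x \int[v]_y (f (x, y))%:E <= \int[v]_y \int[u]_x (f (x, y))%:E.
Proof.
move=> uK vK fK; have [cf c1 c2 f0 fs] := fK.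
have fKs := supported_swap fK.
have mK1 : measurable (K1 : set (borel X)) by exact: compact_borel.
have mT := @measurableT _ (borel X).
have vK2 : v K2 \is a fin_num by rewrite ge0_fin_numE// vK.
have uK1 : u K1 \is a fin_num by rewrite ge0_fin_numE// uK.
have K1E (h : X -> \bar R) : (forall x, ~ K1 x -> h x = 0) ->
    \int[u]_x h x = \int[u]_(x in K1) h x.
  move=> hK; rewrite [RHS]integral_mkcond; apply: eq_integral => x _.
  by rewrite patchE; case: ifPn => // /negP; rewrite inE => /hK.
have fE x : ~ K1 x -> forall y, f (x, y) = 0%R.
  by move=> nK y; apply/eqP; apply: contra_notT nK => /fs[].
rewrite K1E; last first.
  by move=> x /fE fx; rewrite integral0_eq// => y _; rewrite fx.
under [leRHS]eq_integral => y _.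
  rewrite (@K1E (fun x => (f (x, y))%:E)); last by move=> x /fE->.
  over.
(* The claim is generalized to Borel subsets [B] of [K1] for an induction on a finite subcover: the
   part of [B] in the first open set is handled by [fubini_small], the rest by induction. The errors
   add up because [u] is additive. *)
have main e : (0 < e)%R -> forall B : set (borel X), measurable B -> B `<=` K1 ->
    \int[u]_(x in B) \int[v]_y (f (x, y))%:E
      <= \int[v]_y \int[u]_(x in B) (f (x, y))%:E + (2 * e)%:E * (v K2 * u B).
  move=> e0; have := c1; rewrite compact_cover => /(_ X K1 (fun x0 =>
      [set x | forall y, (`|f (x, y) - f (x0, y)| <= e)%R]°)).
  case=> [x _|x Kx|D _ KD]; [exact: open_interior | by exists x => //; exact: tube fK _ _ _ |].
  have {}KD : K1 `<=` \bigcup_(x0 in [set` enum_fset D])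
      [set x | forall y, (`|f (x, y) - f (x0, y)| <= e)%R]° by [].
  move=> B mB BK1.
  have : B `<=` \bigcup_(x0 in [set` enum_fset D])
      [set x | forall y, (`|f (x, y) - f (x0, y)| <= e)%R]°.
    exact: subset_trans KD.
  elim: (enum_fset D) B mB BK1 => [B mB BK1 BU|x0 l IH B mB BK1 BU].
    have -> : B = set0 by apply/seteqP; split => // x /BU[].
    by rewrite integral_set0 measure0 !mule0 adde0; apply: integral_ge0 => y _; rewrite integral_set0.
  set U := [set x | forall y, (`|f (x, y) - f (x0, y)| <= e)%R]°.
  have mU : measurable (U : set (borel X)) by apply: open_borel; exact: open_interior.
  have mBU : measurable (B `&` U) by exact: measurableI.
  have mBD : measurable (B `\` U) by exact: measurableD.
  have h1 : \int[u]_(x in B `&` U) \int[v]_y (f (x, y))%:E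
      <= \int[v]_y \int[u]_(x in B `&` U) (f (x, y))%:E + (2 * e)%:E * (v K2 * u (B `&` U)).
    apply: (@fubini_small _ _ _ K1 K2 _ x0) => //; first by move=> x [/BK1].
    by move=> x [_ /interior_subset].
  have h2 : \int[u]_(x in B `\` U) \int[v]_y (f (x, y))%:E
      <= \int[v]_y \int[u]_(x in B `\` U) (f (x, y))%:E + (2 * e)%:E * (v K2 * u (B `\` U)).
    apply: IH => //; first by move=> x [/BK1].
    move=> x [/BU[z /= + Uz] nUx]; rewrite inE => /predU1P[zx0|zl].
      by exfalso; apply: nUx; rewrite /U -zx0.
    by exists z.
  have BE : B = (B `&` U) `|` (B `\` U) by rewrite setUIDK.
  have disj : [disjoint B `&` U & B `\` U].
    by apply/disj_setPS => x [[_ Ux] [_ nUx]].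
  have uBE : u B = u (B `&` U) + u (B `\` U).
    by rewrite {1}BE measureU//; apply/disj_set2P.
  rewrite {1}BE ge0_integral_setU//; last 2 first.
  - exact: slice_integral_borel fK _.
  - by move=> x _; apply: integral_ge0 => y _; rewrite lee_fin.
  have -> : \int[v]_y \int[u]_(x in B) (f (x, y))%:E =
      \int[v]_y \int[u]_(x in B `&` U) (f (x, y))%:E +
      \int[v]_y \int[u]_(x in B `\` U) (f (x, y))%:E.
    rewrite -ge0_integralD//.
    - apply: eq_integral => y _; rewrite {1}BE ge0_integral_setU//.
        exact: slice_borel fKs _ _.
      by move=> x _; rewrite lee_fin.
    - by move=> y _; apply: integral_ge0 => x _; rewrite lee_fin.
    - exact: slice_integral_borel fKs _.
    - by move=> y _; apply: integral_ge0 => x _; rewrite lee_fin.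
    - exact: slice_integral_borel fKs _.
  apply: (le_trans (leeD h1 h2)).
  rewrite uBE ge0_muleDr// ge0_muleDr//; try by rewrite mule_ge0.
  by rewrite addeACA.
apply/lee_addgt0Pr => e e0.
pose C := (2 * fine (v K2) * fine (u K1) + 1)%R.
have C0 : (0 < C)%R by rewrite ltr_wpDl// !mulr_ge0// fine_ge0.
apply: (le_trans (main (e / C)%R (divr_gt0 e0 C0) K1 mK1 _)) => //.
rewrite leeD2l// -(fineK vK2) -(fineK uK1) -!EFinM lee_fin.
rewrite (_ : 2 * (e / C) * _ = e * ((2 * fine (v K2) * fine (u K1)) / C))%R; last by ring.
by rewrite ler_piMr ?(ltW e0)// ler_pdivrMr// mul1r lerDl ler01.
Qed.

End SliceIntegrals.

(** * Integrals of lower semicontinuous kernels *)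

HB.lock Definition kernel_integral (R : realType) (X : ptopologicalType)
    (k : X -> X -> \bar R) (u v : set (borel X) -> \bar R) : \bar R :=
  \int[u]_x \int[v]_y k x y.

Section Kernels.
Context {R : realType} {X : ptopologicalType}.
Hypothesis hX : hausdorff_space X.
Hypothesis lcX : locally_compact [set: X].

Lemma kernel_integralE (k : X -> X -> \bar R) (u v : set (borel X) -> \bar R) :
  kernel_integral k u v = \int[u]_x \int[v]_y k x y.
Proof. by rewrite unlock. Qed.

(** Unlike the test functions in [prod_integral], these are nonnegative, as [tau_smooth]
    requires. *)
Definition minorants (k : X -> X -> \bar R) : set (X * X -> R) :=
  [set f | (exists K1 K2, supported f K1 K2) /\ forall x y, (f (x, y))%:E <= k x y].

Definition nonneg_kernel (k : X -> X -> \bar R) :=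
  lower_semicontinuous (fun z : X * X => k z.1 z.2) /\ forall x y, 0 <= k x y.

Implicit Types (u v w : {measure set (borel X) -> \bar R}) (k : X -> X -> \bar R).

Lemma minorants0 k : nonneg_kernel k -> minorants k (cst 0%R).
Proof.
move=> [_ k0]; split; last by move=> x y; exact: k0.
exists set0, set0; split => //; try exact: compact0.
- by move=> z; exact: cvg_cst.
- by move=> x y /=; rewrite eqxx.
Qed.

Lemma minorants_max k f g : minorants k f -> minorants k g ->
  minorants k (f \max g)%R.
Proof.
move=> [[K1 [K2 fK]] fk] [[L1 [L2 gL]] gk]; split.
  by exists (K1 `|` L1), (K2 `|` L2); exact: supported_max.
by move=> x y /=; rewrite EFin_max ge_max fk gk.
Qed.

Lemma supported_tensor (phi psi : X -> R) : test_fun phi -> test_fun psi ->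
  (forall x, (0 <= phi x)%R) -> (forall x, (0 <= psi x)%R) ->
  exists K1 K2, supported (fun z => phi z.1 * psi z.2)%R K1 K2.
Proof.
move=> [cphi c1] [cpsi c2] phi0 psi0.
exists (closure [set x | phi x != 0%R]), (closure [set x | psi x != 0%R]); split => //.
- move=> z; apply: (@cvgM R).
    by apply: (@continuous_comp _ _ _ fst phi); [exact: cvg_fst | exact: cphi].
  by apply: (@continuous_comp _ _ _ snd psi); [exact: cvg_snd | exact: cpsi].
- by move=> z; exact: mulr_ge0.
- move=> x y /=; rewrite mulf_eq0 negb_or => /andP[? ?].
  by split; exact: subset_closure.
Qed.

(** If the supremum fell short, some real [t >= 0] would lie strictly between it and [k x y]. By
    lower semicontinuity [k] exceeds [t] on a rectangle around the point, and [t] times a product of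
    two bumps supported there is a minorant with value [t] at [(x, y)]. *)
Lemma minorants_sup k x y : nonneg_kernel k ->
  k x y = ereal_sup [set (f (x, y))%:E | f in minorants k].
Proof.
move=> kk; have [klsc k0] := kk; apply/eqP; rewrite eq_le; apply/andP; split; last first.
  by apply/ereal_supP => _ [f [_ fk] <-]; exact: fk.
have S0 : 0 <= ereal_sup [set (f (x, y))%:E | f in minorants k].
  by apply: le_ereal_sup_tmp; exists 0 => //; exists (cst 0%R) => //; exact: minorants0.
rewrite leNgt; apply/negP => Sk.
have [t t0 tk] : exists2 t, (0 <= t)%R &
    ereal_sup [set (f (x, y))%:E | f in minorants k] < t%:E /\ t%:E < k x y.
  move: Sk S0; set S := ereal_sup _.
  case: S => [s sk|/lt_le_trans/(_ (leey _))|//]; last by rewrite ltxx.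
  rewrite lee_fin => s0.
  move: sk; case: (k x y) (k0 x y) => [r _|_ _|//].
    rewrite lte_fin => sr; exists ((s + r) / 2)%R; first by lra.
    by rewrite !lte_fin; split; lra.
  by exists (s + 1)%R; [lra | rewrite lte_fin ltry; split => //; lra].
have [St tkxy] := tk.
have [V xyV Vk] := klsc (x, y) t tkxy.
have [[/= V1 V2] [xV1 yV2] V12] := xyV.
have [phi [tphi phi01 phix phiV]] := @test_fun_nbhs R _ _ _ hX lcX xV1.
have [psi [tpsi psi01 psiy psiV]] := @test_fun_nbhs R _ _ _ hX lcX yV2.
have phi0 z : (0 <= phi z)%R by have /andP[] := phi01 z.
have psi0 z : (0 <= psi z)%R by have /andP[] := psi01 z.
have [K1 [K2 [cf c1 c2 f0 fs]]] := supported_tensor tphi tpsi phi0 psi0.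
pose f z := (t * (phi z.1 * psi z.2))%R.
suff fk : minorants k f.
  move: St; rewrite ltNge => /negP; apply; apply: ereal_sup_ubound.
  by exists f => //; rewrite /f /= phix psiy !mulr1.
split.
  exists K1, K2; split => //.
  - by move=> z; apply: (@cvgM R); [exact: cvg_cst | exact: cf].
  - by move=> z; rewrite mulr_ge0.
  - by move=> a b; rewrite mulf_eq0 negb_or => /andP[_]; exact: fs.
move=> a b; rewrite /f /=.
have [pa|phia] := eqVneq (phi a) 0%R; first by rewrite pa mul0r mulr0.
have [pb|psib] := eqVneq (psi b) 0%R; first by rewrite pb !mulr0.
have : t%:E < k a b by apply: (Vk (a, b)); apply: V12; split; [exact: phiV | exact: psiV].
move=> /ltW; apply: le_trans; rewrite lee_fin ler_piMr//.
have /andP[? ?] := phi01 a; have /andP[? ?] := psi01 b.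
by rewrite -(mulr1 1%R) ler_pM.
Qed.

Definition kernel_potential k (v : set (borel X) -> \bar R) (x : X) : \bar R :=
  \int[v]_y k x y.

Lemma kernel_potential_sup k v x : nonneg_kernel k -> radon v ->
  kernel_potential k v x = ereal_sup [set \int[v]_y (f (x, y))%:E | f in minorants k].
Proof.
move=> kk vr; rewrite /kernel_potential.
rewrite (@tau_smooth _ _ hX v [set (fun y => f (x, y)) | f in minorants k])//.
- congr ereal_sup; apply/seteqP; split => [_ [_ [f fk <-] <-]|_ [f fk <-]].
    by exists f.
  by exists (fun y => f (x, y)) => //; exists f.
- by exists (fun _ => 0%R), (cst 0%R) => //; exact: minorants0.
- move=> _ _ [f fk <-] [g gk <-]; exists (fun y => (f \max g)%R (x, y)) => //.
  by exists (f \max g)%R => //; exact: minorants_max.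
- move=> _ [f [[K1 [K2 fK]] _] <-]; split; first exact: slice_continuous fK _.
  by move=> y; have [_ _ _ f0 _] := fK.
- move=> y; rewrite (minorants_sup x y kk); congr ereal_sup.
  apply/seteqP; split => [_ [f fk <-]|_ [_ [f fk <-] <-]].
    by exists (fun y => f (x, y)) => //; exists f.
  by exists f.
Qed.

Lemma minorant_integral_fin k v f x : radon v -> minorants k f ->
  \int[v]_y (f (x, y))%:E \is a fin_num.
Proof.
by move=> [vK _] [[K1 [K2 fK]] _]; exact: (slice_integral_fin hX x vK fK measurableT).
Qed.

Lemma kernel_potential_lsc k v : nonneg_kernel k -> radon v ->
  lower_semicontinuous (kernel_potential k v).
Proof.
move=> kk vr x a; rewrite kernel_potential_sup// => /ereal_sup_gt[_ [f fk <-] af].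
have [[K1 [K2 fK]] _] := fk.
have cI := slice_integral_continuous hX vr.1 fK (@measurableT _ (borel X)).
have [|V xV Vf] := continuous_lsc cI (x := x) (a := a).
  by rewrite fineK// (minorant_integral_fin _ vr fk).
exists V => // y /Vf; rewrite fineK ?(minorant_integral_fin _ vr fk)//.
move=> /lt_le_trans; apply; rewrite kernel_potential_sup//.
by apply: ereal_sup_ubound; exists f.
Qed.

Lemma kernel_potential_borel k v (D : set (borel X)) : nonneg_kernel k -> radon v ->
  measurable_fun D (kernel_potential k v : borel X -> \bar R).
Proof. by move=> kk vr; apply: measurable_funTS; apply: lsc_borel; exact: kernel_potential_lsc. Qed.

Lemma kernel_borel k x (D : set (borel X)) : nonneg_kernel k ->
  measurable_fun D (k x : borel X -> \bar R).
Proof.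
move=> [klsc _]; apply: measurable_funTS; apply: lsc_borel => y a.
move=> /(klsc (x, y) a)[V [[/= V1 V2] [xV1 yV2] V12] Vk].
exists V2 => // z V2z; apply: (Vk (x, z)); apply: V12; split => //.
exact: nbhs_singleton.
Qed.

(** Tau-smoothness is used a second time, now in the outer variable: the slice integrals of the
    minorants are continuous, directed, and have the potential as supremum by
    [kernel_potential_sup]. They are finite, so passing through [fine] loses nothing. *)
Lemma kernel_integral_sup k u v : nonneg_kernel k -> radon u -> radon v ->
  kernel_integral k u v =
  ereal_sup [set \int[u]_x \int[v]_y (f (x, y))%:E | f in minorants k].
Proof.
move=> kk ur vr.
have fin f x := @minorant_integral_fin k v f x vr.
rewrite kernel_integralE (@tau_smooth _ _ hX u
    [set (fun x => fine (\int[v]_y (f (x, y))%:E)) | f in minorants k])//.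
- have E f : minorants k f -> \int[u]_x (fine (\int[v]_y (f (x, y))%:E))%:E =
      \int[u]_x \int[v]_y (f (x, y))%:E.
    by move=> fk; apply: eq_integral => x _; rewrite fineK// fin.
  congr ereal_sup; apply/seteqP; split => [_ [_ [f fk <-] <-]|_ [f fk <-]].
    by exists f => //; rewrite E.
  by exists (fun x => fine (\int[v]_y (f (x, y))%:E)); [exists f | exact: E].
- by eexists; exists (cst 0%R) => //; exact: minorants0.
- move=> _ _ [f fk <-] [g gk <-].
  have mk := minorants_max fk gk.
  exists (fun x => fine (\int[v]_y ((f \max g)%R (x, y))%:E)); first by exists (f \max g)%R.
  have [[K1 [K2 fK]] _] := fk; have [[L1 [L2 gL]] _] := gk; have [[M1 [M2 mM]] _] := mk.
  move=> x; rewrite ge_max; apply/andP; split; apply: fine_le; try exact: fin.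
    apply: ge0_le_integral => //.
    - by move=> y _; have [_ _ _ f0 _] := fK; rewrite lee_fin.
    - exact: slice_borel fK _ _.
    - exact: slice_borel mM _ _.
    - by move=> y _; rewrite lee_fin /= le_max lexx.
  apply: ge0_le_integral => //.
  - by move=> y _; have [_ _ _ g0 _] := gL; rewrite lee_fin.
  - exact: slice_borel gL _ _.
  - exact: slice_borel mM _ _.
  - by move=> y _; rewrite lee_fin /= le_max lexx orbT.
- move=> _ [f [[K1 [K2 fK]] _] <-]; split.
    by apply: (slice_integral_continuous hX vr.1 fK).
  by move=> x; apply: fine_ge0; exact: slice_integral_ge0 fK _ _ _.
- move=> x; rewrite -/(kernel_potential k v x) kernel_potential_sup//.
  congr ereal_sup; apply/seteqP; split => [_ [f fk <-]|_ [_ [f fk <-] <-]].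
    by exists (fun x => fine (\int[v]_y (f (x, y))%:E)); [exists f | rewrite fineK// fin].
  by exists f => //; rewrite fineK// fin.
Qed.

Lemma kernel_integral_sym k u v : nonneg_kernel k -> (forall x y, k x y = k y x) ->
  radon u -> radon v -> kernel_integral k u v = kernel_integral k v u.
Proof.
move=> kk ksym; suff le u' v' : radon u' -> radon v' ->
    kernel_integral k u' v' <= kernel_integral k v' u'.
  by move=> ur vr; apply/eqP; rewrite eq_le !le.
move=> ur vr; rewrite !kernel_integral_sup//; apply/ereal_supP => _ [f [[K1 [K2 fK]] fk] <-].
apply: (le_trans (fubini_le hX ur.1 vr.1 fK)).
apply: ereal_sup_ubound; exists (fun z => f (z.2, z.1)) => //; split.
  by exists K2, K1; exact: supported_swap.
by move=> x y /=; rewrite ksym.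
Qed.

End Kernels.

(** * Jordan parts of signed Radon measures *)

Section JordanParts.
Context {R : realType} {X : ptopologicalType}.
Hypothesis hX : hausdorff_space X.
Implicit Types (m : {measure set (borel X) -> \bar R}) (nu : set X -> R).

(** Membership of 0 makes both suprema nonnegative, so their sum never has the form [+oo - oo]. *)
Lemma ereal_supD_le (A B : set (\bar R)) (z : \bar R) : A 0 -> B 0 ->
  (forall x y, A x -> B y -> x + y <= z) -> ereal_sup A + ereal_sup B <= z.
Proof.
move=> A0 B0 ABz.
have z0 : 0 <= z by rewrite -[0]adde0; exact: ABz.
have sA0 : 0 <= ereal_sup A by apply: le_ereal_sup_tmp; exists 0.
have sB0 : 0 <= ereal_sup B by apply: le_ereal_sup_tmp; exists 0.
case: z z0 ABz => [z _ ABz|_ _|//]; last exact: leey.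
have Az x : A x -> x <= z%:E by move=> Ax; rewrite -[x]adde0; exact: ABz.
have sAz : ereal_sup A <= z%:E by apply/ereal_supP => x; exact: Az.
have sAfin : ereal_sup A \is a fin_num.
  by rewrite ge0_fin_numE//; apply: le_lt_trans sAz _; rewrite ltry.
suff : ereal_sup B <= z%:E - ereal_sup A by rewrite leeBrDl.
apply/ereal_supP => y By; rewrite leeBrDl//.
case: y By => [y By|/(ABz 0 +oo A0)|_]; last by rewrite addeNy leNye.
- suff : ereal_sup A <= z%:E - y%:E by rewrite leeBrDr.
  by apply/ereal_supP => x Ax; rewrite leeBrDr//; exact: ABz.
- by rewrite add0e leye_eq.
Qed.

Lemma compact_bounded_borel (K : set X) : compact K -> bounded_borel K.
Proof. by move=> cK; split; [exact: compact_borel | exact: compact_precompact]. Qed.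

Lemma bounded_borelS (B C : set X) : bounded_borel B ->
  measurable (C : set (borel X)) -> C `<=` B -> bounded_borel C.
Proof. by move=> [_ pB] mC CB; split => //; exact: precompact_subset pB. Qed.

Lemma bounded_borelU (B C : set X) : bounded_borel B -> bounded_borel C ->
  bounded_borel (B `|` C).
Proof.
move=> [mB [B' BB' [cB' clB']]] [mC [C' CC' [cC' clC']]]; split.
  exact: measurableU.
exists (B' `|` C'); first by move=> x [/BB'|/CC']; [left|right].
by split; [exact: compactU | exact: closedU].
Qed.

Lemma bounded_borel_fin m (B : set X) : radon m -> bounded_borel B ->
  m B \is a fin_num.
Proof.
move=> [mK _] [mB [B' BB' [cB' _]]]; rewrite ge0_fin_numE//.
by apply: le_lt_trans (mK _ cB'); rewrite le_measure ?inE//; exact: compact_borel.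
Qed.

(** The pair need not be the Jordan decomposition: [m1] and [m2] may have a common part. *)
Definition represents nu m1 m2 := [/\ radon m1, radon m2 &
  forall B, bounded_borel B -> nu B = (fine (m1 B) - fine (m2 B))%R].

Lemma represents_neg nu m1 m2 : represents nu m1 m2 -> represents (\- nu)%R m2 m1.
Proof. by move=> [r1 r2 E]; split => // B /E /= ->; rewrite opprB. Qed.

Section PosPart.
Variables (nu : set X -> R) (m1 m2 : {measure set (borel X) -> \bar R}).
Hypothesis nuE : represents nu m1 m2.

Let r1 : radon m1. Proof. by case: nuE. Qed.
Let r2 : radon m2. Proof. by case: nuE. Qed.

Lemma bounded_borel0 : bounded_borel (set0 : set X).
Proof. by apply: compact_bounded_borel; exact: compact0. Qed.

Lemma represents0 : nu set0 = 0%R.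
Proof.
have [_ _ ->] := nuE; last exact: bounded_borel0.
by rewrite !measure0 subrr.
Qed.

Lemma representsU (B C : set X) : bounded_borel B -> bounded_borel C ->
  B `&` C = set0 -> nu (B `|` C) = (nu B + nu C)%R.
Proof.
have [_ _ E] := nuE.
move=> bB bC BC; rewrite !E//; last exact: bounded_borelU.
have [[mB _] [mC _]] := (bB, bC).
rewrite !measureU// !fineD ?(bounded_borel_fin r1)// ?(bounded_borel_fin r2)//.
by ring.
Qed.

Lemma pos_part_set0_in (B : set X) :
  [set (nu C)%:E | C in [set C | bounded_borel C /\ C `<=` B]] 0.
Proof.
by exists set0; [split => //; exact: bounded_borel0 | rewrite represents0].
Qed.

Lemma pos_part_ge0 (B : set (borel X)) : 0 <= pos_part nu B.
Proof. by apply: le_ereal_sup_tmp; exists 0 => //; exact: pos_part_set0_in. Qed.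

Lemma pos_part_ge (C B : set X) : bounded_borel C -> C `<=` B ->
  (nu C)%:E <= pos_part nu B.
Proof. by move=> bC CB; apply: ereal_sup_ubound; exists C. Qed.

Lemma pos_part_le (B C : set X) : B `<=` C -> pos_part nu B <= pos_part nu C.
Proof.
move=> BC; apply: ereal_sup_le => _ [D [bD DB] <-]; exists D => //; split => //.
exact: subset_trans BC.
Qed.

Lemma pos_part0 : pos_part nu set0 = 0.
Proof.
apply/eqP; rewrite eq_le pos_part_ge0 andbT.
apply/ereal_supP => _ [C [_ C0] <-].
have -> : C = set0 by rewrite -subset0.
by rewrite represents0.
Qed.

Lemma pos_partU (B C : set (borel X)) : measurable B -> measurable C ->
  B `&` C = set0 -> pos_part nu (B `|` C) = pos_part nu B + pos_part nu C.
Proof.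
move=> mB mC BC; apply/eqP; rewrite eq_le; apply/andP; split.
  apply/ereal_supP => _ [D [bD DBC] <-].
  have [mD _] := bD.
  have bDB : bounded_borel (D `&` B).
    by apply: (bounded_borelS bD) => //; exact: measurableI.
  have bDC : bounded_borel (D `&` C).
    by apply: (bounded_borelS bD) => //; exact: measurableI.
  have -> : D = (D `&` B) `|` (D `&` C) by rewrite -setIUr setIidl.
  rewrite representsU//; last by rewrite setIACA BC setI0.
  by rewrite EFinD leeD// pos_part_ge.
apply: ereal_supD_le; try exact: pos_part_set0_in.
move=> _ _ [D [bD DB] <-] [E [bE EC] <-].
rewrite -EFinD -representsU//; last first.
  by apply/seteqP; split => // x [/DB Bx /EC Cx]; rewrite -BC.
apply: pos_part_ge; first exact: bounded_borelU.
by move=> x [/DB|/EC]; [left|right].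
Qed.

Lemma pos_part_dom (B : set (borel X)) : measurable B -> pos_part nu B <= m1 B.
Proof.
move=> mB; apply/ereal_supP => _ [C [bC CB] <-].
have [_ _ E] := nuE; rewrite E//; have [mC _] := bC.
apply: (@le_trans _ _ (m1 C)); last by rewrite le_measure ?inE.
rewrite -[leRHS]fineK ?(bounded_borel_fin r1)// lee_fin gerBl.
exact: fine_ge0.
Qed.

(** Finite additivity reduces the claim to continuity from below. A bounded Borel [C] inside the
    union is exhausted by its intersections with the partial unions [G n], and along these [nu]
    converges to [nu C], being a difference of two measures finite on [C]. *)
Lemma pos_part_sigma_additive :
  semi_sigma_additive (pos_part nu : set (borel X) -> \bar R).
Proof.
move=> F mF tF mU.
pose G n : set (borel X) := \big[setU/set0]_(0 <= i < n) F i.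
have mG n : measurable (G n) by apply: bigsetU_measurable.
have GE n : \sum_(0 <= i < n) pos_part nu (F i) = pos_part nu (G n).
  elim: n => [|n IH]; first by rewrite /G !big_nil pos_part0.
  rewrite big_nat_recr//= IH /G big_nat_recr//= pos_partU//; first exact: mG.
  rewrite -subset0 => x; rewrite -[\big[_/_]_(_ <= _ < _) _]/(G n) => -[].
  rewrite /G big_mkord -bigcup_mkord => -[i /= ni Fix] Fnx.
  move/trivIsetP : tF => /(_ i n Logic.I Logic.I).
  by rewrite ltn_eqF// => /(_ isT)/seteqP[/(_ x)] + _; apply.
under eq_fun do rewrite GE.
have ndG : nondecreasing_seq G.
  move=> i j ij; apply/subsetPset; rewrite /G !big_mkord -!bigcup_mkord => x [k /= ki Fk].
  by exists k => //=; exact: leq_trans ij.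
have GU : \bigcup_n F n = \bigcup_n G n.
  rewrite eqEsubset; split => [x [n _ Fn]|x [n _]].
    by exists n.+1 => //; rewrite /G big_mkord -bigcup_mkord; exists n => //=.
  by rewrite /G big_mkord -bigcup_mkord => -[k _ Fk]; exists k.
have nd : nondecreasing_seq (fun n => pos_part nu (G n)).
  by move=> i j ij; apply: pos_part_le; apply/subsetPset; exact: ndG.
suff -> : pos_part nu (\bigcup_n F n) = ereal_sup (range (fun n => pos_part nu (G n))).
  exact: ereal_nondecreasing_cvgn.
apply/eqP; rewrite eq_le; apply/andP; split; last first.
  apply/ereal_supP => _ [n _ <-]; apply: pos_part_le.
  by rewrite GU; exact: bigcup_sup.
apply/ereal_supP => _ [C [bC CF] <-].
have [mC _] := bC; have [_ _ E] := nuE.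
have mCG n : measurable (C `&` G n : set (borel X)) by exact: measurableI.
have bCG n : bounded_borel (C `&` G n).
  exact: (bounded_borelS bC).
have cvgm (m : {measure set (borel X) -> \bar R}) : radon m ->
    fine (m (C `&` G n)) @[n --> \oo] --> fine (m C).
  move=> mr; apply: fine_cvg; rewrite fineK ?(bounded_borel_fin mr)//.
  have {2}-> : C = \bigcup_n (C `&` G n).
    by rewrite -setI_bigcupr -GU setIidl.
  apply: nondecreasing_cvg_mu => //; first exact: bigcupT_measurable.
  by move=> i j ij; apply/subsetPset; apply: setIS; apply/subsetPset; exact: ndG.
have cvgnu : (nu (C `&` G n))%:E @[n --> \oo] --> (nu C)%:E.
  apply: cvg_EFin; first exact: nearW.
  under eq_fun do rewrite /= E//.
  by rewrite E//; apply: (@cvgB _ R^o); exact: cvgm.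
apply: (cvge_to_le cvgnu); apply: nearW => n.
apply: (@le_trans _ _ (pos_part nu (G n))); first by apply: pos_part_ge.
by apply: ereal_sup_ubound; exists n.
Qed.

(** The proof argument ties the measure structure to a representation of [nu]: for an arbitrary set
    function [pos_part] need not be additive. *)
Definition pos_measure (_ : represents nu m1 m2) : set (borel X) -> \bar R :=
  pos_part nu.

HB.instance Definition _ := isMeasure.Build _ _ _ (pos_measure nuE)
  pos_part0 pos_part_ge0 pos_part_sigma_additive.

(** Inner regularity is inherited from [m1]. A compact [K] inside [C] that misses at most [e] of the
    [m1]-mass also misses at most [e] of [nu C], since the positive part is dominated by [m1]. *)
Lemma pos_measure_radon : radon (pos_measure nuE).
Proof.
split=> [K cK|B mB].
  by apply: le_lt_trans (r1.1 K cK); apply: pos_part_dom; exact: compact_borel.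
apply/eqP; rewrite eq_le; apply/andP; split; last first.
  by apply/ereal_supP => _ [K [_ KB] <-]; exact: pos_part_le.
apply/ereal_supP => _ [C [bC CB] <-]; have [mC _] := bC.
have [_ _ E] := nuE.
have fC := bounded_borel_fin r1 bC.
apply/lee_addgt0Pr => e e0.
have [_ [K [cK KC] <-] Ke] : exists2 y, [set m1 K | K in [set K | compact K /\ K `<=` C]] y &
    m1 C - e%:E < y.
  apply: ereal_sup_gt; rewrite -r1.2// lteBlDr// -(fineK fC) -EFinD lte_fin.
  by rewrite ltrDl.
have bK := compact_bounded_borel cK; have [mK _] := bK.
have mCK : measurable (C `\` K : set (borel X)) by exact: measurableD.
have bCK : bounded_borel (C `\` K) by apply: (bounded_borelS bC) => //; exact: subDsetl.
have -> : nu C = (nu K + nu (C `\` K))%R.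
  by rewrite -representsU// ?setDIK// setDUK.
rewrite EFinD leeD//.
  apply: le_trans (@pos_part_ge K K bK _) _ => //.
  by apply: ereal_sup_ubound; exists K => //; split => //; exact: subset_trans CB.
apply: (@le_trans _ _ (pos_part nu (C `\` K))); first exact: pos_part_ge.
apply: le_trans (pos_part_dom mCK) _.
have mCE : m1 C = m1 K + m1 (C `\` K).
  by rewrite -measureU// ?setDIK// setDUK.
have fK := bounded_borel_fin r1 bK; have fCK := bounded_borel_fin r1 bCK.
move: Ke; rewrite lteBlDr// mCE -(fineK fK) -(fineK fCK) -!EFinD lte_fin lee_fin.
by lra.
Qed.

End PosPart.

(** For [C] inside [B], the value [nu C] is [nu B] minus [nu] of the remainder, hence at most [nu B]
    plus the negative part of [B]; take the supremum over [C]. Applied to the opposite of [nu], it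
    gives the reverse inequality. *)
Lemma pos_part_balance_bounded nu m1 m2 (B : set X) : represents nu m1 m2 ->
  bounded_borel B -> pos_part nu B + m2 B <= neg_part nu B + m1 B.
Proof.
move=> nuE bB; have [r1 r2 E] := nuE.
have f2 := bounded_borel_fin r2 bB; have f1 := bounded_borel_fin r1 bB.
suff : pos_part nu B <= neg_part nu B + m1 B - m2 B by rewrite leeBrDr.
apply/ereal_supP => _ [C [bC CB] <-]; rewrite leeBrDr//.
have [mC _] := bC; have [mB _] := bB.
have bBC : bounded_borel (B `\` C).
  by apply: (bounded_borelS bB); [exact: measurableD | exact: subDsetl].
have EB : nu B = (nu C + nu (B `\` C))%R.
  by rewrite -(representsU nuE)// ?setDIK// setDUK.
have := pos_part_ge (\- nu)%R bBC (@subDsetl _ _ _ : B `\` C `<=` B).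
rewrite -/(neg_part nu B) /= => h.
apply: (@le_trans _ _ ((- nu (B `\` C))%:E + m1 B)); last by rewrite leeD2r.
rewrite -(fineK f1) -(fineK f2) -!EFinD lee_fin.
by move: EB; rewrite E//; lra.
Qed.

Lemma measure_addmE m1 m2 (B : set (borel X)) :
  (measure_add m1 m2 : {measure set (borel X) -> \bar R}) B = m1 B + m2 B.
Proof. exact: measure_addE. Qed.

Lemma radon_add m1 m2 : radon m1 -> radon m2 -> radon (measure_add m1 m2).
Proof.
move=> r1 r2; split=> [K cK|B mB].
  by rewrite measure_addmE lte_add_pinfty// ?r1.1 ?r2.1.
apply/eqP; rewrite eq_le; apply/andP; split; last first.
  apply/ereal_supP => _ [K [cK KB] <-]; rewrite le_measure ?inE//.
  exact: compact_borel.
rewrite measure_addmE r1.2// r2.2//; apply: ereal_supD_le.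
- by exists set0 => //; split => //; exact: compact0.
- by exists set0 => //; split => //; exact: compact0.
move=> _ _ [K [cK KB] <-] [L [cL LB] <-].
apply: (@le_trans _ _ (m1 (K `|` L) + m2 (K `|` L))).
  have mK := compact_borel hX cK; have mL := compact_borel hX cL.
  rewrite leeD// le_measure ?inE//; exact: measurableU.
rewrite -measure_addmE; apply: ereal_sup_ubound; exists (K `|` L) => //; split; first exact: compactU.
by move=> x [/KB|/LB].
Qed.

Lemma radon_ext m1 m2 : radon m1 -> radon m2 ->
  (forall K, compact K -> m1 K = m2 K) ->
  forall B : set (borel X), measurable B -> m1 B = m2 B.
Proof.
move=> r1 r2 E B mB; rewrite r1.2// r2.2//; congr ereal_sup.
by apply/seteqP; split => _ [K [cK KB] <-]; exists K => //; rewrite E.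
Qed.

(** The balance expresses that both pairs have the same difference, but it is written with sums
    because all four values may be infinite on an unbounded Borel set. It is proved on compact sets
    and extended by inner regularity of the two sums. *)
Lemma jordan_parts nu m1 m2 : represents nu m1 m2 ->
  exists p n : {measure set (borel X) -> \bar R},
  [/\ (p : set (borel X) -> \bar R) = pos_part nu,
      (n : set (borel X) -> \bar R) = neg_part nu,
      radon p /\ radon n,
      (forall B : set (borel X), measurable B -> p B <= m1 B) /\
      (forall B : set (borel X), measurable B -> n B <= m2 B) &
      forall B : set (borel X), measurable B -> p B + m2 B = n B + m1 B].
Proof.
move=> nuE; have nuN := represents_neg nuE; have [r1 r2 _] := nuE.
exists (pos_measure nuE), (pos_measure nuN).
have rp := pos_measure_radon nuE; have rn := pos_measure_radon nuN.
split => //.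
- by split => B; [exact: (pos_part_dom nuE) | exact: (pos_part_dom nuN)].
move=> B mB; rewrite -(measure_addmE (pos_measure nuE)) -(measure_addmE (pos_measure nuN)).
apply: radon_ext mB; try exact: radon_add.
move=> K cK; have bK := compact_bounded_borel cK; rewrite !measure_addmE.
apply/eqP; rewrite eq_le; apply/andP; split; first exact: pos_part_balance_bounded nuE bK.
have := pos_part_balance_bounded nuN bK.
by rewrite {1}/neg_part (_ : \- \- nu = nu)%R//; apply/funext => A /=; rewrite opprK.
Qed.

End JordanParts.

(** * Linearity and monotonicity of kernel integrals *)

Section KernelAlgebra.
Context {R : realType} {X : ptopologicalType}.
Hypothesis hX : hausdorff_space X.
Hypothesis lcX : locally_compact [set: X].
Implicit Types (u v w : {measure set (borel X) -> \bar R}) (k h : X -> X -> \bar R).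

Lemma kernel_potential_ge0 k v x : nonneg_kernel k -> 0 <= kernel_potential k v x.
Proof. by move=> [_ k0]; exact: integral_ge0. Qed.

Lemma kernel_integral_ge0 k u v : nonneg_kernel k -> 0 <= kernel_integral k u v.
Proof. by move=> kk; rewrite kernel_integralE; apply: integral_ge0 => x _; exact: kernel_potential_ge0. Qed.

Lemma nonneg_kernelD k h : nonneg_kernel k -> nonneg_kernel h ->
  nonneg_kernel (fun x y => k x y + h x y).
Proof.
move=> [kl k0] [hl h0]; split; last by move=> x y; exact: adde_ge0.
move=> [x y] a /= akh.
have [s [t [sk th ast]]] : exists s t : R,
    [/\ s%:E < k x y, t%:E < h x y & (a <= s + t)%R].
  move: akh (k0 x y) (h0 x y); case: (k x y) => [r| |//]; case: (h x y) => [q| |//].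
  - rewrite -EFinD lte_fin => arq _ _.
    exists (r - (r + q - a) / 2)%R, (q - (r + q - a) / 2)%R.
    by rewrite !lte_fin; split; lra.
  - move=> _ _ _; exists (r - 1)%R, (a - r + 1)%R; rewrite lte_fin ltry; split => //; lra.
  - move=> _ _ _; exists (a - q + 1)%R, (q - 1)%R; rewrite lte_fin ltry; split => //; lra.
  - by move=> _ _ _; exists a, 0%R; rewrite !ltry addr0; split.
have [V xV Vk] := kl (x, y) s sk; have [W xW Wh] := hl (x, y) t th.
exists (V `&` W); first exact: filterI.
move=> z [/Vk sz /Wh tz]; apply: (@le_lt_trans _ _ (s%:E + t%:E)); first by rewrite -EFinD lee_fin.
by apply: lteD.
Qed.

Lemma kernel_integralD k h u v : nonneg_kernel k -> nonneg_kernel h ->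
  radon u -> radon v ->
  kernel_integral (fun x y => k x y + h x y) u v =
  kernel_integral k u v + kernel_integral h u v.
Proof.
move=> kk hh ur vr; rewrite !kernel_integralE -ge0_integralD//.
- apply: eq_integral => x _; rewrite ge0_integralD//.
  + by move=> y _; exact: kk.2.
  + exact: kernel_borel.
  + by move=> y _; exact: hh.2.
  + exact: kernel_borel.
- by move=> x _; exact: kernel_potential_ge0.
- exact: kernel_potential_borel.
- by move=> x _; exact: kernel_potential_ge0.
- exact: kernel_potential_borel.
Qed.

Lemma le_kernel_integral k h u v : nonneg_kernel k -> nonneg_kernel h ->
  radon u -> radon v -> (forall x y, k x y <= h x y) ->
  kernel_integral k u v <= kernel_integral h u v.
Proof.
move=> kk hh ur vr kh; rewrite !kernel_integralE; apply: ge0_le_integral => //.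
- by move=> x _; exact: kernel_potential_ge0.
- exact: kernel_potential_borel.
- exact: kernel_potential_borel.
- move=> x _; apply: ge0_le_integral => //.
  + by move=> y _; exact: kk.2.
  + exact: kernel_borel.
  + exact: kernel_borel.
Qed.

Section OneKernel.
Variable k : X -> X -> \bar R.
Hypothesis kk : nonneg_kernel k.

Lemma eq_kernel_integral u u' v v' :
  (forall B : set (borel X), measurable B -> u B = u' B) ->
  (forall B : set (borel X), measurable B -> v B = v' B) ->
  kernel_integral k u v = kernel_integral k u' v'.
Proof.
move=> uu vv; rewrite !kernel_integralE (eq_measure_integral u') => [|B mB _]; last exact: uu.
by apply: eq_integral => x _; apply: eq_measure_integral => B mB _; exact: vv.
Qed.

Lemma le_kernel_integral_measure u u' v v' :
  radon v -> radon v' ->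
  (forall B : set (borel X), measurable B -> u B <= u' B) ->
  (forall B : set (borel X), measurable B -> v B <= v' B) ->
  kernel_integral k u v <= kernel_integral k u' v'.
Proof.
move=> vr vr' uu vv; apply: (@le_trans _ _ (kernel_integral k u v')); rewrite !kernel_integralE.
  apply: ge0_le_integral => //.
  - by move=> x _; exact: kernel_potential_ge0.
  - exact: kernel_potential_borel.
  - exact: kernel_potential_borel.
  - move=> x _; apply: ge0_le_measure_integral => //; first exact: kk.2.
    exact: kernel_borel.
apply: ge0_le_measure_integral => //.
  by move=> x; exact: kernel_potential_ge0.
exact: kernel_potential_borel.
Qed.

Lemma kernel_integral_addl u1 u2 v : radon v ->
  kernel_integral k (measure_add u1 u2) v =
  kernel_integral k u1 v + kernel_integral k u2 v.
Proof.
move=> vr; rewrite !kernel_integralE ge0_integral_measure_add//.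
  by move=> x _; exact: kernel_potential_ge0.
exact: kernel_potential_borel.
Qed.

Lemma kernel_integral_addr u v1 v2 : radon v1 -> radon v2 ->
  kernel_integral k u (measure_add v1 v2) =
  kernel_integral k u v1 + kernel_integral k u v2.
Proof.
move=> r1 r2; rewrite !kernel_integralE -ge0_integralD//; last 4 first.
- by move=> x _; exact: kernel_potential_ge0.
- exact: kernel_potential_borel.
- by move=> x _; exact: kernel_potential_ge0.
- exact: kernel_potential_borel.
apply: eq_integral => x _; rewrite ge0_integral_measure_add//.
  by move=> y _; exact: kk.2.
exact: kernel_borel.
Qed.

Lemma kernel_integral_scalel (r : {nonneg R}) u v : radon v ->
  kernel_integral k (mscale r u) v = r%:num%:E * kernel_integral k u v.
Proof.
move=> vr; rewrite !kernel_integralE ge0_integral_mscale//.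
  exact: kernel_potential_borel.
by move=> x _; exact: kernel_potential_ge0.
Qed.

Lemma kernel_integral_scaler (r : {nonneg R}) u v : radon v ->
  kernel_integral k u (mscale r v) = r%:num%:E * kernel_integral k u v.
Proof.
move=> vr; rewrite !kernel_integralE -ge0_integralZl//; last 2 first.
- exact: kernel_potential_borel.
- by move=> x _; exact: kernel_potential_ge0.
apply: eq_integral => x _; rewrite ge0_integral_mscale//.
  exact: kernel_borel.
by move=> y _; exact: kk.2.
Qed.

End OneKernel.

Lemma radon_scale (r : {nonneg R}) u : radon u -> radon (mscale r u).
Proof.
move=> [uK uR]; split=> [K cK|B mB].
  by rewrite /= /mscale lte_mul_pinfty// uK.
rewrite {1}/mscale /= {1}/mscale uR//.
have S0 : [set u K | K in [set K | compact K /\ K `<=` B]] !=set0.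
  by exists (u set0); exists set0 => //; split => //; exact: compact0.
rewrite -ereal_supZl//; last exact/set0P.
congr ereal_sup; apply/seteqP; split => [_ [_ [K KB <-] <-]|_ [K KB <-]].
  by exists K.
by exists (u K) => //; exists K.
Qed.

Lemma radon_restr u (D : set (borel X)) (mD : measurable D) :
  radon u -> radon (mrestr u mD).
Proof.
move=> [uK uR]; split=> [K cK|B mB].
  apply: le_lt_trans (uK K cK); rewrite /= /mrestr le_measure ?inE//.
  - by apply: measurableI => //; exact: compact_borel.
  - exact: compact_borel.
apply/eqP; rewrite eq_le; apply/andP; split; last first.
  apply/ereal_supP => _ [K [cK KB] <-].
  by rewrite le_measure ?inE//; exact: compact_borel.
rewrite {1}/mrestr /= {1}/mrestr uR; last exact: measurableI.
apply/ereal_supP => _ [K [cK KBD] <-]; apply: ereal_sup_ubound; exists K.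
  by split => // x /KBD[].
by rewrite /= /mrestr setIidl// => x /KBD[].
Qed.

End KernelAlgebra.

(** * Raising the kernel to a nonnegative one *)

Section ShiftedKernel.
Context {R : realType} {X : ptopologicalType}.
Hypothesis hX : hausdorff_space X.
Hypothesis lcX : locally_compact [set: X].
Implicit Types (u v w : {measure set (borel X) -> \bar R}).

Lemma nonneg_kernel_cst (c : R) : (0 <= c)%R ->
  nonneg_kernel (fun _ _ : X => c%:E).
Proof.
move=> c0; split => // z a ac; exists setT => //; exact: filterT.
Qed.

(** A lower semicontinuous function that avoids [-oo] is bounded below on a compact space: near each
    point it exceeds [-n] for all large [n], and compactness makes [n] uniform. In the remaining
    case the kernel is already nonnegative and [c = 0]. *)
Lemma lsc_kernel_shift (kappa : X -> X -> \bar R) : lsc_kernel kappa ->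
  exists c : R, [/\ (0 <= c)%R, c = 0%R \/ compact [set: X] &
    nonneg_kernel (fun x y => kappa x y + c%:E)].
Proof.
move=> [kl knoo kc].
have shift (c : R) : lower_semicontinuous (fun z : X * X => kappa z.1 z.2 + c%:E).
  move=> z a; rewrite -lteBlDr// -EFinB => /(kl z (a - c)%R)[V zV Vk].
  by exists V => // y /Vk; rewrite EFinB lteBlDr.
case: kc => [cX|k0]; last first.
  exists 0%R; split => //; first by left.
  by split => // x y; rewrite adde0.
have := compact_setX cX cX => /compact_near_coveringP.
move=> /(_ _ \oo (fun n z => - n%:R%:E < kappa z.1 z.2)).
have h z : (setT `*` setT : set (X * X)) z ->
    \forall z' \near z & n \near \oo, - n%:R%:E < kappa z'.1 z'.2.
  move=> _; have [n nk] : exists n : nat, - n%:R%:E < kappa z.1 z.2.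
    move: (knoo z.1 z.2); case: (kappa z.1 z.2) => [r _|_|//].
      have [n rn] : exists n : nat, (`|r| < n%:R)%R.
        by exists (Num.truncn `|r|).+1; exact: truncnS_gt.
      by exists n; rewrite -EFinN lte_fin ltrNl; apply: le_lt_trans rn; rewrite -normrN ler_norm.
    by exists 0%N; exact: ltry.
  have [V zV Vk] := kl z (- n%:R)%R nk.
  exists (V, [set m | (n <= m)%N]); first by split => //; exact: nbhs_infty_ge.
  move=> [z' m] /= [/Vk + nm]; apply: le_lt_trans.
  by apply: (_ : (- m%:R)%:E <= (- n%:R)%:E); rewrite lee_fin lerN2 ler_nat.
move=> /(_ _ h)[n _ nk].
exists n%:R; split => //; first by right.
split => // x y; have := nk n (leqnn n) (x, y) (conj I I) => /= /ltW.
by rewrite addeC -leeBlDl// sub0e.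
Qed.

End ShiftedKernel.

(** * Potentials and product integrals in terms of the raised kernel *)

Section Form.
Context {R : realType} {X : ptopologicalType}.
Hypothesis hX : hausdorff_space X.
Hypothesis lcX : locally_compact [set: X].
Variables (kappa : X -> X -> \bar R) (c : R).
Hypothesis kappa_noo : forall x y, kappa x y != -oo.
Hypothesis c0 : (0 <= c)%R.
Hypothesis cX : c = 0%R \/ compact [set: X].
Let k x y := kappa x y + c%:E.
Let h (_ _ : X) : \bar R := c%:E.
Hypothesis kk : nonneg_kernel k.
Implicit Types (u v w : {measure set (borel X) -> \bar R}) (nu omega : set X -> R).

Let hh : nonneg_kernel h. Proof. exact: nonneg_kernel_cst. Qed.

Notation N1 := (kernel_integral k).
Notation N2 := (kernel_integral h).

Lemma shift_potential_fin v x : radon v -> kernel_potential h v x \is a fin_num.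
Proof.
move=> vr; rewrite ge0_fin_numE; last by apply: (kernel_potential_ge0 v x hh).
rewrite /kernel_potential /h integral_cst//.
by case: cX => [->|/vr.1]; rewrite ?mul0e// => ?; rewrite lte_mul_pinfty.
Qed.

Lemma shift_integral_fin u v : radon u -> radon v -> N2 u v \is a fin_num.
Proof.
move=> ur vr; rewrite ge0_fin_numE; last exact: kernel_integral_ge0.
have -> : N2 u v = kernel_potential h v point * u setT by rewrite kernel_integralE -integral_cst.
case: cX => [c00|/ur.1 ?].
  have -> : kernel_potential h v point = 0 by rewrite /kernel_potential /h c00 integral0_eq.
  by rewrite mul0e.
rewrite lte_mul_pinfty//; first by apply: (kernel_potential_ge0 v point hh).
exact: shift_potential_fin.
Qed.

(** The negative part of [kappa x] is at most [c], so its integral is finite. The positive part plus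
    [c] equals [k x] plus the negative part; this identity between nonnegative functions can be
    integrated, and only finite terms are moved across afterwards. *)
Lemma potential_shift v x : radon v ->
  \int[v]_y kappa x y = kernel_potential k v x - kernel_potential h v x.
Proof.
move=> vr.
have mk : measurable_fun setT (kappa x : borel X -> \bar R).
  rewrite (_ : kappa x = (fun y => k x y - c%:E)); last first.
    by apply/funext => y; rewrite /k addeK.
  by apply: emeasurable_funB => //; exact: kernel_borel.
have mp := measurable_funepos mk; have mn := measurable_funeneg mk.
have nc y : (kappa x)^\- y <= c%:E.
  rewrite funenegE ge_max lee_fin c0 andbT leeNl.
  by have := kk.2 x y; rewrite /k -leeBlDr// sub0e.
have fin_n : \int[v]_y (kappa x)^\- y \is a fin_num.
  rewrite ge0_fin_numE; last exact: integral_ge0.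
  apply: le_lt_trans (_ : kernel_potential h v x < +oo).
    by apply: ge0_le_integral => //; exact: (@kernel_borel _ _ h).
  by have := shift_potential_fin x vr; rewrite fin_numElt => /andP[].
have E : \int[v]_y (kappa x)^\+ y + kernel_potential h v x =
    kernel_potential k v x + \int[v]_y (kappa x)^\- y.
  have mh : measurable_fun setT (h x : borel X -> \bar R) by exact: (@kernel_borel _ _ h).
  have mkx : measurable_fun setT (k x : borel X -> \bar R) by exact: kernel_borel.
  have k0 := kk.2.
  have n0 y : 0 <= (kappa x)^\- y by [].
  have p0 y : 0 <= (kappa x)^\+ y by [].
  rewrite /kernel_potential -ge0_integralD// -ge0_integralD//.
  apply: eq_integral => y _; rewrite /h /k.
  rewrite funeposE funenegE; move: (kappa_noo x y); case: (kappa x y) => [r _|_|//].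
    rewrite -EFinN -!EFin_max -!EFinD; congr EFin.
    by rewrite /Num.max; case: ifPn; case: ifPn; rewrite -?leNgt; lra.
  by rewrite maxye !addye// ?addye// -ltNye lt_max ltNy0 orbT.
rewrite integralE.
have h_fin := shift_potential_fin x vr.
have -> : kernel_potential k v x - kernel_potential h v x =
   (kernel_potential k v x + \int[v]_y (kappa x)^\- y) - \int[v]_y (kappa x)^\- y
     - kernel_potential h v x by rewrite addeK.
by rewrite -E [RHS]addeAC addeK.
Qed.

Lemma supported_integral_fin u v f K1 K2 : radon u -> radon v ->
  supported f K1 K2 -> \int[u]_x \int[v]_y (f (x, y))%:E \is a fin_num.
Proof.
move=> ur vr fK; have [_ c1 _ f0 fs] := fK.
pose G x := fine (\int[v]_y (f (x, y))%:E).
have cG : continuous G by apply: (slice_integral_continuous hX vr.1 fK).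
have G0 x : (0 <= G x)%R by apply: fine_ge0; exact: slice_integral_ge0 fK _ _ _.
have tG : test_fun G.
  split => //; apply: (subclosed_compact _ c1); first exact: closed_closure.
  rewrite [X in _ `<=` X](closure_id K1).1; last exact: compact_closed.
  apply: closureS => x /=; apply: contra_neqP => nK1.
  rewrite /G integral0_eq// => y _; congr EFin; apply/eqP.
  by apply: contra_notT nK1 => /fs[].
(* [G] is itself a test function. Multiplied by a bump equal to 1 at [point], it becomes the slice
   at [point] of a supported function, so [slice_integral_fin] applies once more. *)
have [phi [tphi phi01 phi1 _]] := @test_fun_nbhs R _ point setT hX lcX filterT.
have phi0 x : (0 <= phi x)%R by have /andP[] := phi01 x.
have [L1 [L2 gL]] := supported_tensor tphi tG phi0 G0.
have := slice_integral_fin hX point ur.1 gL (@measurableT _ (borel X)).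
congr (_ \is a fin_num); apply: eq_integral => x _ /=.
by rewrite phi1 mul1r fineK//; exact: (slice_integral_fin hX x vr.1 fK).
Qed.

Lemma supported_part (f g : X * X -> R) : test_fun f -> continuous g ->
  (forall z, (0 <= g z)%R) -> (forall z, g z != 0%R -> f z != 0%R) ->
  exists K1 K2, supported g K1 K2.
Proof.
move=> [_ cpt] cg g0 gf; apply: test_fun_supported => //; split => //.
apply: (subclosed_compact _ cpt); first exact: closed_closure.
by apply: closureS => z; exact: gf.
Qed.

Lemma supported_pos (f : X * X -> R) : test_fun f ->
  exists K1 K2, supported (fun z => Num.max (f z) 0)%R K1 K2.
Proof.
move=> tf; apply: (supported_part tf).
- by move=> z; apply: (@continuous_max _ _ f (cst 0%R)); [exact: tf.1 | exact: cvg_cst].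
- by move=> z; rewrite le_max lexx orbT.
- by move=> z; apply: contra_neqN => /eqP->; rewrite maxxx.
Qed.

Lemma supported_neg (f : X * X -> R) : test_fun f ->
  exists K1 K2, supported (fun z => Num.max (- f z) 0)%R K1 K2.
Proof.
move=> tf; apply: (supported_part tf).
- move=> z; apply: (@continuous_max _ _ (\- f)%R (cst 0%R)); last exact: cvg_cst.
  by apply: (@cvgN _ R^o); exact: tf.1.
- by move=> z; rewrite le_max lexx orbT.
- by move=> z; apply: contra_neqN => /eqP->; rewrite oppr0 maxxx.
Qed.

Lemma supported_kernel (g : X * X -> R) : (exists K1 K2, supported g K1 K2) ->
  nonneg_kernel (fun x y => (g (x, y))%:E).
Proof.
move=> [K1 [K2 [cg _ _ g0 _]]]; split; last by move=> x y; rewrite lee_fin.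
rewrite (_ : (fun z => _) = EFin \o g); first exact: continuous_lsc.
by apply/funext => -[].
Qed.

Lemma supported_integrable u v f K1 K2 : radon u -> radon v ->
  supported f K1 K2 -> u.-integrable setT (fun x => \int[v]_y (f (x, y))%:E).
Proof.
move=> ur vr fK; have kf : nonneg_kernel (fun x y => (f (x, y))%:E).
  by apply: supported_kernel; exists K1, K2.
apply/integrableP; split; first exact: (kernel_potential_borel hX lcX).
under eq_integral do rewrite gee0_abs ?(kernel_potential_ge0 v _ kf)//.
by have := supported_integral_fin ur vr fK; rewrite fin_numElt => /andP[].
Qed.

Lemma test_integral_parts u v (f : X * X -> R) : radon u -> radon v -> test_fun f ->
  \int[u]_x \int[v]_y (f (x, y))%:E =
  kernel_integral (fun x y => (Num.max (f (x, y)) 0)%R%:E) u v -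
  kernel_integral (fun x y => (Num.max (- f (x, y)) 0)%R%:E) u v.
Proof.
move=> ur vr tf.
have [P1 [P2 pP]] := supported_pos tf; have [Q1 [Q2 qQ]] := supported_neg tf.
have kp := supported_kernel (supported_pos tf).
have kn := supported_kernel (supported_neg tf).
rewrite !kernel_integralE -integralB//; last 2 first.
- exact: supported_integrable pP.
- exact: supported_integrable qQ.
apply: eq_integral => x _; rewrite integralE; congr (_ - _).
  by apply: eq_integral => y _; rewrite funeposE EFin_max.
by apply: eq_integral => y _; rewrite funenegE EFin_max.
Qed.

(** Signed minorants of [kappa] are compared with nonnegative minorants of [k] after splitting them
    into positive and negative parts. Every pointwise comparison is arranged as an inequality
    between sums of nonnegative kernels, so that it can be integrated. *)
Lemma prod_integral_shift u v : radon u -> radon v ->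
  prod_integral kappa u v = N1 u v - N2 u v.
Proof.
move=> ur vr.
have finN2 := shift_integral_fin ur vr.
apply/eqP; rewrite eq_le; apply/andP; split.
  apply/ereal_supP => _ [f [tf fk] <-].
  have kp := supported_kernel (supported_pos tf).
  have kn := supported_kernel (supported_neg tf).
  have [Q1 [Q2 qQ]] := supported_neg tf.
  rewrite test_integral_parts// leeBlDr; last first.
    by rewrite kernel_integralE; exact: (supported_integral_fin ur vr qQ).
  rewrite addeAC leeBrDr// -!kernel_integralD//.
  apply: le_kernel_integral => //; try exact: nonneg_kernelD.
  move=> x y; rewrite /k /h; have := kk.2 x y; rewrite /k; have := fk x y.
  move: (kappa_noo x y); case: (kappa x y) => [r _|_ _ _|//].
    rewrite -!EFinD !lee_fin => fr rc.
    by rewrite /Num.max; case: ifPn; case: ifPn; rewrite -?leNgt; lra.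
  by rewrite -addeA -EFinD addye ?leey.
rewrite leeBlDr// kernel_integral_sup//; apply/ereal_supP => _ [g [[K1 [K2 gK]] gk] <-].
have [cg c1 c2 g0 gs] := gK.
(* Lowering a minorant of [k] by [c] gives a minorant of [kappa]. Its support stays compact because
   either [c = 0] or the whole space is compact. *)
pose f z := (g z - c)%R.
have tf : test_fun f.
  split; first by move=> z; apply: (@cvgB _ R^o); [exact: cg | exact: cvg_cst].
  case: cX => [c00|cT].
    by rewrite (_ : f = g); [exact: (supported_test hX gK).2 | apply/funext => z; rewrite /f c00 subr0].
  apply: (@subclosed_compact _ _ (setT `*` setT)); [exact: closed_closure | exact: compact_setX |].
  by move=> [].
have fk x y : (f (x, y))%:E <= kappa x y by rewrite /f EFinB leeBlDr// gk.
have [Q1 [Q2 qQ]] := supported_neg tf.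
have kp := supported_kernel (supported_pos tf).
have kn := supported_kernel (supported_neg tf).
have kg : nonneg_kernel (fun x y => (g (x, y))%:E).
  by apply: supported_kernel; exists K1, K2.
have finQ : kernel_integral (fun x y => (Num.max (- f (x, y)) 0)%R%:E) u v \is a fin_num.
  by rewrite kernel_integralE; exact: (supported_integral_fin ur vr qQ).
apply: (@le_trans _ _ (\int[u]_x \int[v]_y (f (x, y))%:E + N2 u v)); last first.
  by rewrite leeD2r//; apply: ereal_sup_ubound; exists f.
rewrite (test_integral_parts ur vr tf) addeAC leeBrDr//.
rewrite -(kernel_integralE (fun x y => (g (x, y))%:E)).
rewrite -!kernel_integralD//; apply: le_kernel_integral => //; try exact: nonneg_kernelD.
move=> x y; rewrite /h -!EFinD lee_fin /f.
by rewrite /Num.max; case: ifPn; case: ifPn; rewrite -?leNgt; lra.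
Qed.

End Form.

(** * The energy form *)

Lemma fine_addB {R : realDomainType} (x y z t : \bar R) :
  x \is a fin_num -> y \is a fin_num -> z \is a fin_num -> t \is a fin_num ->
  (fine (x + y) - fine (z + t) = (fine x - fine z) + (fine y - fine t))%R.
Proof. by move=> xf yf zf tf; rewrite !fineD//; ring. Qed.

Lemma fine_mulB {R : realDomainType} (r : R) (x y : \bar R) :
  x \is a fin_num -> y \is a fin_num ->
  (fine (r%:E * x) - fine (r%:E * y) = r * (fine x - fine y))%R.
Proof. by move=> xf yf; rewrite !fineM//= mulrBr. Qed.

(* [kappa] is the difference of the nonnegative lower semicontinuous kernels
   [shift_kernel kappa c] and [cst_kernel c], where [c = 0] unless the space is
   compact. *)
Definition shift_kernel {R : realType} {X : ptopologicalType}
    (kappa : X -> X -> \bar R) (c : R) : X -> X -> \bar R :=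
  fun x y => kappa x y + c%:E.

Definition cst_kernel {R : realType} {X : ptopologicalType} (c : R) :
  X -> X -> \bar R := fun _ _ => c%:E.

(** The real-valued mutual energy of two positive measures with respect to [kappa], the raise by [c]
    being subtracted again. It is meaningful when both integrals are finite, since [fine] sends
    infinity to 0. *)
HB.lock Definition bilin (R : realType) (X : ptopologicalType)
    (kappa : X -> X -> \bar R) (c : R)
    (u v : {measure set (borel X) -> \bar R}) : R :=
  (fine (kernel_integral (shift_kernel kappa c) u v)
   - fine (kernel_integral (cst_kernel c) u v))%R.

Section EnergyForm.
Context {R : realType} {X : ptopologicalType}.
Hypothesis hX : hausdorff_space X.
Hypothesis lcX : locally_compact [set: X].
Variables (kappa : X -> X -> \bar R) (c : R).
Hypothesis kappa_noo : forall x y, kappa x y != -oo.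
Hypothesis c0 : (0 <= c)%R.
Hypothesis cX : c = 0%R \/ compact [set: X].
Hypothesis kappa_posdef : positive_definite kappa.

Hypothesis kk : nonneg_kernel (shift_kernel kappa c).
Implicit Types (u v w : {measure set (borel X) -> \bar R}) (nu omega : set X -> R).

Let hh : nonneg_kernel (@cst_kernel R X c). Proof. exact: nonneg_kernel_cst. Qed.

Notation N1 := (kernel_integral (shift_kernel kappa c)).
Notation N2 := (kernel_integral (cst_kernel c)).

Definition finite_pos u := radon u /\ N1 u u < +oo.

Notation bilin := (bilin kappa c).
Let bilinE u v : bilin u v = (fine (N1 u v) - fine (N2 u v))%R.
Proof. by rewrite unlock. Qed.

Let N2_fin u v : radon u -> radon v -> N2 u v \is a fin_num.
Proof. exact: shift_integral_fin. Qed.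

Let N1_fin u v : N1 u v < +oo -> N1 u v \is a fin_num.
Proof. by move=> ?; rewrite ge0_fin_numE//; exact: kernel_integral_ge0. Qed.

Lemma shift_kernel_sym x y : shift_kernel kappa c x y = shift_kernel kappa c y x.
Proof. by rewrite /shift_kernel kappa_posdef.1. Qed.

Let N1_sym u v : radon u -> radon v -> N1 u v = N1 v u.
Proof. by apply: kernel_integral_sym => //; exact: shift_kernel_sym. Qed.

Let N2_sym u v : radon u -> radon v -> N2 u v = N2 v u.
Proof. by apply: kernel_integral_sym. Qed.

Lemma prod_integralE u v : radon u -> radon v ->
  prod_integral kappa u v = N1 u v - N2 u v.
Proof. exact: prod_integral_shift. Qed.

Lemma prod_integral_bilin u v : radon u -> radon v -> N1 u v < +oo ->
  prod_integral kappa u v = (bilin u v)%:E.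
Proof.
move=> ur vr uv; rewrite prod_integralE// bilinE EFinB !fineK//; first exact: N2_fin.
exact: N1_fin.
Qed.

Lemma prod_integral_fin u v : radon u -> radon v ->
  prod_integral kappa u v < +oo -> N1 u v < +oo.
Proof.
move=> ur vr; rewrite prod_integralE//.
by rewrite -(fineK (N2_fin ur vr)) lteBlDr// => /lt_le_trans; apply; exact: leey.
Qed.

Lemma le_finite_pos u v : finite_pos v -> radon u ->
  (forall B : set (borel X), measurable B -> u B <= v B) -> finite_pos u.
Proof.
move=> [vr vf] ur uv; split => //; apply: le_lt_trans vf.
exact: le_kernel_integral_measure.
Qed.

Lemma represents_sub u v : radon u -> radon v ->
  represents (fun B => fine (u B) - fine (v B))%R u v.
Proof. by []. Qed.

(* The Jordan parts of [u - v] are dominated by [u] and [v], so its energy is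
   defined; positive definiteness then bounds their mutual energy. *)
Lemma finite_pos_cross u v : finite_pos u -> finite_pos v -> N1 u v < +oo.
Proof.
move=> uf vf; have [ur uu] := uf; have [vr vv] := vf.
have rep := represents_sub ur vr.
have [p [n [pE nE [pr nr] [pu nv] bal]]] := jordan_parts hX rep.
have pf := le_finite_pos uf pr pu; have nf := le_finite_pos vf nr nv.
set nu := (fun B => _) in rep pE nE.
have posE : energy_pos kappa nu nu = (bilin p p + bilin n n)%:E.
  by rewrite /energy_pos -pE -nE !prod_integral_bilin//; [exact: nf.2 | exact: pf.2].
have def : energy_defined kappa nu nu by left; rewrite posE ltry.
have sr : signed_radon nu by exists u, v.
have en := kappa_posdef.2 nu sr def.
(* If the mutual energy of [p] and [n] were infinite, the energy of [nu] would be a finite number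
   minus infinity, hence negative. *)
have pn : N1 p n < +oo.
  apply: prod_integral_fin => //; rewrite ltey; apply/negP => /eqP pn.
  have np : prod_integral kappa n p = +oo.
    by rewrite -pn !prod_integralE// N1_sym// N2_sym.
  move: en; rewrite /energy /mutual_energy posE /energy_neg -pE -nE pn np.
  by rewrite addye// addeNy.
(* The balance [p + v = n + u] is used twice: [N1 u v] is at most [N1 u (p + v) = N1 u u + N1 u n],
   and [N1 u n] is at most [N1 (n + u) n = N1 p n + N1 v n], where [n] is dominated by [v]. *)
apply: (@le_lt_trans _ _ (N1 u u + (N1 v v + N1 p n))); last first.
  by rewrite lte_add_pinfty// lte_add_pinfty.
have pvr : radon (measure_add p v) by exact: radon_add.
have e1 : N1 u (measure_add p v) = N1 u (measure_add u n).
  by apply: eq_kernel_integral => // B mB; rewrite !measure_addmE (bal B mB) addeC.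
have e2 : N1 (measure_add n u) n = N1 (measure_add p v) n.
  by apply: eq_kernel_integral => // B mB; rewrite !measure_addmE (bal B mB).
apply: (@le_trans _ _ (N1 u u + N1 u n)).
  rewrite -kernel_integral_addr// -e1.
  apply: le_kernel_integral_measure => // B mB.
  by rewrite measure_addmE leeDr.
rewrite leeD2l//; apply: (@le_trans _ _ (N1 (measure_add n u) n)).
  by rewrite kernel_integral_addl// leeDr//; exact: kernel_integral_ge0.
rewrite e2 kernel_integral_addl// addeC leeD2r//.
exact: le_kernel_integral_measure.
Qed.

Let cross_fin u v : finite_pos u -> finite_pos v -> N1 u v \is a fin_num.
Proof. by move=> uf vf; apply: N1_fin; exact: finite_pos_cross. Qed.

Lemma bilin_sym u v : radon u -> radon v -> bilin u v = bilin v u.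
Proof. by move=> ur vr; rewrite !bilinE N1_sym// N2_sym. Qed.

Lemma finite_pos_add u v : finite_pos u -> finite_pos v ->
  finite_pos (measure_add u v).
Proof.
move=> uf vf; have [ur uu] := uf; have [vr vv] := vf.
have ar := radon_add hX ur vr.
have uv := finite_pos_cross uf vf; have vu := finite_pos_cross vf uf.
split => //; rewrite kernel_integral_addl// !kernel_integral_addr//.
by apply: lte_add_pinfty; apply: lte_add_pinfty.
Qed.

Lemma finite_pos_scale (r : {nonneg R}) u : finite_pos u -> finite_pos (mscale r u).
Proof.
move=> [ur uu]; have sr := radon_scale r ur.
split => //; rewrite kernel_integral_scalel// kernel_integral_scaler//.
by rewrite lte_mul_pinfty// ?mule_ge0 ?kernel_integral_ge0// lte_mul_pinfty// kernel_integral_ge0.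
Qed.

Lemma bilin_addl u1 u2 v : finite_pos u1 -> finite_pos u2 -> finite_pos v ->
  bilin (measure_add u1 u2) v = (bilin u1 v + bilin u2 v)%R.
Proof.
move=> f1 f2 vf; have [[r1 _] [r2 _] [vr _]] := And3 f1 f2 vf.
rewrite !bilinE !kernel_integral_addl//.
exact: (fine_addB (cross_fin f1 vf) (cross_fin f2 vf) (N2_fin r1 vr) (N2_fin r2 vr)).
Qed.

Lemma bilin_scalel (r : {nonneg R}) u v : finite_pos u -> finite_pos v ->
  bilin (mscale r u) v = (r%:num * bilin u v)%R.
Proof.
move=> uf vf; have [[ur _] [vr _]] := conj uf vf.
rewrite !bilinE !kernel_integral_scalel//.
exact: (fine_mulB _ (cross_fin uf vf) (N2_fin ur vr)).
Qed.

Lemma eq_bilin u u' v :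
  (forall B : set (borel X), measurable B -> u B = u' B) -> bilin u v = bilin u' v.
Proof.
move=> uu; rewrite !bilinE; congr (fine _ - fine _)%R; exact: eq_kernel_integral.
Qed.

Lemma bilin_balance p m1 n m2 v :
  finite_pos p -> finite_pos m1 -> finite_pos n -> finite_pos m2 -> finite_pos v ->
  (forall B : set (borel X), measurable B -> p B + m2 B = n B + m1 B) ->
  (bilin p v - bilin n v = bilin m1 v - bilin m2 v)%R.
Proof.
move=> pf f1 nf f2 vf bal.
suff : (bilin p v + bilin m2 v = bilin n v + bilin m1 v)%R by lra.
rewrite -!bilin_addl//; apply: eq_bilin => B mB.
by rewrite !measure_addmE (bal B mB).
Qed.

(** The definition uses Jordan parts. The balance between these and any other decomposition of
    finite energy transfers the value to that decomposition; this is what makes the energy visibly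
    bilinear. *)
Lemma mutual_energyE nu m1 m2 omega w1 w2 :
  represents nu m1 m2 -> represents omega w1 w2 ->
  finite_pos m1 -> finite_pos m2 -> finite_pos w1 -> finite_pos w2 ->
  mutual_energy kappa nu omega =
    (bilin m1 w1 - bilin m1 w2 - bilin m2 w1 + bilin m2 w2)%:E /\
  energy_pos kappa nu omega < +oo.
Proof.
move=> nuE omE f1 f2 g1 g2.
have [p [n [pE nE [pr nr] [pm nm] bal]]] := jordan_parts hX nuE.
have [q [s [qE sE [qr sr] [qm sm] bal']]] := jordan_parts hX omE.
have pf := le_finite_pos f1 pr pm; have nf := le_finite_pos f2 nr nm.
have qf := le_finite_pos g1 qr qm; have sf := le_finite_pos g2 sr sm.
have posE : energy_pos kappa nu omega = (bilin p q + bilin n s)%:E.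
  by rewrite /energy_pos -pE -nE -qE -sE !prod_integral_bilin//; exact: finite_pos_cross.
split; last by rewrite posE ltry.
rewrite /mutual_energy posE /energy_neg -pE -nE -qE -sE !prod_integral_bilin//; try exact: finite_pos_cross.
apply: (congr1 EFin).
have h1 := bilin_balance pf f1 nf f2 qf bal.
have h2 := bilin_balance pf f1 nf f2 sf bal.
have h3 := bilin_balance qf g1 sf g2 f1 bal'.
have h4 := bilin_balance qf g1 sf g2 f2 bal'.
have [m1r _] := f1; have [m2r _] := f2; have [w1r _] := g1; have [w2r _] := g2.
rewrite (bilin_sym qr m1r) (bilin_sym sr m1r) (bilin_sym w1r m1r) (bilin_sym w2r m1r) in h3.
rewrite (bilin_sym qr m2r) (bilin_sym sr m2r) (bilin_sym w1r m2r) (bilin_sym w2r m2r) in h4.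
by lra.
Qed.

Definition decomposed nu := exists m1 m2,
  [/\ represents nu m1 m2, finite_pos m1 & finite_pos m2].

Lemma decomposed_finite nu : decomposed nu -> finite_energy kappa nu.
Proof.
move=> [m1 [m2 [nuE f1 f2]]]; have [E pos] := mutual_energyE nuE nuE f1 f2 f1 f2.
split; [by exists m1, m2; have [] := nuE | by left | by rewrite /energy E].
Qed.

(** A finite difference of [energy_pos] and [energy_neg] has a finite first term, whose summands are
    the self-energies of the two Jordan parts. *)
Lemma jordan_finite nu m1 m2 : represents nu m1 m2 -> finite_energy kappa nu ->
  exists p n, [/\ represents nu p n, finite_pos p, finite_pos n,
    (p : set (borel X) -> \bar R) = pos_part nu &
    (n : set (borel X) -> \bar R) = neg_part nu].
Proof.
move=> nuE [_ _ fin].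
have [p [n [pE nE [pr nr] [pm nm] bal]]] := jordan_parts hX nuE.
have [r1 r2 E] := nuE.
have posfin : prod_integral kappa p p + prod_integral kappa n n \is a fin_num.
  by move: fin; rewrite /energy /mutual_energy fin_numB /energy_pos -pE -nE => /andP[].
have [pp nn] : prod_integral kappa p p < +oo /\ prod_integral kappa n n < +oo.
  move: posfin; rewrite fin_numD => /andP[]; rewrite !fin_numElt.
  by move=> /andP[_ ->] /andP[_ ->].
exists p, n; split => //; try by split => //; exact: prod_integral_fin.
split => // B bB; have [mB _] := bB; rewrite E//.
have := bal B mB.
have [pB nB m1B m2B] := And4 (bounded_borel_fin hX pr bB) (bounded_borel_fin hX nr bB)
  (bounded_borel_fin hX r1 bB) (bounded_borel_fin hX r2 bB).
rewrite -{1}(fineK pB) -{1}(fineK nB) -{1}(fineK m1B) -{1}(fineK m2B) -!EFinD => -[].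
by lra.
Qed.

Lemma finite_decomposed nu : finite_energy kappa nu -> decomposed nu.
Proof.
move=> fin; have [[m1 [m2 [r1 r2 E]]] _ _] := fin.
have nuE : represents nu m1 m2 by [].
by have [p [n [pn pf nf _ _]]] := jordan_finite nuE fin; exists p, n.
Qed.

End EnergyForm.

HB.lock Definition form (R : realType) (X : ptopologicalType)
    (kappa : X -> X -> \bar R) (nu omega : set X -> R) : R :=
  fine (mutual_energy kappa nu omega).

(** * Energy as a positive semidefinite form *)

Section FormAlgebra.
Context {R : realType} {X : ptopologicalType}.
Hypothesis hX : hausdorff_space X.
Hypothesis lcX : locally_compact [set: X].
Variables (kappa : X -> X -> \bar R) (c : R).
Hypothesis kappa_noo : forall x y, kappa x y != -oo.
Hypothesis c0 : (0 <= c)%R.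
Hypothesis cX : c = 0%R \/ compact [set: X].
Hypothesis kappa_posdef : positive_definite kappa.
Hypothesis kk : nonneg_kernel (shift_kernel kappa c).
Implicit Types (u v w : {measure set (borel X) -> \bar R}) (nu omega : set X -> R).

Notation finite_pos := (finite_pos kappa c).
Notation bilin := (bilin kappa c).

Notation form := (form kappa).

Let decomposedP nu : finite_energy kappa nu -> decomposed kappa c nu.
Proof. exact: finite_decomposed. Qed.

Let decomposed_fin nu : decomposed kappa c nu -> finite_energy kappa nu.
Proof. exact: decomposed_finite. Qed.

Lemma mutual_energy_form nu omega : finite_energy kappa nu -> finite_energy kappa omega ->
  mutual_energy kappa nu omega = (form nu omega)%:E.
Proof.
move=> /decomposedP[m1 [m2 [nuE f1 f2]]] /decomposedP[w1 [w2 [omE g1 g2]]].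
have [E _] := mutual_energyE hX lcX kappa_noo c0 cX kappa_posdef kk nuE omE f1 f2 g1 g2.
by rewrite unlock E.
Qed.

Lemma form_bilin nu m1 m2 omega w1 w2 :
  represents nu m1 m2 -> represents omega w1 w2 ->
  finite_pos m1 -> finite_pos m2 -> finite_pos w1 -> finite_pos w2 ->
  form nu omega = (bilin m1 w1 - bilin m1 w2 - bilin m2 w1 + bilin m2 w2)%R.
Proof.
move=> nuE omE f1 f2 g1 g2.
have [E _] := mutual_energyE hX lcX kappa_noo c0 cX kappa_posdef kk nuE omE f1 f2 g1 g2.
by rewrite unlock E.
Qed.

Lemma energy_form nu : finite_energy kappa nu -> energy kappa nu = (form nu nu)%:E.
Proof. by move=> nuf; rewrite /energy mutual_energy_form. Qed.

Lemma form_ge0 nu : finite_energy kappa nu -> (0 <= form nu nu)%R.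
Proof.
move=> nuf; rewrite -lee_fin -energy_form//.
by have [sr def _] := nuf; exact: kappa_posdef.2.
Qed.

Lemma represents_add nu m1 m2 omega w1 w2 :
  represents nu m1 m2 -> represents omega w1 w2 ->
  represents (nu \+ omega)%R (measure_add m1 w1) (measure_add m2 w2).
Proof.
move=> [r1 r2 nuE] [s1 s2 omE]; split; try exact: radon_add.
move=> B bB; rewrite !measure_addmE /= nuE// omE//.
rewrite !fineD ?(bounded_borel_fin hX r1 bB) ?(bounded_borel_fin hX r2 bB)
  ?(bounded_borel_fin hX s1 bB) ?(bounded_borel_fin hX s2 bB)//; ring.
Qed.

Lemma represents_scale (r : {nonneg R}) nu m1 m2 : represents nu m1 m2 ->
  represents (fun B => r%:num * nu B)%R (mscale r m1) (mscale r m2).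
Proof.
move=> [r1 r2 nuE]; split; try exact: radon_scale.
move=> B bB; rewrite nuE// /= /mscale !fineM ?(bounded_borel_fin hX r1 bB)
  ?(bounded_borel_fin hX r2 bB)//=; ring.
Qed.

Lemma finite_energyD nu omega : finite_energy kappa nu -> finite_energy kappa omega ->
  finite_energy kappa (nu \+ omega)%R.
Proof.
move=> /decomposedP[m1 [m2 [nuE f1 f2]]] /decomposedP[w1 [w2 [omE g1 g2]]].
apply: decomposed_fin; exists (measure_add m1 w1), (measure_add m2 w2); split.
- exact: represents_add.
- exact: (finite_pos_add hX lcX kappa_noo c0 cX kappa_posdef kk).
- exact: (finite_pos_add hX lcX kappa_noo c0 cX kappa_posdef kk).
Qed.

Lemma finite_energyN nu : finite_energy kappa nu -> finite_energy kappa (\- nu)%R.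
Proof.
move=> /decomposedP[m1 [m2 [nuE f1 f2]]].
by apply: decomposed_fin; exists m2, m1; split => //; exact: represents_neg.
Qed.

Let finite_energyZ_ge0 (r : {nonneg R}) nu : finite_energy kappa nu ->
  finite_energy kappa (fun B => r%:num * nu B)%R.
Proof.
move=> /decomposedP[m1 [m2 [nuE f1 f2]]].
apply: decomposed_fin; exists (mscale r m1), (mscale r m2); split.
- exact: represents_scale.
- exact: (finite_pos_scale hX lcX).
- exact: (finite_pos_scale hX lcX).
Qed.

Lemma finite_energyZ (r : R) nu : finite_energy kappa nu ->
  finite_energy kappa (fun B => r * nu B)%R.
Proof.
move=> nuf; have [r0|r0] := leP 0%R r; first exact: (finite_energyZ_ge0 (NngNum r0)).
have nr0 : (0 <= - r)%R by rewrite oppr_ge0 ltW.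
have := finite_energyN (finite_energyZ_ge0 (NngNum nr0) nuf).
by congr finite_energy; apply/funext => B /=; rewrite mulNr opprK.
Qed.

Lemma finite_energyB nu omega : finite_energy kappa nu -> finite_energy kappa omega ->
  finite_energy kappa (nu \- omega)%R.
Proof. by move=> nuf omf; exact: finite_energyD nuf (finite_energyN omf). Qed.

Lemma form_sym nu omega : finite_energy kappa nu -> finite_energy kappa omega ->
  form nu omega = form omega nu.
Proof.
move=> /decomposedP[m1 [m2 [nuE f1 f2]]] /decomposedP[w1 [w2 [omE g1 g2]]].
rewrite (form_bilin nuE omE)// (form_bilin omE nuE)//.
have [[r1 _] [r2 _] [s1 _] [s2 _]] := And4 f1 f2 g1 g2.
have sym := bilin_sym hX lcX c0 kappa_posdef kk.
by rewrite (sym _ _ r1 s1) (sym _ _ r1 s2) (sym _ _ r2 s1) (sym _ _ r2 s2); ring.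
Qed.

Lemma formDl nu nu' omega : finite_energy kappa nu -> finite_energy kappa nu' ->
  finite_energy kappa omega ->
  form (nu \+ nu')%R omega = (form nu omega + form nu' omega)%R.
Proof.
move=> /decomposedP[m1 [m2 [nuE f1 f2]]] /decomposedP[w1 [w2 [omE g1 g2]]].
move=> /decomposedP[v1 [v2 [vE h1 h2]]].
have add := finite_pos_add hX lcX kappa_noo c0 cX kappa_posdef kk.
rewrite (form_bilin nuE vE)// (form_bilin omE vE)//.
rewrite (form_bilin (represents_add nuE omE) vE)//; try exact: add.
have badd := bilin_addl hX lcX kappa_noo c0 cX kappa_posdef kk.
by rewrite !badd//; ring.
Qed.

Lemma formNl nu omega : finite_energy kappa nu -> finite_energy kappa omega ->
  form (\- nu)%R omega = (- form nu omega)%R.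
Proof.
move=> /decomposedP[m1 [m2 [nuE f1 f2]]] /decomposedP[v1 [v2 [vE h1 h2]]].
by rewrite (form_bilin nuE vE)// (form_bilin (represents_neg nuE) vE)//; ring.
Qed.

Let formZl_ge0 (r : {nonneg R}) nu omega : finite_energy kappa nu ->
  finite_energy kappa omega ->
  form (fun B => r%:num * nu B)%R omega = (r%:num * form nu omega)%R.
Proof.
move=> /decomposedP[m1 [m2 [nuE f1 f2]]] /decomposedP[v1 [v2 [vE h1 h2]]].
have sc := finite_pos_scale hX lcX kk r.
rewrite (form_bilin nuE vE)// (form_bilin (represents_scale r nuE) vE)//; try exact: sc.
have bsc := bilin_scalel hX lcX kappa_noo c0 cX kappa_posdef kk r.
by rewrite !bsc//; ring.
Qed.

Lemma formZl (r : R) nu omega : finite_energy kappa nu -> finite_energy kappa omega ->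
  form (fun B => r * nu B)%R omega = (r * form nu omega)%R.
Proof.
move=> nuf omf; have [r0|r0] := leP 0%R r; first exact: (formZl_ge0 (NngNum r0)).
have nr0 : (0 <= - r)%R by rewrite oppr_ge0 ltW.
rewrite (_ : (fun B => r * nu B)%R = (\- (fun B => (NngNum nr0)%:num * nu B))%R); last first.
  by apply/funext => B /=; rewrite mulNr opprK.
rewrite (formNl (finite_energyZ_ge0 (NngNum nr0) nuf) omf).
by rewrite (formZl_ge0 (NngNum nr0) nuf omf)/= mulNr opprK.
Qed.

Lemma formBl nu nu' omega : finite_energy kappa nu -> finite_energy kappa nu' ->
  finite_energy kappa omega ->
  form (nu \- nu')%R omega = (form nu omega - form nu' omega)%R.
Proof.
move=> nuf nuf' omf; rewrite [form _ _](formDl nuf (finite_energyN nuf') omf).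
by rewrite formNl.
Qed.

Lemma form_sqB nu omega : finite_energy kappa nu -> finite_energy kappa omega ->
  form (nu \- omega)%R (nu \- omega)%R =
  (form nu nu - 2 * form nu omega + form omega omega)%R.
Proof.
move=> nuf omf; have df := finite_energyB nuf omf.
rewrite formBl// (form_sym nuf df) (form_sym omf df) !formBl// (form_sym omf nuf).
ring.
Qed.

Lemma radon_zero : radon (mzero : {measure set (borel X) -> \bar R}).
Proof.
split=> [K _|B _]; first by rewrite /= /mzero ltry.
rewrite /= {1}/mzero; apply/esym/eqP; rewrite eq_le; apply/andP; split.
  by apply/ereal_supP => _ [K _ <-].
by apply: le_ereal_sup_tmp; exists 0 => //; exists set0 => //; split => //; exact: compact0.
Qed.

Lemma finite_pos_zero : finite_pos mzero.
Proof.
split; first exact: radon_zero.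
by rewrite kernel_integralE integral_measure_zero.
Qed.

Lemma represents_pos u : radon u -> represents (signed_of u) u mzero.
Proof. by move=> ur; split => //; [exact: radon_zero | move=> B _; rewrite subr0]. Qed.

Lemma finite_energy_pos u : finite_pos u -> finite_energy kappa (signed_of u).
Proof.
move=> uf; apply: decomposed_fin; exists u, mzero; split => //.
- by apply: represents_pos; exact: uf.1.
- exact: finite_pos_zero.
Qed.

Lemma form_pos u v : finite_pos u -> finite_pos v ->
  form (signed_of u) (signed_of v) = bilin u v.
Proof.
move=> uf vf; have zf := finite_pos_zero.
rewrite (form_bilin (represents_pos uf.1) (represents_pos vf.1))//.
have z0 w : bilin mzero w = 0%R.
  by rewrite unlock !kernel_integralE !integral_measure_zero subrr.
have sym := bilin_sym hX lcX c0 kappa_posdef kk.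
rewrite (sym _ _ uf.1 zf.1) !z0; ring.
Qed.

Lemma finite_energy_sum (I : Type) (s : seq I) (r : I -> R) (nu_ : I -> set X -> R) :
  (forall i, finite_energy kappa (nu_ i)) ->
  finite_energy kappa (fun B => \sum_(i <- s) r i * nu_ i B)%R.
Proof.
move=> nuf; elim: s => [|i s IH].
  rewrite (_ : (fun _ => _) = signed_of mzero); first exact: finite_energy_pos finite_pos_zero.
  by apply/funext => B; rewrite big_nil.
rewrite (_ : (fun _ => _) = ((fun B => r i * nu_ i B) \+ (fun B => \sum_(i <- s) r i * nu_ i B))%R).
  exact: (finite_energyD (finite_energyZ (r i) (nuf i)) IH).
by apply/funext => B /=; rewrite big_cons.
Qed.

Lemma form_suml (I : Type) (s : seq I) (r : I -> R) (nu_ : I -> set X -> R) omega :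
  (forall i, finite_energy kappa (nu_ i)) -> finite_energy kappa omega ->
  form (fun B => \sum_(i <- s) r i * nu_ i B)%R omega =
  (\sum_(i <- s) r i * form (nu_ i) omega)%R.
Proof.
move=> nuf omf; elim: s => [|i s IH].
  rewrite big_nil (_ : (fun _ => _) = (fun B => 0 * omega B)%R); first by rewrite formZl// mul0r.
  by apply/funext => B; rewrite big_nil mul0r.
rewrite (_ : (fun _ => _) = ((fun B => r i * nu_ i B) \+ (fun B => \sum_(i <- s) r i * nu_ i B))%R).
  rewrite (formDl (finite_energyZ (r i) (nuf i)) (finite_energy_sum s r nuf) omf).
  by rewrite (formZl _ (nuf i) omf) IH big_cons.
by apply/funext => B /=; rewrite big_cons.
Qed.

End FormAlgebra.

(** * Integrating potential inequalities that hold nearly everywhere *)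

Section WeakDuality.
Context {R : realType} {X : ptopologicalType}.
Hypothesis hX : hausdorff_space X.
Hypothesis lcX : locally_compact [set: X].
Variables (kappa : X -> X -> \bar R) (c : R).
Hypothesis kappa_noo : forall x y, kappa x y != -oo.
Hypothesis c0 : (0 <= c)%R.
Hypothesis cX : c = 0%R \/ compact [set: X].
Hypothesis kappa_posdef : positive_definite kappa.
Hypothesis kk : nonneg_kernel (shift_kernel kappa c).
Implicit Types (u v w : {measure set (borel X) -> \bar R}) (nu omega : set X -> R).

Let hh : nonneg_kernel (@cst_kernel R X c). Proof. exact: nonneg_kernel_cst. Qed.

Notation finite_pos := (finite_pos kappa c).
Notation bilin := (bilin kappa c).
Notation form := (form kappa).
Notation k := (shift_kernel kappa c).
Notation h := (@cst_kernel R X c).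

Lemma form_pos_l u nu p n : finite_pos u -> represents nu p n ->
  finite_pos p -> finite_pos n ->
  form (signed_of u) nu = (bilin u p - bilin u n)%R.
Proof.
move=> uf nuE pf nf; have zf := finite_pos_zero kappa c.
rewrite (form_bilin hX lcX kappa_noo c0 cX kappa_posdef kk (represents_pos uf.1) nuE)//.
have z0 w : bilin mzero w = 0%R.
  by rewrite unlock !kernel_integralE !integral_measure_zero subrr.
rewrite !z0; ring.
Qed.

(* Otherwise the restriction of [u] to a compact part of the exceptional set,
   once normalized, has finite energy. *)
Lemma ne_null (E : set X) u (B : set (borel X)) : pos_radon_on E u -> finite_pos u ->
  measurable B -> nearly_everywhere kappa E (fun x => B x) -> u (~` B) = 0.
Proof.
move=> uE uf mB ne; apply/eqP; rewrite eq_le measure_ge0 andbT leNgt; apply/negP.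
have [ur _] := uE; have mBC : measurable (~` B) by exact: measurableC.
rewrite (radon_on_sup hX uE mBC) => /ereal_sup_gt[_ [K [cK KB] <-] uK0].
have mK : measurable (K : set (borel X)) by exact: compact_borel.
have uKfin : u K \is a fin_num := bounded_borel_fin hX ur (compact_bounded_borel hX cK).
have fK0 : (0 < fine (u K))%R by rewrite fine_gt0// uK0 ltey_eq uKfin.
have r0 : (0 <= (fine (u K))^-1)%R by rewrite invr_ge0 ltW.
pose r : {nonneg R} := NngNum r0.
pose theta : {measure set (borel X) -> \bar R} := mscale r (mrestr u mK).
have thetaE (D : set (borel X)) : theta D = (fine (u K))^-1%:E * u (D `&` K) by [].
have rf : finite_pos (mrestr u mK).
  apply: (le_finite_pos hX lcX kk uf (radon_restr hX mK ur)) => D mD.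
  by rewrite /= /mrestr le_measure ?inE//; exact: measurableI.
have tf : finite_pos theta by exact: (finite_pos_scale hX lcX kk r rf).
have tZ : pos_radon_on [set x | E x /\ ~ B x] theta.
  split; first exact: tf.1.
  move=> L cL; exists (~` K); split; first exact: measurableC.
    by rewrite thetaE setICl measure0 mule0.
  by move=> x [Lx nx] Kx; apply: nx; have [? ?] := KB _ Kx.
have t1 : theta setT = 1.
  by rewrite thetaE setTI -(fineK uKfin) -EFinM mulVf// gt_eqF.
have fin := finite_energy_pos hX lcX kappa_noo c0 cX kappa_posdef kk tf.
(* Capacity zero means that the infimum of the energies is [+oo], whereas [theta] contributes a
   finite energy. *)
move: ne; rewrite /nearly_everywhere /interior_capacity => /eqP; rewrite inve_eq0 => /eqP infy.
have : ereal_inf [set energy kappa (signed_of v) | v in [set v |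
    pos_finite_energy_on kappa [set x | E x /\ ~ B x] v /\ v setT = 1]] <= energy kappa (signed_of theta).
  by apply: ereal_inf_lbound; exists theta.
rewrite infy (energy_form hX lcX kappa_noo c0 cX kappa_posdef kk fin).
by rewrite leye_eq.
Qed.

Lemma kernel_potential_integrable (l : X -> X -> \bar R) u v : nonneg_kernel l ->
  radon v -> kernel_integral l u v < +oo ->
  u.-integrable setT (kernel_potential l v : borel X -> \bar R).
Proof.
move=> ll vr; rewrite kernel_integralE => uv; apply/integrableP; split.
  exact: (kernel_potential_borel hX lcX).
by under eq_integral do rewrite gee0_abs ?kernel_potential_ge0//.
Qed.

(** The potential of [nu] is [u]-integrable because the mutual energies of [u] with the Jordan parts
    of [nu] are finite. The inequality fails only on a [u]-null set and can therefore be integrated;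
    it will be used with [s = alpha i * a i]. *)
Lemma weak_duality (E : set X) u nu (g : X -> R) (t q s : R) :
  pos_radon_on E u -> finite_pos u -> finite_energy kappa nu ->
  continuous g -> (forall x, (0 < g x)%R) -> \int[u]_x (g x)%:E = t%:E ->
  nearly_everywhere kappa E (fun x => potential_defined kappa x nu /\
    (q * g x)%:E <= s%:E * potential kappa x nu) ->
  (q * t <= s * form (signed_of u) nu)%R.
Proof.
move=> uE uf nuf cg g0 gt ne; have [ur _] := uE.
have [m1 [m2 [nuE0 _ _]]] := finite_decomposed hX lcX kappa_noo c0 cX kk nuf.
have [p [n [nuE pf nf pE nE]]] := jordan_finite hX lcX kappa_noo c0 cX kk nuE0 nuf.
have [pr _] := pf; have [nr _] := nf.
have potE v x : radon v -> \int[v]_y kappa x y = kernel_potential k v x - kernel_potential h v x.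
  exact: potential_shift.
have mpot v : radon v -> measurable_fun setT (fun x : borel X => \int[v]_y kappa x y).
  move=> vr; rewrite (_ : (fun _ => _) = kernel_potential k v \- kernel_potential h v); last first.
    by apply/funext => x; rewrite potE.
  by apply: emeasurable_funB; exact: (kernel_potential_borel hX lcX).
(* [B] is taken in all of [X]: its measurability then follows from that of the potentials, even when
   [E] is not Borel. *)
pose B : set (borel X) := [set x | potential_defined kappa x nu /\
    (q * g x)%:E <= s%:E * potential kappa x nu].
have mg : measurable_fun setT (fun x : borel X => (g x)%:E).
  by apply/measurable_EFinP; exact: continuous_borel.
have mpotnu : measurable_fun setT (fun x : borel X => potential kappa x nu).
  by rewrite /potential -pE -nE; apply: emeasurable_funB; exact: mpot.
have mB : measurable B.
  have -> : B = ([set x | \int[p]_y kappa x y < +oo] `|` [set x | \int[n]_y kappa x y < +oo])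
      `&` [set x | (q * g x)%:E <= s%:E * potential kappa x nu].
    by rewrite /B /potential_defined -pE -nE.
  have mlt v : radon v -> measurable ([set x | \int[v]_y kappa x y < +oo] : set (borel X)).
    by move=> vr; rewrite -[X in measurable X]setTI; apply: measurable_lte => //; exact: mpot.
  apply: measurableI; first by apply: measurableU; exact: mlt.
  rewrite -[X in measurable X]setTI; apply: measurable_lee => //.
    under eq_fun do rewrite EFinM.
    exact: measurable_funeM.
  exact: measurable_funeM.
have uB : u (~` B) = 0 by exact: ne_null uE uf mB ne.
have N1fin v : finite_pos v -> kernel_integral k u v \is a fin_num.
  move=> vf; rewrite ge0_fin_numE; last exact: kernel_integral_ge0.
  exact: (finite_pos_cross hX lcX kappa_noo c0 cX kappa_posdef kk uf vf).
have N2fin v : finite_pos v -> kernel_integral h u v \is a fin_num.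
  by move=> vf; exact: (shift_integral_fin c0 cX uf.1 vf.1).
have i1 v : finite_pos v -> u.-integrable setT (kernel_potential k v : borel X -> \bar R).
  move=> vf; apply: kernel_potential_integrable => //; first exact: vf.1.
  by have := N1fin v vf; rewrite fin_numElt => /andP[].
have i2 v : finite_pos v -> u.-integrable setT (kernel_potential h v : borel X -> \bar R).
  move=> vf; apply: kernel_potential_integrable => //; first exact: vf.1.
  by have := N2fin v vf; rewrite fin_numElt => /andP[].
have i12 v : finite_pos v -> u.-integrable setT (kernel_potential k v \- kernel_potential h v).
  by move=> vf; apply: integrableB => //; [exact: i1 | exact: i2].
pose V x := (kernel_potential k p x - kernel_potential h p x)
          - (kernel_potential k n x - kernel_potential h n x).
have VE x : potential kappa x nu = V x by rewrite /potential -pE -nE !potE.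
have iV : u.-integrable setT (V : borel X -> \bar R).
  by apply: integrableB => //; exact: i12.
have intV : \int[u]_x V x = (form (signed_of u) nu)%:E.
  rewrite (form_pos_l uf nuE pf nf) integralB//; try exact: i12.
  have bE v : finite_pos v -> \int[u]_x (kernel_potential k v \- kernel_potential h v) x = (bilin u v)%:E.
    move=> vf; rewrite integralB//; [|exact: i1|exact: i2].
    rewrite -!(kernel_integralE _ u v) -(fineK (N1fin v vf)) -(fineK (N2fin v vf)).
    by rewrite [in RHS]unlock.
  by rewrite bE// bE.
have ig : u.-integrable setT (fun x : borel X => (g x)%:E).
  apply/integrableP; split => //.
  under eq_integral do rewrite gee0_abs ?lee_fin ?ltW//.
  by rewrite gt ltry.
have iqg : u.-integrable setT (fun x : borel X => q%:E * (g x)%:E) by exact: integrableZl.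
have isV : u.-integrable setT (fun x : borel X => s%:E * V x) by exact: integrableZl.
have TB (f : borel X -> \bar R) : u.-integrable setT f -> \int[u]_x f x = \int[u]_(x in B) f x.
  move=> fi; rewrite (@negligible_integral _ _ _ _ _ (~` B))//; last exact: measurableC.
  by rewrite setTD setCK.
rewrite -lee_fin EFinM -gt -integralZl// (EFinM s) -intV -integralZl// !TB//.
apply: le_integral => //.
- exact: integrableS iqg.
- exact: integrableS isV.
- by move=> x /[!inE] -[_]; rewrite VE EFinM.
Qed.

End WeakDuality.

(** * Condensers *)

Section Condenser.
Context {R : realType} {X : ptopologicalType}.
Hypothesis hX : hausdorff_space X.
Hypothesis lcX : locally_compact [set: X].
Variables (kappa : X -> X -> \bar R) (c : R).
Hypothesis kappa_noo : forall x y, kappa x y != -oo.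
Hypothesis c0 : (0 <= c)%R.
Hypothesis cX : c = 0%R \/ compact [set: X].
Hypothesis kappa_posdef : positive_definite kappa.
Hypothesis kk : nonneg_kernel (shift_kernel kappa c).
Implicit Types (u v w : {measure set (borel X) -> \bar R}) (nu omega : set X -> R).

Notation finite_pos := (finite_pos kappa c).
Notation bilin := (bilin kappa c).
Notation form := (form kappa).

Let fe_pos := finite_energy_pos hX lcX kappa_noo c0 cX kappa_posdef kk.
Let feB := finite_energyB hX lcX kappa_noo c0 cX kappa_posdef kk.
Let feD := finite_energyD hX lcX kappa_noo c0 cX kappa_posdef kk.
Let feZ := finite_energyZ hX lcX kappa_noo c0 cX kappa_posdef kk.
Let f_ge0 := form_ge0 hX lcX kappa_noo c0 cX kappa_posdef kk.
Let f_sqB := form_sqB hX lcX kappa_noo c0 cX kappa_posdef kk.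
Let f_sym := form_sym hX lcX kappa_noo c0 cX kappa_posdef kk.
Let fDl := formDl hX lcX kappa_noo c0 cX kappa_posdef kk.
Let fBl := formBl hX lcX kappa_noo c0 cX kappa_posdef kk.
Let fZl := formZl hX lcX kappa_noo c0 cX kappa_posdef kk.

(** This replaces the triangle inequality without square roots: it is positivity of the form at the
    sum of the two differences on the right. *)
Lemma form_parallelogram nu omega lambda : finite_energy kappa nu ->
  finite_energy kappa omega -> finite_energy kappa lambda ->
  (form (nu \- omega)%R (nu \- omega)%R <=
   2 * form (lambda \- nu)%R (lambda \- nu)%R +
   2 * form (lambda \- omega)%R (lambda \- omega)%R)%R.
Proof.
move=> nuf omf laf; have d1 := feB laf nuf; have d2 := feB laf omf.
rewrite (_ : (nu \- omega)%R = ((lambda \- omega) \- (lambda \- nu))%R); last first.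
  by apply/funext => B /=; ring.
have := f_ge0 (feD d1 d2).
rewrite (f_sqB d2 d1) (fDl d1 d2 (feD d1 d2)) (f_sym d1 (feD d1 d2)) (f_sym d2 (feD d1 d2)).
rewrite (fDl d1 d2 d1) (fDl d1 d2 d2) (f_sym d1 d2).
by lra.
Qed.

(* Cauchy-Schwarz in the degenerate case. *)
Lemma form_null nu omega : finite_energy kappa nu -> finite_energy kappa omega ->
  form omega omega = 0%R -> form nu omega = 0%R.
Proof.
move=> nuf omf om0; have pos t := f_ge0 (feB nuf (feZ t omf)).
have {}pos t : (0 <= form nu nu - 2 * t * form nu omega)%R.
  have := pos t; rewrite (f_sqB nuf (feZ t omf)) (f_sym nuf (feZ t omf)) (fZl t omf nuf).
  rewrite (fZl t omf (feZ t omf)) (f_sym omf (feZ t omf)) (fZl t omf omf) om0 (f_sym omf nuf).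
  by rewrite !mulr0 addr0 mulrA.
apply/eqP; apply: contraT => nz.
(* For this value of [t] the quadratic expression in [pos] equals -1. *)
have := pos ((form nu nu + 1) / (2 * form nu omega))%R.
rewrite (_ : (2 * _ * _ = form nu nu + 1)%R); first by lra.
by field.
Qed.

Lemma pos_radon_onS (E E' : set X) u : E `<=` E' -> pos_radon_on E u -> pos_radon_on E' u.
Proof.
move=> EE' [ur uE]; split => // K cK.
by apply: negligibleS (uE K cK) => x [Kx nE]; split => // /EE'.
Qed.

Section Plates.
Variables (m p : nat) (A : 'I_(m + p) -> set X).
Hypothesis A_condenser : condenser A.
Implicit Types mu : vmeasure R X m p.

Lemma alpha_sq (i : 'I_(m + p)) : (alpha i * alpha i = 1 :> R)%R.
Proof. by rewrite /alpha; case: ifP => _; rewrite ?mulr1// mulrNN mulr1. Qed.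

Lemma alpha_neg_disjoint (i j : 'I_(m + p)) : (alpha i * alpha j < 0 :> R)%R ->
  closure (A i) `&` closure (A j) = set0.
Proof.
rewrite /alpha; have [im|mi] := ltnP i m; have [jm|mj] := ltnP j m.
- by rewrite mulr1 ltr10.
- by move=> _; exact: A_condenser.2.
- by move=> _; rewrite setIC; exact: A_condenser.2.
- by rewrite mulrNN mulr1 ltr10.
Qed.

(* The plates of sign opposite to [A i] do not charge [closure (A i)], and those
   of the same sign only help. *)
Lemma component_le mu (i : 'I_(m + p)) (K : set X) :
  (forall j, pos_radon_on (closure (A j)) (mu j)) -> compact K ->
  exists C, [/\ bounded_borel C, C `<=` K &
    ((mu i) K <= (alpha i * signed_sum mu C)%:E)].
Proof.
move=> muA cK; pose F := closure (A i).
have mF : measurable (F : set (borel X)).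
  rewrite -[F]setCK; apply: (@measurableC _ (borel X)); apply: open_borel.
  exact/closed_openC/closed_closure.
have mK := compact_borel hX cK.
have mKF : measurable (K `&` F : set (borel X)) by exact: measurableI.
have bKF : bounded_borel (K `&` F).
  exact: (bounded_borelS (compact_bounded_borel hX cK) mKF (@subIsetl _ _ _)).
exists (K `&` F); split => //.
have null j D : D `<=` K -> measurable (D : set (borel X)) ->
    D `&` closure (A j) = set0 -> mu j D = 0.
  move=> DK mD DA; apply/negligibleP => //.
  apply: negligibleS ((muA j).2 K cK) => x Dx; split; first exact: DK.
  by move=> Ax; suff: (set0 : set X) x by []; rewrite -DA.
have -> : mu i K = mu i (K `&` F).
  rewrite (measureDI (mu i) mK mF) [X in X + _](null i (K `\` F)) ?add0e//.
  - exact: measurableD.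
  - by rewrite -subset0 => x [[_ nFx] Fx].
rewrite -(fineK (bounded_borel_fin hX (muA i).1 bKF)) lee_fin /signed_sum mulr_sumr.
rewrite (bigD1 i)//= mulrA alpha_sq mul1r lerDl; apply: sumr_ge0 => j ji.
rewrite mulrA; have [aij|aij] := leP 0%R (alpha i * alpha j : R)%R.
  by rewrite mulr_ge0// fine_ge0.
rewrite /signed_of (null j (K `&` F)) ?mulr0//.
by rewrite -setIA (alpha_neg_disjoint aij) setI0.
Qed.

(** By [component_le] and inner regularity, [mu i] lies below the positive or the negative Jordan
    part of the signed sum, according to its sign, and Jordan parts of a measure of finite energy
    have finite energy. *)
Lemma component_finite mu : (forall j, pos_radon_on (closure (A j)) (mu j)) ->
  finite_energy kappa (signed_sum mu) -> forall i, finite_pos (mu i).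
Proof.
move=> muA muf i.
have [m1 [m2 [nuE0 _ _]]] := finite_decomposed hX lcX kappa_noo c0 cX kk muf.
have [q [n [nuE qf nf qE nE]]] := jordan_finite hX lcX kappa_noo c0 cX kk nuE0 muf.
have [ir _] := muA i.
case: (ltnP i m) => im.
- apply: (le_finite_pos hX lcX kk qf ir) => B mB.
  rewrite qE ir.2//; apply/ereal_supP => _ [K [cK KB] <-].
  have [C [bC CK Cle]] := component_le i muA cK.
  apply: (le_trans Cle); rewrite /alpha im mul1r.
  by apply: ereal_sup_ubound; exists C => //; split => //; exact: subset_trans KB.
- apply: (le_finite_pos hX lcX kk nf ir) => B mB.
  rewrite nE ir.2//; apply/ereal_supP => _ [K [cK KB] <-].
  have [C [bC CK Cle]] := component_le i muA cK.
  apply: (le_trans Cle); rewrite /alpha ltnNge im /= mulN1r.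
  by apply: ereal_sup_ubound; exists C => //; split => //; exact: subset_trans KB.
Qed.

Lemma signed_sum_finite mu : (forall i, finite_pos (mu i)) ->
  finite_energy kappa (signed_sum mu).
Proof.
move=> muf; apply: (finite_energy_sum hX lcX kappa_noo c0 cX kappa_posdef kk) => i.
exact: fe_pos.
Qed.

Lemma form_signed_suml mu omega : (forall i, finite_pos (mu i)) ->
  finite_energy kappa omega ->
  form (signed_sum mu) omega = (\sum_i alpha i * form (signed_of (mu i)) omega)%R.
Proof.
move=> muf omf; apply: (form_suml hX lcX kappa_noo c0 cX kappa_posdef kk) => // i.
exact: fe_pos.
Qed.

Lemma form_signed_sum mu : (forall i, finite_pos (mu i)) ->
  form (signed_sum mu) (signed_sum mu) =
  (\sum_i \sum_j alpha i * alpha j * bilin (mu i) (mu j))%R.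
Proof.
move=> muf; have sf := signed_sum_finite muf; rewrite form_signed_suml//.
apply: eq_bigr => i _; rewrite f_sym//; last exact: fe_pos.
rewrite form_signed_suml//; last exact: fe_pos.
rewrite mulr_sumr; apply: eq_bigr => j _.
rewrite f_sym; try exact: fe_pos.
by rewrite (form_pos hX lcX kappa_noo c0 cX kappa_posdef kk)// mulrA.
Qed.

(** The identity survives infinite values: [fine] then gives 0 on the right, and on the left as
    well, also for [r = 0] because 0 times infinity is 0. *)
Lemma signed_of_scale (r : {nonneg R}) u (B : set X) :
  signed_of (mscale r u) B = (r%:num * signed_of u B)%R.
Proof.
rewrite /signed_of /= /mscale; case: (u B) => [x|/=|/=] //; rewrite mulr0.
- have [->|r0] := eqVneq (r%:num)%R 0%R; first by rewrite mul0e.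
  by rewrite gt0_muley// lte_fin lt_def r0/=.
- have [->|r0] := eqVneq (r%:num)%R 0%R; first by rewrite mul0e.
  by rewrite gt0_muleNy// lte_fin lt_def r0/=.
Qed.

Lemma pos_radon_on_scale (r : {nonneg R}) (E : set X) u :
  pos_radon_on E u -> pos_radon_on E (mscale r u).
Proof.
move=> [ur uE]; split; first exact: radon_scale.
move=> K /uE[N [mN uN KN]]; exists N; split => //.
by rewrite /= /mscale uN mule0.
Qed.

Variables (a : 'I_(m + p) -> R) (g : X -> R).
Hypotheses (g_cont : continuous g) (g_gt0 : forall x, (0 < g x)%R).
Hypothesis a_gt0 : forall i, (0 < a i)%R.

Lemma admissible_finite (K : 'I_(m + p) -> set X) (b : 'I_(m + p) -> R) lambda :
  sub_condenser K A -> admissible kappa K b g lambda -> forall i, finite_pos (lambda i).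
Proof.
move=> KA [[laK laf] _]; apply: component_finite => // j.
by apply: pos_radon_onS (laK j); exact: subset_trans (KA j) (@subset_closure _ _).
Qed.

Lemma admissible_scale (r : {nonneg R}) (K : 'I_(m + p) -> set X) (b : 'I_(m + p) -> R) lambda :
  sub_condenser K A -> admissible kappa K b g lambda ->
  admissible kappa K (fun i => b i * r%:num)%R g (fun i => mscale r (lambda i)).
Proof.
move=> KA ad; have fp := admissible_finite KA ad; have [[laK laf] gla] := ad.
split; first split.
- by move=> i; exact: pos_radon_on_scale.
- by apply: signed_sum_finite => i; exact: (finite_pos_scale hX lcX).
- move=> i; rewrite ge0_integral_mscale//.
  + by rewrite gla -EFinM mulrC.
  + by apply/measurable_EFinP; exact: continuous_borel.
  + by move=> x _; rewrite lee_fin ltW.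
Qed.

Lemma signed_sum_scale (r : {nonneg R}) (lambda : vmeasure R X m p) :
  signed_sum (fun i => mscale r (lambda i)) = (fun B => r%:num * signed_sum lambda B)%R.
Proof.
apply/funext => B; rewrite /signed_sum mulr_sumr; apply: eq_bigr => i _.
by rewrite signed_of_scale; ring.
Qed.

(** The factor [a i] occurs in both the mass of [lambda i] and the constraint, and cancels. The
    parameter [t] covers both normalizations: [t = 1] for the problem on [A], and [t] the capacity
    of [K] for the rescaled minimizers. *)
Lemma plate_duality (K : 'I_(m + p) -> set X) lambda nu (t q : R) (i : 'I_(m + p)) :
  sub_condenser K A -> admissible kappa K (fun i => a i * t)%R g lambda ->
  finite_energy kappa nu ->
  nearly_everywhere kappa (A i) (fun x => potential_defined kappa x nu /\
    (q * g x)%:E <= (alpha i * a i)%:E * potential kappa x nu) ->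
  (q * t <= alpha i * form (signed_of (lambda i)) nu)%R.
Proof.
move=> KA ad nuf ne; have fp := admissible_finite KA ad; have [[laK laf] gla] := ad.
have laA : pos_radon_on (A i) (lambda i) by exact: pos_radon_onS (KA i) (laK i).
have := weak_duality hX lcX kappa_noo c0 cX kappa_posdef kk laA (fp i) nuf g_cont g_gt0 (gla i) ne.
rewrite (_ : q * (a i * t) = a i * (q * t))%R; last by ring.
by rewrite (_ : alpha i * a i * _ = a i * (alpha i * form (signed_of (lambda i)) nu))%R;
  [rewrite ler_pM2l | ring].
Qed.

Lemma dual_form_ge (K : 'I_(m + p) -> set X) lambda nu (t : R) (q : 'I_(m + p) -> R) :
  sub_condenser K A -> admissible kappa K (fun i => a i * t)%R g lambda ->
  finite_energy kappa nu ->
  (forall i, nearly_everywhere kappa (A i) (fun x => potential_defined kappa x nu /\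
    (q i * g x)%:E <= (alpha i * a i)%:E * potential kappa x nu)) ->
  ((\sum_i q i) * t <= form (signed_sum lambda) nu)%R.
Proof.
move=> KA ad nuf ne; have fp := admissible_finite KA ad.
rewrite form_signed_suml// mulr_suml; apply: ler_sum => i _.
exact: plate_duality KA ad nuf (ne i).
Qed.

End Plates.
End Condenser.

(** * Inner approximation by compact condensers *)

Lemma cvg_sumr {R : realType} (I : Type) (s : seq I) (f : I -> nat -> R) (l : I -> R) :
  (forall i, f i n @[n --> \oo] --> l i) ->
  (\sum_(i <- s) f i n)%R @[n --> \oo] --> (\sum_(i <- s) l i)%R.
Proof.
move=> fl; elim: s => [|i s IH].
  by rewrite big_nil; under eq_fun do rewrite big_nil; exact: cvg_cst.
rewrite big_cons; under eq_fun do rewrite big_cons.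
by apply: (@cvgD _ R^o) => //; exact: fl.
Qed.

Lemma cvg_harmonic_close {R : realType} (x : nat -> R) (l b : R) :
  (forall n, `|x n - l| <= b * n.+1%:R^-1)%R -> x n @[n --> \oo] --> l.
Proof.
move=> xl; have h0 : (b * n.+1%:R^-1 : R)%R @[n --> \oo] --> (b * 0)%R.
  by apply: (@cvgM R); [exact: cvg_cst | exact: cvg_harmonic].
rewrite mulr0 in h0.
apply: (@squeeze_cvgr _ _ _ _ (fun n => l - b * n.+1%:R^-1)%R (fun n => l + b * n.+1%:R^-1)%R).
- by apply: nearW => n; have := xl n; rewrite ler_distl.
- by rewrite -[X in _ --> X]subr0; apply: (@cvgB _ R^o); [exact: cvg_cst | exact: h0].
- by rewrite -[X in _ --> X]addr0; apply: (@cvgD _ R^o); [exact: cvg_cst | exact: h0].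
Qed.

Section Exhaustion.
Context {R : realType} {X : ptopologicalType}.
Hypothesis hX : hausdorff_space X.
Hypothesis lcX : locally_compact [set: X].
Variables (kappa : X -> X -> \bar R) (c : R).
Hypothesis kappa_noo : forall x y, kappa x y != -oo.
Hypothesis c0 : (0 <= c)%R.
Hypothesis cX : c = 0%R \/ compact [set: X].
Hypothesis kappa_posdef : positive_definite kappa.
Hypothesis kk : nonneg_kernel (shift_kernel kappa c).
Implicit Types (u v w : {measure set (borel X) -> \bar R}) (nu omega : set X -> R).

Let hh : nonneg_kernel (@cst_kernel R X c). Proof. exact: nonneg_kernel_cst. Qed.

Notation finite_pos := (finite_pos kappa c).
Notation bilin := (bilin kappa c).
Notation form := (form kappa).
Notation k := (shift_kernel kappa c).
Notation h := (@cst_kernel R X c).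

Lemma mrestr_split u (D B : set (borel X)) (mD : measurable D) : measurable B ->
  u B = (measure_add (mrestr u mD) (mrestr u (measurableC mD)) :
    {measure set (borel X) -> \bar R}) B.
Proof. by move=> mB; rewrite measure_addmE /= /mrestr addeC -setDE; exact: measureDI. Qed.

Lemma restriction_small (E : set X) u (f : borel X -> \bar R) (d : R) :
  pos_radon_on E u -> measurable_fun setT f -> (forall x, 0 <= f x) ->
  \int[u]_x f x < +oo -> (0 < d)%R ->
  exists (K : set X) (mK : measurable (K : set (borel X))),
  [/\ compact K, K `<=` E & \int[mrestr u (measurableC mK)]_x f x <= d%:E].
Proof.
move=> uE mf f0 ufin d0.
have uf : \int[u]_x f x \is a fin_num by rewrite ge0_fin_numE//; exact: integral_ge0.
have : \int[u]_x f x - d%:E < \int[u]_x f x.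
  by rewrite lteBlDr// -(fineK uf) -EFinD lte_fin ltrDl.
move=> /(integral_compact hX uE mf f0)[K [cK KE lt]].
have mK : measurable (K : set (borel X)) by exact: compact_borel.
exists K, mK; split => //.
have E1 : \int[u]_x f x = \int[mrestr u mK]_x f x + \int[mrestr u (measurableC mK)]_x f x.
  rewrite -ge0_integral_measure_add//; apply: eq_measure_integral => B mB _.
  exact: mrestr_split.
have le : \int[u]_(x in K) f x <= \int[mrestr u mK]_x f x.
  have -> : \int[u]_(x in K) f x = \int[mrestr u mK]_(x in K) f x.
    by apply: eq_measure_integral => B mB BK; rewrite /= /mrestr setIidl.
  exact: ge0_subset_integral.
have := lt_le_trans lt le; rewrite lteBlDr// E1.
have [f1 f2] : \int[mrestr u mK]_x f x \is a fin_num /\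
    \int[mrestr u (measurableC mK)]_x f x \is a fin_num.
  by move: uf; rewrite E1 fin_numD => /andP[].
by rewrite lteD2lE// => /ltW.
Qed.

(** Restriction lowers each of the two kernel integrals by an amount between 0 and [2 * d], so their
    difference moves by at most [2 * d] in either direction. *)
Lemma bilin_restr_close u v (D F : set (borel X)) (mD : measurable D) (mF : measurable F)
    (d : R) : finite_pos u -> finite_pos v ->
  (forall l, l = k \/ l = h ->
    kernel_integral l (mrestr u (measurableC mD)) v <= d%:E /\
    kernel_integral l (mrestr v (measurableC mF)) u <= d%:E) ->
  (`|bilin (mrestr u mD) (mrestr v mF) - bilin u v| <= 2 * d)%R.
Proof.
move=> uf vf small; have [ur _] := uf; have [vr _] := vf.
have rDu := radon_restr hX mD ur; have rFv := radon_restr hX mF vr.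
have rDu' := radon_restr hX (measurableC mD) ur; have rFv' := radon_restr hX (measurableC mF) vr.
have leD B : measurable B -> mrestr u mD B <= u B.
  by move=> mB; rewrite /mrestr le_measure ?inE//; exact: measurableI.
have leF B : measurable B -> mrestr v mF B <= v B.
  by move=> mB; rewrite /mrestr le_measure ?inE//; exact: measurableI.
have ksym : forall x y, k x y = k y x by exact: shift_kernel_sym.
have main l : nonneg_kernel l -> (forall x y, l x y = l y x) -> l = k \/ l = h ->
    kernel_integral l u v \is a fin_num ->
    kernel_integral l (mrestr u mD) (mrestr v mF) \is a fin_num /\
    (fine (kernel_integral l (mrestr u mD) (mrestr v mF)) <= fine (kernel_integral l u v)
      <= fine (kernel_integral l (mrestr u mD) (mrestr v mF)) + 2 * d)%R.
  move=> ll lsym lkh luv; have [s1 s2] := small l lkh.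
  have le1 : kernel_integral l (mrestr u mD) (mrestr v mF) <= kernel_integral l u v.
    exact: (le_kernel_integral_measure hX lcX ll rFv vr leD leF).
  have fin : kernel_integral l (mrestr u mD) (mrestr v mF) \is a fin_num.
    rewrite ge0_fin_numE; last exact: kernel_integral_ge0.
    by apply: le_lt_trans le1 _; move: luv; rewrite fin_numElt => /andP[].
  split => //; rewrite (fine_le fin luv le1)/=.
  have E1 : kernel_integral l u v = kernel_integral l (mrestr u mD) v +
      kernel_integral l (mrestr u (measurableC mD)) v.
    rewrite -(kernel_integral_addl hX lcX ll)//.
    by apply: eq_kernel_integral => // B mB; exact: mrestr_split.
  have E2 : kernel_integral l (mrestr u mD) v = kernel_integral l (mrestr u mD) (mrestr v mF) +
      kernel_integral l (mrestr u mD) (mrestr v (measurableC mF)).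
    rewrite -(kernel_integral_addr hX lcX ll)//.
    by apply: eq_kernel_integral => // B mB; exact: mrestr_split.
  have s3 : kernel_integral l (mrestr u mD) (mrestr v (measurableC mF)) <= d%:E.
    rewrite (kernel_integral_sym hX lcX ll lsym)//; apply: le_trans s2.
    exact: (le_kernel_integral_measure hX lcX ll rDu ur).
  rewrite -lee_fin (fineK luv) E1 E2 EFinD (fineK fin) -addeA leeD2l//.
  by rewrite (_ : (2 * d)%:E = d%:E + d%:E); [exact: leeD | rewrite -EFinD; congr EFin; ring].
have hh0 : nonneg_kernel h by exact: hh.
have fk : kernel_integral k u v \is a fin_num.
  rewrite ge0_fin_numE; last exact: kernel_integral_ge0.
  exact: (finite_pos_cross hX lcX kappa_noo c0 cX kappa_posdef kk uf vf).
have fh : kernel_integral h u v \is a fin_num by exact: (shift_integral_fin c0 cX ur vr).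
have [_ /andP[k1 k2]] := main k kk ksym (or_introl erefl) fk.
have [_ /andP[h1 h2]] := main h hh0 (fun _ _ => erefl) (or_intror erefl) fh.
by rewrite unlock ler_norml; apply/andP; split; lra.
Qed.

Section Plates.
Variables (m p : nat) (A : 'I_(m + p) -> set X).
Hypothesis A_condenser : condenser A.
Variables (a : 'I_(m + p) -> R) (g : X -> R).
Hypotheses (g_cont : continuous g) (g_gt0 : forall x, (0 < g x)%R).
Hypothesis a_gt0 : forall i, (0 < a i)%R.

Lemma compact_approximation lambda (x : R) : admissible kappa A a g lambda ->
  (form (signed_sum lambda) (signed_sum lambda) < x)%R ->
  exists K lambda', [/\ compact_condenser K, sub_condenser K A,
    admissible kappa K a g lambda' &
    (form (signed_sum lambda') (signed_sum lambda') < x)%R].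
Proof.
move=> ad lax.
have fp := admissible_finite hX lcX kappa_noo c0 cX kk A_condenser (fun i => @subset_refl _ (A i)) ad.
have [[laA laf] gla] := ad.
have mg : measurable_fun setT (fun y : borel X => (g y)%:E).
  by apply/measurable_EFinP; exact: continuous_borel.
have g0 y : 0 <= (g y)%:E by rewrite lee_fin ltW.
pose U j y := kernel_potential k (lambda j) y + kernel_potential h (lambda j) y.
have U0 j y : 0 <= U j y by apply: adde_ge0; exact: kernel_potential_ge0.
have mk l j : nonneg_kernel l -> measurable_fun setT (kernel_potential l (lambda j) : borel X -> \bar R).
  by move=> ll; apply: (kernel_potential_borel hX lcX ll); exact: (fp j).1.
have mU j : measurable_fun setT (U j : borel X -> \bar R).
  by apply: emeasurable_funD; exact: mk.
(* One integrand dominates [g] and all the potentials, for both kernels, so that a single compact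
   subset of each plate makes every error small at once. *)
pose f y := (g y)%:E + \sum_j U j y.
have S0 y : 0 <= \sum_j U j y by exact: sume_ge0.
have mS : measurable_fun setT (fun y : borel X => \sum_j U j y) by exact: emeasurable_sum.
have f0 y : 0 <= f y by exact: adde_ge0.
have mf : measurable_fun setT (f : borel X -> \bar R) by exact: emeasurable_funD.
have Ufin i j : \int[lambda i]_y U j y < +oo.
  rewrite ge0_integralD//; [|by move=> y _; exact: kernel_potential_ge0|exact: mk
    |by move=> y _; exact: kernel_potential_ge0|exact: mk].
  rewrite -!(kernel_integralE _ (lambda i) (lambda j)); apply: lte_add_pinfty.
    exact: (finite_pos_cross hX lcX kappa_noo c0 cX kappa_posdef kk (fp i) (fp j)).
  by have := shift_integral_fin c0 cX (fp i).1 (fp j).1; rewrite fin_numElt => /andP[].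
have ffin i : \int[lambda i]_y f y < +oo.
  rewrite ge0_integralD// gla ge0_integral_sum//.
  by apply: lte_add_pinfty; [rewrite ltry | apply: lte_sum_pinfty => j _; exact: Ufin].
pose d (n : nat) : R := (n.+1%:R^-1)%R.
have d0 n : (0 < d n)%R by rewrite /d invr_gt0 ltr0n.
have /choice[K_ K_P] : forall ni : nat * 'I_(m + p), exists K : {K : set X | measurable (K : set (borel X))},
    [/\ compact (sval K), sval K `<=` A ni.2 &
      \int[mrestr (lambda ni.2) (measurableC (svalP K))]_y f y <= (d ni.1)%:E].
  move=> [n i] /=.
  have [K [mK [cK KA le]]] := restriction_small (laA i) mf f0 (ffin i) (d0 n).
  by exists (exist _ K mK).
pose th n i : {measure set (borel X) -> \bar R} := mrestr (lambda i) (svalP (K_ (n, i))).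
pose th' n i : {measure set (borel X) -> \bar R} := mrestr (lambda i) (measurableC (svalP (K_ (n, i)))).
have thle n i B : measurable B -> th n i B <= lambda i B.
  move=> mB; rewrite /th /= /mrestr le_measure ?inE//.
  by apply: measurableI => //; exact: svalP.
have thf n i : finite_pos (th n i).
  apply: (le_finite_pos hX lcX kk (fp i)); last exact: thle.
  by apply: radon_restr => //; exact: (fp i).1.
have small_le n i (f' : borel X -> \bar R) : measurable_fun setT f' ->
    (forall y, 0 <= f' y) -> (forall y, f' y <= f y) ->
    \int[th' n i]_y f' y <= (d n)%:E.
  move=> mf' f'0 f'f; have [_ _ le] := K_P (n, i).
  by apply: le_trans le; apply: ge0_le_integral.
have small_pot l n i j : l = k \/ l = h -> kernel_integral l (th' n i) (lambda j) <= (d n)%:E.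
  move=> lkh; rewrite kernel_integralE.
  have ll : nonneg_kernel l by case: lkh => ->.
  apply: small_le; [exact: mk | by move=> y; exact: kernel_potential_ge0 | move=> y].
  apply: (@le_trans _ _ (U j y)).
    by case: lkh => ->; rewrite /U; [apply: leeDl|apply: leeDr]; exact: kernel_potential_ge0.
  rewrite /f (bigD1 j)//=; apply: (@le_trans _ _ (U j y + \sum_(i0 < m + p | i0 != j) U i0 y)).
    by apply: leeDl; exact: sume_ge0.
  exact: leeDr.
pose t n i : R := fine (\int[th n i]_y (g y)%:E).
have tE n i : \int[th n i]_y (g y)%:E \is a fin_num /\ (`|t n i - a i| <= 1 * d n)%R.
  have E1 : (a i)%:E = \int[th n i]_y (g y)%:E + \int[th' n i]_y (g y)%:E.
    rewrite -gla -ge0_integral_measure_add//; apply: eq_measure_integral => B mB _.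
    exact: mrestr_split.
  have sm : \int[th' n i]_y (g y)%:E <= (d n)%:E.
    by apply: small_le => // y; rewrite /f; exact: leeDl.
  have gg0 : 0 <= \int[th' n i]_y (g y)%:E by exact: integral_ge0.
  have [f1 f2] : \int[th n i]_y (g y)%:E \is a fin_num /\ \int[th' n i]_y (g y)%:E \is a fin_num.
    by have : (a i)%:E \is a fin_num by []; rewrite E1 fin_numD => /andP[].
  split => //; rewrite /t.
  move: E1 sm gg0; rewrite -{1}(fineK f1) -(fineK f2) -EFinD !lee_fin => -[->] ? ?.
  by rewrite ler_norml; apply/andP; split; lra.
have cvgt i : t n i @[n --> \oo] --> a i.
  by apply: (@cvg_harmonic_close _ _ _ 1) => n; exact: (tE n i).2.
have cvgb i j : bilin (th n i) (th n j) @[n --> \oo] --> bilin (lambda i) (lambda j).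
  apply: (@cvg_harmonic_close _ _ _ 2) => n.
  apply: bilin_restr_close => // l lkh; split; exact: small_pot.
(* The energy of the restrictions rescaled by [a i / t n i], the factor that restores the prescribed
   integrals of [g]. It tends to the energy of [lambda], since these factors tend to 1 and the
   mutual energies converge. *)
pose F n := (\sum_i \sum_j alpha i * alpha j *
   ((a i / t n i) * (a j / t n j) * bilin (th n i) (th n j)))%R.
have cvgr i : (a i / t n i)%R @[n --> \oo] --> (1 : R)%R.
  rewrite -[X in _ --> X](@divff _ (a i)); last by rewrite gt_eqF.
  apply: (@cvgM R); first exact: cvg_cst.
  by apply: cvgV; [rewrite gt_eqF | exact: cvgt].
have cvgF : F n @[n --> \oo] --> form (signed_sum lambda) (signed_sum lambda).
  rewrite (form_signed_sum hX lcX kappa_noo c0 cX kappa_posdef kk fp).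
  apply: cvg_sumr => i; apply: cvg_sumr => j.
  apply: (@cvgM R); first exact: cvg_cst.
  rewrite -[X in _ --> X]mul1r; apply: (@cvgM R) => //.
  by rewrite -[X in _ --> X]mulr1; apply: (@cvgM R).
have : \forall n \near \oo, (F n < x)%R /\ (forall i, (0 < t n i)%R).
  apply: filterS2 (_ : \forall n \near \oo, (F n < x)%R) (_ : \forall n \near \oo, forall i, (0 < t n i)%R).
  - by [].
  - by move/cvgrPdist_lt : cvgF => /(_ (x - form (signed_sum lambda) (signed_sum lambda))%R);
      rewrite subr_gt0 => /(_ lax); apply: filterS => n; rewrite ltr_norml => /andP[+ _]; lra.
  - apply: filter_forall => i; move/cvgrPdist_lt : (cvgt i) => /(_ _ (a_gt0 i)).
    by apply: filterS => n; rewrite ltr_norml => /andP[_]; lra.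
move=> [n _ /(_ n (leqnn n))[Fx t0]].
pose K i := sval (K_ (n, i)).
have r0 i : (0 <= a i / t n i)%R by rewrite divr_ge0// ltW.
pose la' i : {measure set (borel X) -> \bar R} := mscale (NngNum (r0 i)) (th n i).
have la'f i : finite_pos (la' i) by exact: (finite_pos_scale hX lcX kk (NngNum (r0 i)) (thf n i)).
have KA : sub_condenser K A by move=> i; have [] := K_P (n, i).
exists K, la'; split => //.
- split; last by move=> i; have [] := K_P (n, i).
  split=> [i|i j im mj].
    (* An empty [K i] would carry no mass, against [t n i > 0]. *)
    apply/set0P/eqP => K0; have := t0 i; rewrite /t.
    rewrite (_ : \int[th n i]_y (g y)%:E = 0) ?ltxx//.
    rewrite (@eq_measure_integral _ _ _ _ mzero) ?integral_measure_zero// => B mB _.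
    by rewrite /th /= /mrestr -/(K i) K0 setI0 measure0.
  rewrite -subset0 -(A_condenser.2 i j im mj).
  by move=> z [zi zj]; split; apply: closureS; [exact: KA | | exact: KA | ].
- split; first split.
  + move=> i; apply: pos_radon_on_scale => //; split; first exact: (thf n i).1.
    move=> L cL; exists (~` K i); split.
    * by apply: measurableC; exact: svalP.
    * by rewrite /th /= /mrestr -/(K i) setICl measure0.
    * by move=> z [_].
  + exact: (signed_sum_finite hX lcX kappa_noo c0 cX kappa_posdef kk).
  + move=> i; rewrite ge0_integral_mscale// -(fineK (tE n i).1) -/(t n i) -EFinM /=.
    by rewrite divfK// gt_eqF.
- rewrite (form_signed_sum hX lcX kappa_noo c0 cX kappa_posdef kk la'f).
  apply: le_lt_trans Fx; rewrite le_eqVlt; apply/orP; left; apply/eqP.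
  apply: eq_bigr => i _; apply: eq_bigr => j _; congr (_ * _)%R.
  have bs := bilin_scalel hX lcX kappa_noo c0 cX kappa_posdef kk.
  have bsym := bilin_sym hX lcX c0 kappa_posdef kk.
  rewrite /la' bs//; last exact: la'f.
  rewrite bsym; [|exact: (thf n i).1|exact: (la'f j).1].
  rewrite bs// bsym; [|exact: (thf n j).1|exact: (thf n i).1].
  by rewrite /= mulrA.
Qed.

End Plates.
End Exhaustion.

(** * Dual minimizers and capacitary distributions *)

Section CapacitaryDistributions.
Context {R : realType} {X : ptopologicalType}.
Hypothesis hX : hausdorff_space X.
Hypothesis lcX : locally_compact [set: X].
Variables (kappa : X -> X -> \bar R) (c : R).
Hypothesis kappa_noo : forall x y, kappa x y != -oo.
Hypothesis c0 : (0 <= c)%R.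
Hypothesis cX : c = 0%R \/ compact [set: X].
Hypothesis kappa_posdef : positive_definite kappa.
Hypothesis kk : nonneg_kernel (shift_kernel kappa c).
Implicit Types (u v w : {measure set (borel X) -> \bar R}) (nu omega : set X -> R).

Notation finite_pos := (finite_pos kappa c).
Notation form := (form kappa).

Let fe_pos := finite_energy_pos hX lcX kappa_noo c0 cX kappa_posdef kk.
Let feB := finite_energyB hX lcX kappa_noo c0 cX kappa_posdef kk.
Let feZ := finite_energyZ hX lcX kappa_noo c0 cX kappa_posdef kk.
Let f_ge0 := form_ge0 hX lcX kappa_noo c0 cX kappa_posdef kk.
Let f_sqB := form_sqB hX lcX kappa_noo c0 cX kappa_posdef kk.
Let f_sym := form_sym hX lcX kappa_noo c0 cX kappa_posdef kk.
Let fBl := formBl hX lcX kappa_noo c0 cX kappa_posdef kk.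
Let fZl := formZl hX lcX kappa_noo c0 cX kappa_posdef kk.
Let energyE := energy_form hX lcX kappa_noo c0 cX kappa_posdef kk.

Variables (m p : nat) (A : 'I_(m + p) -> set X).
Hypothesis A_condenser : condenser A.
Variables (a : 'I_(m + p) -> R) (g : X -> R).
Hypotheses (g_cont : continuous g) (g_gt0 : forall x, (0 < g x)%R).
Hypothesis a_gt0 : forall i, (0 < a i)%R.

Definition plate_constraint nu (i : 'I_(m + p)) (q : R) :=
  nearly_everywhere kappa (A i) (fun x => potential_defined kappa x nu /\
    (q * g x)%:E <= (alpha i * a i)%:E * potential kappa x nu).

Lemma admissible_form_scale (r : R) nu lambda : finite_energy kappa nu ->
  finite_energy kappa lambda ->
  form ((fun B => r * lambda B) \- nu)%R ((fun B => r * lambda B) \- nu)%R =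
  (r ^+ 2 * form lambda lambda - 2 * r * form lambda nu + form nu nu)%R.
Proof.
move=> nuf laf; rewrite (f_sqB (feZ r laf) nuf) (fZl r laf nuf) (fZl r laf (feZ r laf)).
by rewrite (f_sym laf (feZ r laf)) (fZl r laf laf); ring.
Qed.

Lemma form_equivalent nu omega lambda : finite_energy kappa nu ->
  finite_energy kappa omega -> finite_energy kappa lambda ->
  form (nu \- omega)%R (nu \- omega)%R = 0%R -> form lambda nu = form lambda omega.
Proof.
move=> nuf omf laf eqv; have df := feB nuf omf.
have := form_null hX lcX kappa_noo c0 cX kappa_posdef kk laf df eqv.
rewrite (f_sym laf df) (fBl nuf omf laf) (f_sym nuf laf) (f_sym omf laf).
by lra.
Qed.

Lemma min_energy_cap (C : R) (K : 'I_(m + p) -> set X) : (0 < C)%R -> cap kappa K a g = C%:E ->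
  min_energy kappa K a g = (C^-1)%:E.
Proof.
move=> C_gt0; rewrite /cap => /(congr1 inve); rewrite inveK => ->.
by rewrite inver gt_eqF.
Qed.

Lemma near_minimizer (C : R) (K : 'I_(m + p) -> set X) (e : R) : (0 < C)%R -> cap kappa K a g = C%:E ->
  (0 < e)%R -> exists2 lambda, admissible kappa K a g lambda &
    (form (signed_sum lambda) (signed_sum lambda) < C^-1 + e)%R.
Proof.
move=> C_gt0 capK e0.
have : min_energy kappa K a g < (C^-1 + e)%:E by rewrite (min_energy_cap C_gt0 capK) lte_fin ltrDl.
move=> /ereal_inf_ltP[_ [la ad <-]]; have [[_ laf] _] := ad.
by rewrite energyE// lte_fin => ?; exists la.
Qed.

Section Capacity.
Variables (C : R).
Hypothesis C_gt0 : (0 < C)%R.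

Hypothesis capA : cap kappa A a g = C%:E.

Let AA : sub_condenser A A. Proof. by move=> i x. Qed.

Lemma dual_form_ge1 lambda nu (q : 'I_(m + p) -> R) :
  admissible kappa A a g lambda -> finite_energy kappa nu ->
  (forall i, plate_constraint nu i (q i)) ->
  (\sum_i q i <= form (signed_sum lambda) nu)%R.
Proof.
move=> ad nuf ne; rewrite -[leLHS]mulr1.
apply: (dual_form_ge hX lcX kappa_noo c0 cX kappa_posdef kk A_condenser g_cont g_gt0 a_gt0 AA) => //.
by under eq_fun do rewrite mulr1.
Qed.

(* Both measures are strong limits of [C * lambda_n], where [lambda_n] is a
   minimizing sequence for the primal problem. *)
Lemma dual_minimizers_equivalent nu omega (q r : 'I_(m + p) -> R) :
  finite_energy kappa nu -> finite_energy kappa omega ->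
  form nu nu = C -> form omega omega = C ->
  (forall i, plate_constraint nu i (q i)) -> (1 <= \sum_i q i)%R ->
  (forall i, plate_constraint omega i (r i)) -> (1 <= \sum_i r i)%R ->
  form (nu \- omega)%R (nu \- omega)%R = 0%R.
Proof.
move=> nuf omf nuC omC nuq q1 omr r1; apply/eqP; rewrite eq_le.
rewrite (f_ge0 (feB nuf omf)) andbT; apply/ler_addgt0Pr => e e0; rewrite add0r.
(* After scaling by [C] the slack becomes [e / 4], and [form_parallelogram] doubles two such
   bounds. *)
have e'0 : (0 < e / (4 * C ^+ 2))%R by rewrite divr_gt0// mulr_gt0// exprn_gt0.
have [la ad lae] := near_minimizer C_gt0 capA e'0; have [[_ laf] _] := ad.
have clf := feZ C laf.
have bound sigma : finite_energy kappa sigma -> form sigma sigma = C ->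
    (1 <= form (signed_sum la) sigma)%R ->
    (form ((fun B => C * signed_sum la B) \- sigma)
          ((fun B => C * signed_sum la B) \- sigma) <= e / 4)%R.
  move=> sf sC s1; rewrite admissible_form_scale// sC.
  have h1 : (C ^+ 2 * form (signed_sum la) (signed_sum la) <= C ^+ 2 * (C^-1 + e / (4 * C ^+ 2)))%R.
    by rewrite ler_pM2l ?exprn_gt0// ltW.
  have h2 : (C * 1 <= C * form (signed_sum la) sigma)%R by rewrite ler_pM2l.
  have h3 : (C ^+ 2 * (C^-1 + e / (4 * C ^+ 2)) = C + e / 4)%R by field; rewrite gt_eqF.
  by rewrite -mulrA; lra.
have := form_parallelogram hX lcX kappa_noo c0 cX kappa_posdef kk nuf omf clf.
have := bound _ nuf nuC (le_trans q1 (dual_form_ge1 ad nuf nuq)).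
have := bound _ omf omC (le_trans r1 (dual_form_ge1 ad omf omr)).
by lra.
Qed.

(** For a near-minimizer [lambda], the squared norm of [C * lambda - nu] is nonnegative and at most
    [(C + e) - 2 * C + form nu nu]. *)
Lemma dual_energy_ge nu (q : 'I_(m + p) -> R) : finite_energy kappa nu ->
  (forall i, plate_constraint nu i (q i)) -> (1 <= \sum_i q i)%R ->
  (C <= form nu nu)%R.
Proof.
move=> nuf nuq q1; apply/ler_addgt0Pr => e e0.
have e'0 : (0 < e / C ^+ 2)%R by rewrite divr_gt0// exprn_gt0.
have [la ad lae] := near_minimizer C_gt0 capA e'0; have [[_ laf] _] := ad.
have := f_ge0 (feB (feZ C laf) nuf); rewrite admissible_form_scale//.
have h1 : (C ^+ 2 * form (signed_sum la) (signed_sum la) <= C ^+ 2 * (C^-1 + e / C ^+ 2))%R.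
  by rewrite ler_pM2l ?exprn_gt0// ltW.
have h2 : (C * 1 <= C * form (signed_sum la) nu)%R.
  by rewrite ler_pM2l//; exact: le_trans q1 (dual_form_ge1 ad nuf nuq).
have h3 : (C ^+ 2 * (C^-1 + e / C ^+ 2) = C + e)%R by field; rewrite gt_eqF.
by rewrite -mulrA; lra.
Qed.

Lemma constraint_le nu omega (r : 'I_(m + p) -> R) (i : 'I_(m + p)) (q : R) :
  finite_energy kappa nu -> finite_energy kappa omega ->
  form omega omega = C -> (forall j, plate_constraint omega j (r j)) ->
  (\sum_j r j = 1)%R ->
  form (nu \- omega)%R (nu \- omega)%R = 0%R -> plate_constraint nu i q ->
  (q <= r i)%R.
Proof.
move=> nuf omf omC omr r1 eqv nuq; apply/ler_addgt0Pr => e e0.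
(* With this slack, nonnegativity of the squared norm of [C * la - omega], divided by [C], gives
   [form (signed_sum la) omega <= 1 + e], which meets the lower bound [q + (1 - r i)]. *)
have e'0 : (0 < 2 * e / C)%R by rewrite divr_gt0// mulr_gt0.
have [la ad lae] := near_minimizer C_gt0 capA e'0; have [[_ laf] _] := ad.
have ad1 : admissible kappa A (fun i => a i * 1)%R g la by under eq_fun do rewrite mulr1.
have fp := admissible_finite hX lcX kappa_noo c0 cX kk A_condenser AA ad.
have pd sigma j b : finite_energy kappa sigma -> plate_constraint sigma j b ->
    (b <= alpha j * form (signed_of (la j)) sigma)%R.
  move=> sf sb; rewrite -[leLHS]mulr1.
  exact: (plate_duality hX lcX kappa_noo c0 cX kappa_posdef kk A_condenser g_cont g_gt0 a_gt0 AA ad1 sf sb).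
have lower : (q + (1 - r i) <= form (signed_sum la) omega)%R.
  rewrite (form_signed_suml hX lcX kappa_noo c0 cX kappa_posdef kk fp omf) -r1.
  rewrite (bigD1 i)//= [leRHS](bigD1 i)//= [X in (X - _)%R]addrC addrK lerD//.
    by rewrite -(form_equivalent nuf omf (fe_pos (fp i)) eqv); exact: pd.
  by apply: ler_sum => j _; exact: pd.
have := f_ge0 (feB (feZ C laf) omf); rewrite admissible_form_scale// omC.
have h1 : (C * form (signed_sum la) (signed_sum la) <= C * (C^-1 + 2 * e / C))%R.
  by rewrite ler_pM2l// ltW.
have h3 : (C * (C^-1 + 2 * e / C) = 1 + 2 * e)%R by field; rewrite gt_eqF.
rewrite (_ : _ + C = C * (C * form (signed_sum la) (signed_sum la)
  - 2 * form (signed_sum la) omega + 1))%R; last by ring.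
by rewrite pmulr_rge0//; lra.
Qed.

Lemma exhausting_capacity (e : R) : (0 < e)%R ->
  exists K, compact_subcondenser kappa A a g K /\ (C - e)%:E <= cap kappa K a g.
Proof.
move=> e0; have e'0 : (0 < e / C ^+ 2)%R by rewrite divr_gt0// exprn_gt0.
have [la ad lae] := near_minimizer C_gt0 capA e'0.
have [K [la' [cK KA ad' lt]]] := compact_approximation hX lcX kappa_noo c0 cX kappa_posdef kk
  A_condenser g_cont g_gt0 a_gt0 ad lae.
have [[_ la'f] _] := ad'.
have minge0 : 0 <= min_energy kappa K a g.
  apply/ereal_infP => _ [la2 [[_ la2f] _] <-].
  by rewrite energyE// lee_fin f_ge0.
have minle : min_energy kappa K a g <= (C^-1 + e / C ^+ 2)%:E.
  apply: (@le_trans _ _ (energy kappa (signed_sum la'))).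
    by apply: ereal_inf_lbound; exists la'.
  by rewrite energyE// lee_fin ltW.
have [x xE] : exists x : R, min_energy kappa K a g = x%:E.
  move: minge0 minle; case: (min_energy kappa K a g) => [x _ _|_|//]; first by exists x.
  by rewrite leye_eq.
move: minge0 minle; rewrite xE !lee_fin => x0 xle.
(* The product of [C - e] with [C^-1 + e / C ^+ 2] is [1 - (e / C) ^+ 2]; this is why the slack was
   chosen as [e / C ^+ 2]. *)
have Cle : (C - e <= (C^-1 + e / C ^+ 2)^-1)%R.
  have y0 : (0 < C^-1 + e / C ^+ 2)%R by rewrite addr_gt0// invr_gt0.
  rewrite -[leRHS]mul1r ler_pdivlMr//.
  rewrite (_ : _ * _ = 1 - (e / C) ^+ 2)%R; last by field; rewrite gt_eqF.
  by rewrite gerBl sqr_ge0.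
(* If the minimum [x] is 0, the convention for the inverse makes the capacity [+oo] and the bound is
   immediate. *)
exists K; rewrite /compact_subcondenser /cap xE inver; case: ifPn => [_|xn0].
  by split; [split => // | exact: leey].
have {}x0 : (0 < x)%R by rewrite lt_def xn0.
split; first by split => //; rewrite lte_fin invr_gt0.
by rewrite lee_fin (le_trans Cle)// lef_pV2 ?posrE// (lt_le_trans x0).
Qed.

Lemma inve_le (x y : \bar R) : 0 <= x -> x <= y -> y^-1 <= x^-1.
Proof.
case: x => [x| |//]; case: y => [y| |//].
- rewrite !lee_fin !inver => x0 xy; case: eqP => [y0|/eqP yn0].
    by case: eqP => // /eqP xn0; move: xn0; rewrite eq_le x0 andbT -{1}y0 xy.
  case: eqP => [_|/eqP xn0]; first exact: leey.
  have x0' : (0 < x)%R by rewrite lt_def xn0.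
  by rewrite lee_fin lef_pV2 ?posrE// (lt_le_trans x0').
- by move=> x0 _; rewrite invey inve_ge0.
- by move=> _; rewrite leye_eq.
- by [].
Qed.

Lemma le_cap (K L : 'I_(m + p) -> set X) : sub_condenser K L ->
  cap kappa K a g <= cap kappa L a g.
Proof.
move=> KL; apply: inve_le.
  apply/ereal_infP => _ [la [[_ laf] _] <-].
  by rewrite energyE// lee_fin f_ge0.
apply: ereal_inf_le_tmp => _ [la [[laK laf] gla] <-].
exists la => //; split => //; split => // i; exact: pos_radon_onS (KL i) (laK i).
Qed.

(** Write [D] for the capacity of [K]. Near-minimizers with masses [a i], scaled by [D], show that
    [lambda] has energy at most [D]; [dual_form_ge] with [t = D] shows that its mutual energy with
    [omega] is at least [D]. Hence the bound [D - 2 * D + C]. *)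
Lemma minimizer_close (K : 'I_(m + p) -> set X) omega (r : 'I_(m + p) -> R) lambda :
  compact_subcondenser kappa A a g K ->
  minimizers kappa K (fun i => a i * fine (cap kappa K a g))%R g lambda ->
  finite_energy kappa omega -> form omega omega = C ->
  (forall j, plate_constraint omega j (r j)) -> (\sum_j r j = 1)%R ->
  finite_energy kappa (signed_sum lambda) /\
  (form (signed_sum lambda \- omega) (signed_sum lambda \- omega)
   <= C - fine (cap kappa K a g))%R.
Proof.
move=> [_ KA capK0] [ad lamin] omf omC omr r1; have [[_ laf] _] := ad.
split => //; have capKC := le_cap KA; rewrite capA in capKC.
have [D D0 capK] : exists2 D : R, (0 < D)%R & cap kappa K a g = D%:E.
  move: capK0 capKC; case: (cap kappa K a g) => [D|_|//]; last by rewrite leye_eq.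
  by rewrite lte_fin => D0 _; exists D.
rewrite capK /= in ad lamin *.
have laD : (form (signed_sum lambda) (signed_sum lambda) <= D)%R.
  apply/ler_addgt0Pr => e e0.
  have e'0 : (0 < e / D ^+ 2)%R by rewrite divr_gt0// exprn_gt0.
  have [la ad' lae] := near_minimizer D0 capK e'0.
  pose D' : {nonneg R} := NngNum (ltW D0).
  have adD := admissible_scale hX lcX kappa_noo c0 cX kappa_posdef kk A_condenser
    g_cont g_gt0 D' KA ad'.
  have [[_ la'f] _] := ad'; have [[_ scf] _] := adD.
  have : energy kappa (signed_sum lambda) <= energy kappa (signed_sum (fun i => mscale D' (la i))).
    by rewrite lamin; apply: ereal_inf_lbound; exists (fun i => mscale D' (la i)).
  rewrite !energyE// lee_fin signed_sum_scale => /le_trans; apply.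
  rewrite (fZl _ la'f (feZ _ la'f)) (f_sym la'f (feZ _ la'f)) (fZl _ la'f la'f) /=.
  have h1 : (D ^+ 2 * form (signed_sum la) (signed_sum la) <= D ^+ 2 * (D^-1 + e / D ^+ 2))%R.
    by rewrite ler_pM2l ?exprn_gt0// ltW.
  have h3 : (D ^+ 2 * (D^-1 + e / D ^+ 2) = D + e)%R by field; rewrite gt_eqF.
  by rewrite mulrA -expr2; lra.
have := dual_form_ge hX lcX kappa_noo c0 cX kappa_posdef kk A_condenser g_cont g_gt0 a_gt0 KA ad omf omr.
rewrite r1 mul1r (f_sqB laf omf) omC; lra.
Qed.

Lemma distribution_equivalent gamma omega (r : 'I_(m + p) -> R) :
  capacitary_distributions kappa A a g gamma ->
  finite_energy kappa omega -> form omega omega = C ->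
  (forall j, plate_constraint omega j (r j)) -> (\sum_j r j = 1)%R ->
  energy kappa (omega \- signed_sum gamma)%R = 0.
Proof.
move=> [[_ gf] [S [le [K_ [la_ [dir sub cof mins [_ str]]]]]]] omf omC omr r1.
have df := feB omf gf; rewrite energyE//; congr EFin; apply/eqP.
rewrite eq_le f_ge0// andbT; apply/ler_addgt0Pr => e e0; rewrite add0r.
(* An index beyond both [s0] and [s1] brings [la_ s] within squared distance [e / 4] of [omega], by
   monotonicity of the capacity, and of [gamma], by strong convergence. [form_parallelogram] then
   gives [e]. *)
have e4 : (0 < e / 4)%R by rewrite divr_gt0.
have [K [subK capK]] := exhausting_capacity e4.
have [s0 s0P] := cof K subK.
have [s1 _ s1P] : tails le [set s | energy kappa (signed_sum (la_ s) \- signed_sum gamma)%R < (e / 4)%:E].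
  have nb : nbhs (0 : \bar R) [set y | y < (e / 4)%:E].
    apply: open_nbhs_nbhs; split; last by rewrite /= lte_fin.
    exact: open_ereal_lt_ereal.
  exact: (str _ nb).
have [_ refl trans updir] := dir.
have [s [s0s s1s]] := updir s0 s1.
have [lasf close] := minimizer_close (sub s) (mins s) omf omC omr r1.
have close2 := s1P s s1s; rewrite /= energyE ?lte_fin in close2; last exact: feB.
have capKs := le_trans capK (le_cap (s0P s s0s)).
have capKsC : cap kappa (K_ s) a g <= C%:E by rewrite -capA; apply: le_cap; have [] := sub s.
have capfin : (C - e / 4 <= fine (cap kappa (K_ s) a g))%R.
  move: capKs capKsC; case: (cap kappa (K_ s) a g) => [x|_|//]; last by rewrite leye_eq.
  by rewrite lee_fin.
have := form_parallelogram hX lcX kappa_noo c0 cX kappa_posdef kk omf gf lasf.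
by lra.
Qed.

End Capacity.
End CapacitaryDistributions.
Unset Implicit Arguments.

Theorem proposition1 (R : realType) (X : ptopologicalType)
  (Xhausdorff : hausdorff_space X) (Xlc : locally_compact [set: X])
  (kappa : X -> X -> \bar R)
  (kappa_kernel : lsc_kernel kappa) (kappa_consistent : consistent kappa)
  (g : X -> R) (g_cont : continuous g) (g_gt0 : forall x, (0 < g x)%R)
  (m p : nat) (m_ge1 : (1 <= m)%N)
  (a : 'I_(m + p) -> R) (a_gt0 : forall i, (0 < a i)%R)
  (A : 'I_(m + p) -> set X) (A_condenser : condenser A)
  (cap_gt0 : 0 < cap kappa A a g) (cap_fin : cap kappa A a g < +oo)
  (Ag : p = 0%N \/
    (0 < ereal_inf [set (g x)%:E | x in plates A] /\
     ereal_sup [set kappa x y | x in pos_plates A & y in neg_plates A] < +oo))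
  (mu : vmeasure R X m p)
  (mu_energy : vfinite_energy kappa (closure_condenser A) mu)
  (mu_norm : energy kappa (signed_sum mu) = cap kappa A a g)
  (mu_potential : forall i : 'I_(m + p), nearly_everywhere kappa (A i) (fun x =>
     potential_defined kappa x (signed_sum mu) /\
     (alpha i)%:E * mutual_energy kappa (signed_of (mu i)) (signed_sum mu)
       / cap kappa A a g * (g x)%:E
     <= (alpha i * a i)%:E * potential kappa x (signed_sum mu))) :
  (forall gamma, capacitary_distributions kappa A a g gamma ->
     equivalent kappa mu gamma) /\
  exists2 C : 'I_(m + p) -> R,
    unique (capacitary_constants kappa A a g) C &
    forall i : 'I_(m + p),
      (C i)%:E = (alpha i)%:E
        * mutual_energy kappa (signed_of (mu i)) (signed_sum mu)
        / cap kappa A a g /\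
      (alpha i)%:E * mutual_energy kappa (signed_of (mu i)) (signed_sum mu)
        / cap kappa A a g
      = ne_inf kappa (A i)
          (fun x => potential_defined kappa x (signed_sum mu))
          (fun x => (alpha i * a i)%:E * potential kappa x (signed_sum mu)
                    / (g x)%:E).
Proof.
have [kl kappa_noo _] := kappa_kernel; have [kappa_posdef _] := kappa_consistent.
have [c [c0 cX kk]] := lsc_kernel_shift kappa_kernel.
have feB := finite_energyB Xhausdorff Xlc kappa_noo c0 cX kappa_posdef kk.
have energyE := energy_form Xhausdorff Xlc kappa_noo c0 cX kappa_posdef kk.
have [C C_gt0 capA] : exists2 C : R, (0 < C)%R & cap kappa A a g = C%:E.
  move: cap_gt0 cap_fin; case: (cap kappa A a g) => [C|//|//].
  by rewrite lte_fin => C0 _; exists C.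
pose omega := signed_sum mu.
have [muA omf] := mu_energy.
have fp := component_finite Xhausdorff Xlc kappa_noo c0 cX kk A_condenser muA omf.
have compf i := finite_energy_pos Xhausdorff Xlc kappa_noo c0 cX kappa_posdef kk (fp i).
have omC : form kappa omega omega = C.
  by move: mu_norm; rewrite energyE// capA => -[].
pose r i := (alpha i * form kappa (signed_of (mu i)) omega / C)%R.
have rE i : (alpha i)%:E * mutual_energy kappa (signed_of (mu i)) (signed_sum mu)
    / cap kappa A a g = (r i)%:E.
  rewrite (mutual_energy_form Xhausdorff Xlc kappa_noo c0 cX kappa_posdef kk (compf i) omf).
  by rewrite capA inver gt_eqF.
(* The numbers [alpha i * form (signed_of (mu i)) omega] add up to the energy of [omega], which is
   [C]. *)
have r1 : (\sum_i r i = 1)%R.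
  rewrite -mulr_suml -(form_signed_suml Xhausdorff Xlc kappa_noo c0 cX kappa_posdef kk fp omf).
  by rewrite omC divff// gt_eqF.
have r1' : (1 <= \sum_i r i)%R by rewrite r1.
have omr i : plate_constraint kappa A a g omega i (r i).
  have := mu_potential i; rewrite /plate_constraint; congr nearly_everywhere.
  by apply/funext => x; rewrite rE.
have ubound nu i q : finite_energy kappa nu ->
    form kappa (nu \- omega)%R (nu \- omega)%R = 0%R ->
    plate_constraint kappa A a g nu i q -> (q <= r i)%R.
  move=> nuf eqv nuq.
  exact: (constraint_le Xhausdorff Xlc kappa_noo c0 cX kappa_posdef kk A_condenser
    g_cont g_gt0 a_gt0 C_gt0 capA nuf omf omC omr r1 eqv nuq).
have om0 : form kappa (omega \- omega)%R (omega \- omega)%R = 0%R.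
  rewrite (form_sqB Xhausdorff Xlc kappa_noo c0 cX kappa_posdef kk omf omf); ring.
(* There is no duality gap: [omega] lies in the dual class with energy [C], the least possible by
   [dual_energy_ge]. *)
have infE : ereal_inf [set energy kappa nu | nu in dual_class kappa A a g] = C%:E.
  apply/eqP; rewrite eq_le; apply/andP; split.
    apply: ereal_inf_lbound; exists omega; last by rewrite energyE// omC.
    by split => //; exists r; split; [exact: omr | exact: r1'].
  apply/ereal_infP => _ [nu [nuf [q [nuq q1]]] <-]; rewrite energyE// lee_fin.
  exact: (dual_energy_ge Xhausdorff Xlc kappa_noo c0 cX kappa_posdef kk A_condenser
    g_cont g_gt0 a_gt0 C_gt0 capA nuf nuq q1).
split.
  move=> gamma gammaD.
  exact: (distribution_equivalent Xhausdorff Xlc kappa_noo c0 cX kappa_posdef kk A_condenser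
    g_cont g_gt0 a_gt0 C_gt0 capA gammaD omf omC omr r1).
exists r.
  split.
    exists omega; split.
    - by split => //; exists r; split; [exact: omr | exact: r1'].
    - by rewrite infE energyE// omC.
    - by split; [exact: omr | exact: r1'].
  move=> q [nu [[nuf _] nuE [nuq q1]]].
  have nuC : form kappa nu nu = C by move: nuE; rewrite infE energyE// => -[].
  have eqv := dual_minimizers_equivalent Xhausdorff Xlc kappa_noo c0 cX kappa_posdef kk
    A_condenser g_cont g_gt0 a_gt0 C_gt0 capA nuf omf nuC omC nuq q1 omr r1'.
  have qr i : (q i <= r i)%R by exact: ubound nuf eqv (nuq i).
  (* Termwise [q i <= r i], while the [q i] add up to at least 1 and the [r i] to exactly 1; so no
     term can be strict. *)
  have sum0 : (\sum_i (r i - q i) = 0)%R.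
    apply/eqP; rewrite eq_le sumr_ge0 ?andbT => [|i _]; last by rewrite subr_ge0.
    by rewrite sumrB r1 subr_le0.
  apply/funext => i; apply/eqP; rewrite -subr_eq0; apply/eqP.
  by apply: (psumr_eq0P _ sum0) => // j _; rewrite subr_ge0.
move=> i; rewrite rE; split => //.
have ineqE q x : (q%:E <= (alpha i * a i)%:E * potential kappa x (signed_sum mu) / (g x)%:E)
    = ((q * g x)%:E <= (alpha i * a i)%:E * potential kappa x (signed_sum mu)).
  by rewrite inver gt_eqF// lee_pdivlMr// EFinM.
apply/eqP; rewrite eq_le; apply/andP; split.
  apply: ereal_sup_ubound; exists (r i) => //=.
  have := omr i; rewrite /plate_constraint; congr nearly_everywhere.
  by apply/funext => x; rewrite ineqE.
(* The bound on admissible constants is applied to [omega] itself, which is trivially equivalent to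
   [omega] by [om0]. *)
apply/ereal_supP => _ [q qne <-]; rewrite lee_fin; apply: (ubound omega) => //.
move: qne; rewrite /plate_constraint /=; congr nearly_everywhere.
by apply/funext => x; rewrite ineqE.
Qed.
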